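(* Let $V\colon\mathbb T^1\to\mathbb R$ be a $C^1$ function and let $g_V\colon\mathbb T^2\to\mathbb T^2$ be the associated generalized standard map $$g_V(y_1,y_2)=\bigl(y_1+y_2+V(y_1),\,y_2+V(y_1)\bigr)\pmod 1.$$ Let $(\omega_n)_{n\ge0}$ be i.i.d. $\mathbb T^2$-valued random variables with common distribution $\nu$, and assume that $\nu$ is either absolutely continuous with respect to $m$ or a vertical line measure. Let $F_\omega^n=f_{\omega_{n-1}}\circ\cdots\circ f_{\omega_0}$ be the random compositions of the maps $f_x(y)=g_V(y)+x$. Then the Lyapunov exponents $\lambda^+$ and $\lambda^-$ of the random compositions $F_\omega^n$ are non-zero $(\rho_\nu\times m)$-almost everywhere if $V$ is non-constant, and vanish $(\rho_\nu\times m)$-almost everywhere otherwise.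
   Context: $\mathbb T^k=\mathbb R^k/\mathbb Z^k$; $m$ is the normalized Haar measure on $\mathbb T^2$ and $m_1$ that on $\mathbb T^1$. A Borel probability measure $\nu$ on $\mathbb T^2$ is a vertical line measure if $\nu=\delta_0\times\chi$, where $\delta_0$ is the Dirac measure at $0\in\mathbb T^1$ and $\chi=h\,m_1$ is absolutely continuous with respect to $m_1$. $\Omega=(\mathbb T^2)^{\mathbb N}$ ($\mathbb N$ includes $0$), $\omega=(\omega_n)_{n\ge0}\in\Omega$, and $\rho_\nu=\nu^{\mathbb N}$. The Lyapunov exponents at $(\omega,y)\in\Omega\times\mathbb T^2$ are $$\lambda^+(\omega,y)=\limsup_{n\to\infty}\frac1n\log\|DF_\omega^n(y)\|,\qquad\lambda^-(\omega,y)=-\limsup_{n\to\infty}\frac1n\log\|(DF_\omega^n(y))^{-1}\|.$$ *)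

(* Defs.v *)
From HB Require Import structures.
From mathcomp Require Import all_boot all_order all_algebra ring_quotient ring lra.
From mathcomp Require Import all_classical all_reals all_analysis.

Set Implicit Arguments.
Unset Strict Implicit.
Unset Printing Implicit Defensive.

Import Order.TTheory GRing.Theory Num.Theory.
Import numFieldNormedType.Exports.

Local Open Scope classical_set_scope.
Local Open Scope ring_scope.

(* The group R / Z; [Num.int_num_subdef] is the predicate behind [Num.int]. *)
Definition circle_group (R : realType) : Type :=
  @Quotient.quot R (@Num.int_num_subdef R : {pred R}).

HB.instance Definition _ (R : realType) := GRing.Zmodule.on (circle_group R).
HB.instance Definition _ (R : realType) := isPointed.Build (circle_group R) 0.

Definition circle_pi (R : realType) (t : R) : circle_group R :=
  (\pi_(@Quotient.quot R (@Num.int_num_subdef R : {pred R})) t)%qT.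

Lemma circle_pi_eq (R : realType) (s t : R) :
  circle_pi s = circle_pi t <-> s - t \is a Num.int.
Proof. by split => [/eqP|h]; [|apply/eqP]; rewrite piE. Qed.

Lemma circle_piD (R : realType) (s t : R) :
  circle_pi (s + t) = circle_pi s + circle_pi t.
Proof. by rewrite /circle_pi -pi_addr. Qed.

(* Open sets of the quotient topology. *)
Definition circle_open (R : realType) : set (set (circle_group R)) :=
  [set U | open (@circle_pi R @^-1` U)].

Definition circle (R : realType) : Type :=
  g_sigma_algebraType (@circle_open R).

HB.instance Definition _ (R : realType) := GRing.Zmodule.on (circle R).
HB.instance Definition _ (R : realType) := Measurable.on (circle R).

Definition torus (R : realType) : Type := (circle R * circle R)%type.

HB.instance Definition _ (R : realType) := GRing.Zmodule.on (torus R).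
HB.instance Definition _ (R : realType) := Measurable.on (torus R).

Lemma measurable_circle_pi (R : realType) :
  measurable_fun [set: R] (@circle_pi R : R -> circle R).
Proof.
apply: (@measurability _ _ _ (circle R) _ _ (@circle_open R)) => //.
by move=> _ [U oU <-]; rewrite setTI; exact: measurable_realfun.open_measurable.
Qed.

Section haar.
Variable R : realType.

(* The normalized Haar measure is the image of the Lebesgue measure of the    *)
(* fundamental domain [0, 1[.                                                 *)
Definition haar1 : set (circle R) -> \bar R :=
  pushforward (mrestr (@lebesgue_measure R) (measurable_itv `[0, 1[))
    (@circle_pi R : R -> circle R).

Let haar1_0 : haar1 set0 = 0%E.
Proof. by rewrite /haar1 /pushforward preimage_set0 measure0. Qed.

Let haar1_ge0 A : (0 <= haar1 A)%E.
Proof. by rewrite /haar1 /pushforward measure_ge0. Qed.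

Let haar1_sigma_additive : semi_sigma_additive haar1.
Proof.
apply: measure_semi_sigma_additive; exact: measurable_circle_pi.
Qed.

HB.instance Definition _ := isMeasure.Build _ (circle R) R haar1
  haar1_0 haar1_ge0 haar1_sigma_additive.

Let haar1_setT : haar1 setT = 1%E.
Proof.
rewrite /haar1 /pushforward preimage_setT /mrestr setTI.
by rewrite lebesgue_measure_itv/= lte_fin ltr01 oppr0 adde0.
Qed.

HB.instance Definition _ :=
  Measure_isProbability.Build _ (circle R) R haar1 haar1_setT.

Definition haar2 : set (torus R) -> \bar R := (haar1 \x haar1)%E.

HB.instance Definition _ := Measure.on haar2.

Let haar2_setT : haar2 setT = 1%E.
Proof.
by rewrite /haar2 -setXTT product_measure1E//= !haar1_setT mule1.
Qed.

HB.instance Definition _ :=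
  Measure_isProbability.Build _ (torus R) R haar2 haar2_setT.

End haar.

Section random_product.
Context d (T : measurableType d) (R : realType).

Definition cylinders : set (set (nat -> T)) :=
  [set C | exists n (A : set T), measurable A /\ C = [set w | A (w n)]].

(* The one-sided sequence space, with the product sigma-algebra. *)
Definition seq_space : Type := g_sigma_algebraType cylinders.

HB.instance Definition _ := Measurable.on seq_space.

(* [rho] is the product measure [nu]^N. *)
Definition is_power_measure (nu : set T -> \bar R)
    (rho : set seq_space -> \bar R) :=
  forall (n : nat) (A : nat -> set T), (forall i, measurable (A i)) ->
    rho [set w : seq_space | forall i, (i < n)%N -> A i (w i)] =
    (\prod_(i < n) nu (A i))%E.

End random_product.

Section standard_map.
Variable R : realType.

Definition torus_pi (h : 'rV[R]_2) : torus R :=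
  (circle_pi (h 0 0), circle_pi (h 0 1)).

(* The representative in [-1/2, 1/2[. *)
Definition circle_log (x : circle R) : R :=
  let t := repr (x : Quotient.quot (@Num.int_num_subdef R : {pred R})) in
  t - (Num.floor (t + 2^-1))%:~R.

Lemma circle_logK (x : circle R) : circle_pi (circle_log x) = x.
Proof.
rewrite -[RHS](reprK (x : Quotient.quot (@Num.int_num_subdef R : {pred R}))).
by apply/circle_pi_eq; rewrite /circle_log addrAC subrr add0r rpredN intr_int.
Qed.

Lemma circle_piK (t : R) : - 2^-1 <= t < 2^-1 -> circle_log (circle_pi t) = t.
Proof.
move=> /andP[t1 t2]; rewrite /circle_log.
set s := repr _; have /circle_pi_eq/intrP[m sm] : circle_pi s = circle_pi t.
  by rewrite /circle_pi /s reprK.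
have -> : s = t + m%:~R by rewrite -sm addrC subrK.
suff -> : Num.floor (t + m%:~R + 2^-1) = m by rewrite addrK.
by apply: floor_def; rewrite intrD; apply/andP; split; lra.
Qed.

Definition torus_log (y : torus R) : 'rV[R]_2 :=
  \row_(j < 2) circle_log (if j == 0 then y.1 else y.2).

(* The derivative of F at y, the tangent spaces being identified with R^2 by  *)
(* translation: the Jacobian at 0 of F read in the charts h |-> y + h and     *)
(* k |-> F y + k. As in ['J], matrices act on row vectors.                    *)
Definition torus_jacobian (F : torus R -> torus R) (y : torus R) : 'M[R]_2 :=
  'J (fun h => torus_log (F (y + torus_pi h) - F y)) 0.

Definition eucl_norm (v : 'rV[R]_2) : R := Num.sqrt (\sum_j v 0 j ^+ 2).

Definition op_norm (M : 'M[R]_2) : R :=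
  sup [set eucl_norm (v *m M) | v in [set v | eucl_norm v <= 1]].

Definition circle_C1 (V : circle R -> R) :=
  (forall t, derivable (V \o @circle_pi R) t 1) /\
  continuous (derive1 (V \o @circle_pi R)).

Definition gen_standard_map (V : circle R -> R) (y : torus R) : torus R :=
  (y.1 + y.2 + circle_pi (V y.1), y.2 + circle_pi (V y.1)).

Definition translated_map (V : circle R -> R) (x y : torus R) : torus R :=
  gen_standard_map V y + x.

Fixpoint random_iter (V : circle R -> R) (w : seq_space (torus R)) (n : nat)
    (y : torus R) : torus R :=
  if n is k.+1 then translated_map V (w k) (random_iter V w k y) else y.

Definition lyapunov_plus (V : circle R -> R) (w : seq_space (torus R))
    (y : torus R) : \bar R :=
  limn_esup (fun n =>
    (n%:R^-1 * ln (op_norm (torus_jacobian (random_iter V w n) y)))%:E).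

Definition lyapunov_minus (V : circle R -> R) (w : seq_space (torus R))
    (y : torus R) : \bar R :=
  (- limn_esup (fun n => (n%:R^-1 *
    ln (op_norm (invmx (torus_jacobian (random_iter V w n) y))))%:E))%E.

Definition vertical_line_measure (nu : set (torus R) -> \bar R) :=
  exists (chi : probability (circle R) R) (h : circle R -> R),
    [/\ measurable_fun [set: circle R] h,
        forall x, 0 <= h x,
        forall A, measurable A -> chi A = (\int[@haar1 R]_(x in A) (h x)%:E)%E
      & forall A, measurable A -> nu A = (\d_(0%R : circle R) \x chi)%E A].

End standard_map.

(* Main.v *)
From HB Require Import structures.
Require Import Defs.
From mathcomp Require Import all_boot all_order all_algebra ring lra.
From mathcomp Require Import all_classical all_reals all_analysis measurable_realfun.

Set Implicit Arguments.
Unset Strict Implicit.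
Unset Printing Implicit Defensive.

Import Order.TTheory GRing.Theory Num.Theory.
Import numFieldNormedType.Exports.

Local Open Scope classical_set_scope.
Local Open Scope ring_scope.

(** Write a = V'(y_1) and let S_a be the derivative of g_V at y. The derivative
of the random composition is a product A_n of matrices S_a along the random
orbit. One step acts on pairs (y, v) of a point of the torus and a tangent
vector by the skew product (y, v) |-> (g_V y, S_a v), followed by a translation
of y by a random x. The matrices are unimodular, so every step preserves the
product of the Haar measure and of the Lebesgue measure of the plane, and the
averaged composition operator T ([transfer]) does not increase L2 norms.

The heart of the proof is that T^4 is a strict contraction on functions with
values in [0, 1] ([transfer_contraction]). Applied to the indicator of the box
|v| <= 1, it makes the L2 norm of the function P(A_n v in the box) of (y, v)
decay exponentially ([iter_transfer]). If all the entries of A_n are at most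
e^(cn), this event occurs for all v of size e^(-cn) / 2; comparing areas, such
slow growth has a probability tending to 0 along n = 4k when c is small
([frequent_growth]). Almost surely some entry therefore exceeds e^(cn) for
infinitely many n, and this is enough because the exponents are defined by upper
limits. It bounds both of them, since the inverse of a matrix of determinant 1
has the same entries up to order and sign.

Here is why T^4 contracts. The norm lost in one step is the mean square distance
between phi and its translates by the noise ([sqnorm_noise_mean]). If it is
small, then D z = ||phi(. + z) - phi||^2 is small at x - y for most independent
samples x and y of the noise. Since D is subadditive up to a factor, a theorem
of Steinhaus type ([noise_gap]) makes D small at all vertical translations, for
both kinds of noise. The skew product turns vertical translations into diagonal
ones, so a second step makes D small on the whole torus, and phi is close to a
function xi of v alone ([close_to_fiber]). With xi_0, xi_1, xi_2 obtained so at
consecutive times, xi_1 is close to the composition of xi_0 with S_a for most y.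
If V is not constant, its derivative, of mean zero on the circle, takes two
separated ranges of values on sets of positive measure ([slopes_differ]).
Comparing the two shows that xi_1 is nearly invariant under a definite vertical
shear; comparing xi_1 and xi_2 shows that the same holds for the composition of
xi_1 with the horizontal shear. A vertical shear moves a cone around the
horizontal axis off itself, so each invariance leaves little mass in a cone; as
the two cones cover the plane, xi_1 is small ([ping_pong]). Hence phi cannot
keep its norm through four steps.

If V is constant, A_n is unipotent, and its norm grows linearly. *)

(** * Measurability on the circle and the torus *)

Lemma eq_lee (R : realType) (x y : \bar R) : x = y -> (x <= y)%E.
Proof. by move=> ->. Qed.

Section circle_measurability.
Variable R : realType.
Implicit Types (x y : circle R) (s t : R).

Lemma circle_pi0 : circle_pi 0 = 0 :> circle R.
Proof.
by apply: (addrI (circle_pi 0 : circle R)); rewrite -circle_piD !addr0.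
Qed.

Lemma circle_log_itv x : - 2^-1 <= circle_log x < 2^-1.
Proof.
rewrite /circle_log; set t := repr _.
have := floor_le (t + 2^-1); have := floorD1_gt (t + 2^-1).
by rewrite intrD; move: (Num.floor _)%:~R => m; lra.
Qed.

Lemma circle_log_pi t : exists m : int, circle_log (circle_pi t) = t - m%:~R.
Proof.
have /circle_pi_eq/intrP[m h] := circle_logK (circle_pi t : circle R).
by exists (- m); rewrite mulrNz opprK -h addrC subrK.
Qed.

Lemma circle_piDz t (m : int) : circle_pi (t + m%:~R) = circle_pi t.
Proof. by apply/circle_pi_eq; rewrite addrAC subrr add0r intr_int. Qed.

(** The Borel structure of the circle is generated by the quotient topology, so
that the preimage of a ray is opened in the line: it is the union of the integer
translates of an interval. *)
Lemma measurable_circle_log : measurable_fun [set: circle R] (@circle_log R).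
Proof.
apply: (measurability (@RGenOInfty.G R)); first exact: RGenOInfty.measurableE.
move=> _ [_ [x ->] <-]; rewrite setTI.
have [x2|x2] := ltP x (- 2^-1).
  rewrite (_ : _ @^-1` _ = setT) //; apply/seteqP; split => // z _ /=.
  by rewrite in_itv/= andbT (lt_le_trans x2)//; case/andP: (circle_log_itv z).
apply: sub_gen_smallest; rewrite /circle_open /=.
rewrite (_ : _ @^-1` _ = \bigcup_(k : int) `]x + k%:~R, 2^-1 + k%:~R[%classic).
  by apply: bigcup_open => k _; exact: interval_open.
apply/seteqP; split=> [t /=|t [k _] /=]; rewrite in_itv/= ?andbT.
  have [m tm] := circle_log_pi t; move: (circle_log_itv (circle_pi t)).
  rewrite tm => /andP[_ h1] h2; exists m => //=.
  by rewrite in_itv/=; apply/andP; split; lra.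
rewrite in_itv/= => /andP[h1 h2].
rewrite -(subrK k%:~R t) circle_piDz circle_piK; first by lra.
by apply/andP; split; lra.
Qed.

Lemma measurable_circle_add :
  measurable_fun [set: circle R * circle R] (fun p => p.1 + p.2 : circle R).
Proof.
have h : measurable_fun [set: circle R * circle R]
    ((@circle_pi R : R -> circle R) \o (fun p => circle_log p.1 + circle_log p.2)).
  apply: (measurableT_comp (@measurable_circle_pi R)).
  by apply: measurable_funD; apply: (measurableT_comp measurable_circle_log).
by apply: eq_measurable_fun h => p _ /=; rewrite circle_piD !circle_logK.
Qed.

Lemma measurable_circle_opp :
  measurable_fun [set: circle R] (fun x => - x : circle R).
Proof.
have h : measurable_fun [set: circle R]
    ((@circle_pi R : R -> circle R) \o (fun x => - circle_log x)).
  apply: (measurableT_comp (@measurable_circle_pi R)).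
  by apply: measurableT_comp => //; exact: measurable_circle_log.
apply: eq_measurable_fun h => x _ /=; apply: (addIr x).
by rewrite addNr -[X in _ + X](circle_logK x) -circle_piD addNr circle_pi0.
Qed.

Section fun_measurability.
Context d (T : measurableType d).

Lemma measurable_circleD (f g : T -> circle R) :
  measurable_fun setT f -> measurable_fun setT g ->
  measurable_fun setT (fun z => f z + g z).
Proof.
move=> mf mg.
exact: (measurableT_comp measurable_circle_add (measurable_fun_pair mf mg)).
Qed.

Lemma measurable_circleN (f : T -> circle R) :
  measurable_fun setT f -> measurable_fun setT (fun z => - f z).
Proof. by move=> mf; exact: (measurableT_comp measurable_circle_opp mf). Qed.

Lemma measurable_torusD (f g : T -> torus R) :
  measurable_fun setT f -> measurable_fun setT g ->
  measurable_fun setT (fun z => f z + g z).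
Proof.
move=> mf mg; apply: measurable_fun_pair => /=.
- by apply: measurable_circleD; exact: measurableT_comp.
- by apply: measurable_circleD; exact: measurableT_comp.
Qed.

Lemma measurable_torusN (f : T -> torus R) :
  measurable_fun setT f -> measurable_fun setT (fun z => - f z).
Proof.
move=> mf; apply: measurable_fun_pair => /=.
- by apply: measurable_circleN; exact: measurableT_comp.
- by apply: measurable_circleN; exact: measurableT_comp.
Qed.

End fun_measurability.

Lemma continuous_circle_measurable (W : circle R -> R) :
  continuous (W \o @circle_pi R) -> measurable_fun [set: circle R] W.
Proof.
move=> cW; apply: (measurability (@RGenOpens.G R)).
  exact: RGenOpens.measurableE.
move=> _ [_ [a [b ->]] <-]; rewrite setTI; apply: sub_gen_smallest.
rewrite /circle_open /= -comp_preimage; apply: open_comp => //.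
Qed.

End circle_measurability.

(** * Invariance of the Haar measures *)

Section translations.
Variable R : realType.

Lemma lebesgue_measure_shift (s : R) (A : set R) : measurable A ->
  lebesgue_measure ((fun t => t + s) @^-1` A) = lebesgue_measure A.
Proof.
move=> mA.
have ms : measurable_fun [set: measurableTypeR R]
    ((fun t => t + s) : _ -> measurableTypeR R).
  by apply: measurable_funD.
have -> : lebesgue_measure ((fun t => t + s) @^-1` A) =
  pushforward lebesgue_measure ((fun t => t + s) : _ -> measurableTypeR R) A by [].
apply/esym/lebesgue_measure_unique => //= _ [[a b]] _ <-.
rewrite /pushforward (_ : _ @^-1` _ = `]a - s, b - s]%classic); last first.
  by apply/seteqP; split => t /=; rewrite !in_itv/= => /andP[? ?]; apply/andP; split; lra.
rewrite !lebesgue_measure_itv/= !lte_fin ltrD2r.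
by case: ifP => // _; rewrite -!EFinB; congr EFin; lra.
Qed.

Lemma lebesgue_integral_shift (s : R) (f : R -> \bar R) :
  measurable_fun [set: R] f -> (forall t, (0 <= f t)%E) ->
  (\int[lebesgue_measure]_t f (t + s)%R = \int[lebesgue_measure]_t f t)%E.
Proof.
move=> mf f0.
have ms : measurable_fun [set: measurableTypeR R]
    ((fun t => t + s) : _ -> measurableTypeR R).
  by apply: measurable_funD.
rewrite -[LHS](@ge0_integral_pushforward _ _ _ _ _ _ ms _ setT)//.
by apply: eq_measure_integral => A mA _; exact: lebesgue_measure_shift.
Qed.

End translations.

Section haar.
Variable R : realType.
Implicit Types (c : circle R) (z : torus R).
Local Open Scope ereal_scope.

Lemma circle_lift01 c : exists s : R, (0 <= s < 1)%R /\ circle_pi s = c.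
Proof.
have /andP[c1 c2] := circle_log_itv c.
have [c0|c0] := ltP (circle_log c) 0%R.
  exists (circle_log c + 1)%R; split; first by apply/andP; split; lra.
  by rewrite (circle_piDz _ 1) circle_logK.
by exists (circle_log c); split; [apply/andP; split; lra|exact: circle_logK].
Qed.

(** Translating the fundamental domain by s cuts off a piece at one end; moved by
the integer 1, it fills the gap at the other end. *)
Lemma haar1_shift c (A : set (circle R)) : measurable A ->
  @haar1 R ((fun x => x + c)%R @^-1` A) = haar1 A.
Proof.
move=> mA; have [s [/andP[s0 s1] <-]] := circle_lift01 c.
rewrite /haar1 /pushforward /mrestr /=.
set P := @circle_pi R @^-1` A.
have mP : measurable P.
  by rewrite -[P]setTI; exact: (@measurable_circle_pi R).
have PD1 t : P (t + 1)%R = P t by rewrite /P /= (circle_piDz _ 1).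
transitivity (lebesgue_measure (P `&` `[s, (s + 1)%R[)).
  rewrite -[RHS](lebesgue_measure_shift s); last exact: measurableI.
  congr (lebesgue_measure _); apply/seteqP; split => t /=.
    rewrite !in_itv/= -circle_piD => -[Pt /andP[? ?]].
    by split=> //; apply/andP; split; lra.
  rewrite !in_itv/= -circle_piD => -[Pt /andP[? ?]].
  by split=> //; apply/andP; split; lra.
have -> : P `&` `[s, (s + 1)%R[ = (P `&` `[s, 1%R[) `|` (P `&` `[1%R, (s + 1)%R[).
  rewrite -setIUr; congr (_ `&` _); apply/seteqP; split => t /=; rewrite !in_itv/=.
    by move=> /andP[h1 h2]; case: (ltP t 1%R) => h; [left|right]; apply/andP; split.
  by move=> [|] /andP[h1 h2]; apply/andP; split; lra.
rewrite measureU; [|exact: measurableI..|]; last first.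
  apply/seteqP; split=> // t /= -[[_]]; rewrite !in_itv/= => h [_ h'].
  by move: h h' => /andP[? ?] /andP[? ?]; lra.
rewrite -[X in _ + X](lebesgue_measure_shift 1); last exact: measurableI.
have -> : (fun t => t + 1)%R @^-1` (P `&` `[1%R, (s + 1)%R[) = P `&` `[0%R, s[.
  apply/seteqP; split => t /=; rewrite PD1 !in_itv/= => -[Pt /andP[? ?]];
  by split=> //; apply/andP; split; lra.
rewrite addeC -measureU; [|exact: measurableI..|]; last first.
  apply/seteqP; split=> // t /= -[[_]]; rewrite !in_itv/= => h [_ h'].
  by move: h h' => /andP[? ?] /andP[? ?]; lra.
rewrite -setIUr; congr (lebesgue_measure (_ `&` _)).
apply/seteqP; split => t /=; rewrite !in_itv/=.
  by move=> [|] /andP[h1 h2]; apply/andP; split; lra.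
by move=> /andP[h1 h2]; case: (ltP t s) => h; [left|right]; apply/andP; split.
Qed.

Lemma haar1_integral_shift c (f : circle R -> \bar R) :
  measurable_fun setT f -> (forall x, 0 <= f x) ->
  \int[@haar1 R]_x f (x + c)%R = \int[@haar1 R]_x f x.
Proof.
move=> mf f0.
have ms : measurable_fun [set: circle R] (fun x => (x + c)%R : circle R).
  exact: measurable_circleD.
rewrite -[LHS](@ge0_integral_pushforward _ _ _ _ _ _ ms _ setT)//.
by apply: eq_measure_integral => A mA _; exact: haar1_shift.
Qed.

Lemma measurable_haar1_integral d (T : measurableType d)
    (f : T * circle R -> \bar R) :
  measurable_fun setT f -> (forall q, 0 <= f q) ->
  measurable_fun setT (fun x => \int[@haar1 R]_y f (x, y)).
Proof. exact: measurable_fun_fubini_tonelli_F. Qed.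

Lemma measurable_haar1_integral_swap d (T : measurableType d)
    (f : circle R * T -> \bar R) :
  measurable_fun setT f -> (forall q, 0 <= f q) ->
  measurable_fun setT (fun y => \int[@haar1 R]_x f (x, y)).
Proof. exact: measurable_fun_fubini_tonelli_G. Qed.

Lemma measurable_haar2_integral d (T : measurableType d)
    (f : T * torus R -> \bar R) :
  measurable_fun setT f -> (forall q, 0 <= f q) ->
  measurable_fun setT (fun x => \int[@haar2 R]_y f (x, y)).
Proof. exact: measurable_fun_fubini_tonelli_F. Qed.

Lemma haar11_swap (f : circle R * circle R -> \bar R) :
  measurable_fun setT f -> (forall q, 0 <= f q) ->
  \int[@haar1 R]_x \int[@haar1 R]_y f (x, y) =
  \int[@haar1 R]_y \int[@haar1 R]_x f (x, y).
Proof. exact: fubini_tonelli. Qed.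

Lemma haar12_swap (f : circle R * torus R -> \bar R) :
  measurable_fun setT f -> (forall q, 0 <= f q) ->
  \int[@haar1 R]_x \int[@haar2 R]_y f (x, y) =
  \int[@haar2 R]_y \int[@haar1 R]_x f (x, y).
Proof. exact: fubini_tonelli. Qed.

Lemma haar22_swap (f : torus R * torus R -> \bar R) :
  measurable_fun setT f -> (forall q, 0 <= f q) ->
  \int[@haar2 R]_x \int[@haar2 R]_y f (x, y) =
  \int[@haar2 R]_y \int[@haar2 R]_x f (x, y).
Proof. exact: fubini_tonelli. Qed.

Lemma haar2_integral (f : torus R -> \bar R) :
  measurable_fun setT f -> (forall x, 0 <= f x) ->
  \int[@haar2 R]_y f y = \int[@haar1 R]_y1 \int[@haar1 R]_y2 f (y1, y2).
Proof. by move=> mf f0; rewrite /haar2 fubini_tonelli1. Qed.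

Lemma haar2_integral_fst (f : circle R -> \bar R) :
  measurable_fun setT f -> (forall x, 0 <= f x) ->
  \int[@haar2 R]_y f y.1 = \int[@haar1 R]_x f x.
Proof.
move=> mf f0; rewrite haar2_integral//; last exact: measurableT_comp.
apply: eq_integral => x _ /=.
by rewrite integral_cst// [X in _ * X]probability_setT mule1.
Qed.

Lemma haar2_integral_shift z (f : torus R -> \bar R) :
  measurable_fun setT f -> (forall x, 0 <= f x) ->
  \int[@haar2 R]_y f (y + z)%R = \int[@haar2 R]_y f y.
Proof.
move=> mf f0; have mfz : measurable_fun setT (fun y : torus R => f (y + z)%R).
  by apply: (measurableT_comp mf); exact: measurable_torusD.
rewrite (haar2_integral mf f0) (haar2_integral mfz (fun y => f0 _)).
under eq_integral => y1 _.
  rewrite (@haar1_integral_shift z.2 (fun y2 => f ((y1 + z.1)%R, y2)))//; last first.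
    exact: measurable_fun_pair2.
  over.
rewrite (@haar1_integral_shift z.1 (fun y1 => \int[haar1 (R:=R)]_y2 f (y1, y2)))//.
  exact: measurable_haar1_integral.
by move=> x; exact: integral_ge0.
Qed.

Lemma measurable_gen_standard_map (V : circle R -> R) :
  measurable_fun setT V -> measurable_fun [set: torus R] (gen_standard_map V).
Proof.
move=> mV; have mpV : measurable_fun [set: torus R]
    (fun y => circle_pi (V y.1) : circle R).
  apply: (measurableT_comp (@measurable_circle_pi R)).
  exact: measurableT_comp.
apply: measurable_fun_pair => /=.
  by do 2 apply: measurable_circleD => //.
by apply: measurable_circleD.
Qed.

(** The generalized standard map is a composition of two maps each of which
translates one coordinate by a function of the other. *)
Lemma haar2_integral_standard (V : circle R -> R) (f : torus R -> \bar R) :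
  measurable_fun setT V ->
  measurable_fun setT f -> (forall x, 0 <= f x) ->
  \int[@haar2 R]_y f (gen_standard_map V y) = \int[@haar2 R]_y f y.
Proof.
move=> mV mf f0.
have mfg := measurableT_comp mf (measurable_gen_standard_map mV).
rewrite (haar2_integral mf f0) (haar2_integral mfg (fun y => f0 _)).
have mf' : measurable_fun [set: torus R] (fun p => f ((p.1 + p.2)%R, p.2)).
  by apply: (measurableT_comp mf); apply: measurable_fun_pair => //; exact: measurable_circleD.
transitivity (\int[@haar1 R]_y1 \int[@haar1 R]_y2 f ((y1 + y2)%R, y2)).
  apply: eq_integral => y1 _.
  rewrite -[RHS](@haar1_integral_shift (circle_pi (V y1)) (fun y2 => f ((y1 + y2)%R, y2)))//.
    by apply: eq_integral => y2 _; rewrite addrA.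
  exact: (measurable_fun_pair2 y1 mf').
apply: (etrans (haar11_swap mf' (fun p => f0 _))) => /=.
under eq_integral => y2 _.
  rewrite (@haar1_integral_shift y2 (fun y1 => f (y1, y2)))//; last first.
    exact: measurable_fun_pair1.
  over.
by rewrite -(haar11_swap mf).
Qed.

End haar.

(** * Mean square distance and measure-preserving maps *)

Section sqdist.
Context d (T : measurableType d) (R : realType) (mu : {measure set T -> \bar R}).
Implicit Types (f g h : T -> R) (F : T -> \bar R).
Local Open Scope ereal_scope.

Definition sqdist f g := \int[mu]_x ((f x - g x) ^+ 2)%:E.

(** Invariance is stated through integrals of nonnegative functions, the form in
which compositions use it. *)
Definition preserving (S : T -> T) := measurable_fun setT S /\
  forall F, measurable_fun setT F -> (forall x, 0 <= F x) ->
    \int[mu]_x F (S x) = \int[mu]_x F x.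

Lemma measurable_sq f : measurable_fun setT f ->
  measurable_fun setT (fun x => (f x ^+ 2)%:E).
Proof. by move=> mf; apply/measurable_EFinP; exact: measurable_funX. Qed.

Lemma measurable_sqB f g : measurable_fun setT f -> measurable_fun setT g ->
  measurable_fun setT (fun x => ((f x - g x) ^+ 2)%:E).
Proof. by move=> mf mg; apply: measurable_sq; exact: measurable_funB. Qed.

Lemma sqdist_ge0 f g : 0 <= sqdist f g.
Proof. by apply: integral_ge0 => x _; rewrite lee_fin sqr_ge0. Qed.

Lemma sqdistC f g : sqdist f g = sqdist g f.
Proof. by apply: eq_integral => x _; rewrite -sqrrN opprB. Qed.

Lemma sqdistxx f : sqdist f f = 0.
Proof. by apply: integral0_eq => x _; rewrite subrr expr0n. Qed.

(** Working with squared distances costs a factor 2 in the triangle inequality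
and avoids square roots throughout. *)
Lemma sqdist_tri f g h : measurable_fun setT f -> measurable_fun setT g ->
  measurable_fun setT h ->
  sqdist f h <= 2%:E * (sqdist f g + sqdist g h).
Proof.
move=> mf mg mh.
have m1 := measurable_sqB mf mg; have m2 := measurable_sqB mg mh.
rewrite /sqdist -ge0_integralD//; try by move=> x _; rewrite lee_fin sqr_ge0.
rewrite -ge0_integralZl//; last 2 first.
- exact: emeasurable_funD.
- by move=> x _; rewrite adde_ge0// lee_fin sqr_ge0.
apply: ge0_le_integral => //.
- by move=> x _; rewrite lee_fin sqr_ge0.
- exact: measurable_sqB.
- by apply: emeasurable_funM => //; exact: emeasurable_funD.
move=> x _; rewrite -EFinD -EFinM lee_fin.
by have := sqr_ge0 (f x - g x - (g x - h x)); nra.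
Qed.

Lemma sqdist_preserving (S : T -> T) f g : preserving S ->
  measurable_fun setT f -> measurable_fun setT g ->
  sqdist (f \o S) (g \o S) = sqdist f g.
Proof.
move=> [mS pS] mf mg.
rewrite /sqdist -(pS _ (measurable_sqB mf mg))// => x.
by rewrite lee_fin sqr_ge0.
Qed.

Lemma preserving_comp (S S' : T -> T) :
  preserving S -> preserving S' -> preserving (S \o S').
Proof.
move=> [mS pS] [mS' pS']; split; first exact: measurableT_comp.
move=> F mF F0.
exact: etrans (pS' _ (measurableT_comp mF mS) (fun x => F0 (S x))) (pS F mF F0).
Qed.

(** Let I be the integral of F. If F exceeded I / mu G on all of G, its integral on G,
at most I, would leave integral 0 for the excess, which would vanish almost
everywhere. *)
Lemma le_average (G : set T) F : mu setT < +oo -> measurable G -> 0 < mu G ->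
  measurable_fun setT F -> (forall x, 0 <= F x) ->
  exists2 x, G x & F x * mu G <= \int[mu]_x F x.
Proof.
move=> mufin mG G0 mF F0; set I := \int[mu]_x F x.
have Gfin : mu G \is a fin_num.
  by rewrite ge0_fin_numE// (le_lt_trans _ mufin)// le_measure// inE.
apply: contrapT => /forall2NP H.
have {}H x : G x -> I < F x * mu G.
  by move=> Gx; have [//|/negP] := H x; rewrite -ltNge.
have Ifin : I \is a fin_num.
  rewrite ge0_fin_numE; last exact: integral_ge0.
  have [x Gx] : G !=set0.
    by apply/set0P; apply: contraTneq G0 => ->; rewrite measure0 ltxx.
  by rewrite (lt_le_trans (H x Gx))// leey.
pose c := (fine I / fine (mu G))%R.
have muG0 : (0 < fine (mu G))%R by rewrite fine_gt0// G0 ltey_eq Gfin.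
have c0 : (0 <= c)%R by rewrite divr_ge0// ?fine_ge0//; exact: integral_ge0.
have cG : c%:E * mu G = I.
  by rewrite -(fineK Gfin) -EFinM divfK ?gt_eqF// fineK.
have cF x : G x -> c%:E < F x.
  move=> /H; rewrite -cG => h; rewrite ltNge; apply: contraTN h => h.
  by rewrite -leNgt lee_pmul2r// G0.
have E : \int[mu]_(x in G) F x = \int[mu]_(x in G) (F x - c%:E) + I.
  rewrite -cG -integral_cst// -ge0_integralD//.
  - by apply: eq_integral => x _; rewrite subeK.
  - by move=> x Gx; rewrite sube_ge0// ltW// cF.
  - by apply: emeasurable_funB => //; exact: measurable_funTS.
have : \int[mu]_(x in G) F x <= I.
  by apply: ge0_subset_integral => //.
rewrite E -{2}(add0e I) leeD2rE// => J0.
have J : \int[mu]_(x in G) `|F x - c%:E| = 0.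
  rewrite -[RHS](@le_anti _ _ (\int[mu]_(x in G) (F x - c%:E)) 0); last first.
    by rewrite J0 integral_ge0// => x Gx; rewrite sube_ge0// ltW// cF.
  apply: eq_integral => x; rewrite inE => Gx.
  by rewrite gee0_abs// sube_ge0// ltW// cF.
have mFc : measurable_fun G (fun x => F x - c%:E).
  by apply: emeasurable_funB => //; exact: measurable_funTS.
move/(ae_eq_integral_abs mu mG mFc) : J => [N [mN N0 GN]].
suff : mu G <= 0 by rewrite leNgt G0.
rewrite -N0; apply: le_measure; rewrite ?inE// => x Gx; apply: GN => /=.
move=> /(_ Gx) /eqP; apply/negP; by rewrite gt_eqF//= EFinN sube_gt0 cF.
Qed.

End sqdist.

Lemma sigma_finite_product d1 d2 (T1 : measurableType d1)
    (T2 : measurableType d2) (R : realType)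
    (m1 : {sigma_finite_measure set T1 -> \bar R})
    (m2 : {sigma_finite_measure set T2 -> \bar R}) :
  sigma_finite setT (m1 \x m2)%E.
Proof.
have /sigma_finiteP[F [FT Fnd Ffin]] := sigma_finiteT m1.
have /sigma_finiteP[G [GT Gnd Gfin]] := sigma_finiteT m2.
exists (fun n => F n `*` G n) => [|n]; last first.
  have [[mF F1] [mG G1]] := (Ffin n, Gfin n); split; first exact: measurableX.
  by rewrite product_measure1E// lte_mul_pinfty// ge0_fin_numE.
apply/esym; rewrite -subTset => -[x y] _.
have [i _ Fix] : (\bigcup_i F i) x by rewrite -FT.
have [j _ Gjy] : (\bigcup_j G j) y by rewrite -GT.
exists (maxn i j) => //; split => /=.
- by move/subsetPset: (Fnd _ _ (leq_maxl i j)); apply.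
- by move/subsetPset: (Gnd _ _ (leq_maxr i j)); apply.
Qed.

(** * Shears of the plane *)

Section plane.
Variable R : realType.
Implicit Types (v : R * R) (a t : R).
Local Open Scope ereal_scope.

Definition leb2 : set (measurableTypeR R * measurableTypeR R) -> \bar R :=
  @lebesgue_measure R \x @lebesgue_measure R.

HB.instance Definition _ := Measure.on leb2.

Let leb2_sigma_finite : sigma_finite setT leb2.
Proof. by apply: sigma_finite_product. Qed.

HB.instance Definition _ :=
  Measure_isSigmaFinite.Build _ _ _ leb2 leb2_sigma_finite.

Lemma leb2_integral (F : R * R -> \bar R) :
  measurable_fun setT F -> (forall v, 0 <= F v) ->
  \int[leb2]_v F v =
  \int[@lebesgue_measure R]_s1 \int[@lebesgue_measure R]_s2 F (s1, s2).
Proof. by move=> mF F0; rewrite /leb2 fubini_tonelli1. Qed.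

Lemma leb2_integral_swap (F : R * R -> \bar R) :
  measurable_fun setT F -> (forall v, 0 <= F v) ->
  \int[leb2]_v F v =
  \int[@lebesgue_measure R]_s2 \int[@lebesgue_measure R]_s1 F (s1, s2).
Proof. by move=> mF F0; rewrite /leb2 fubini_tonelli2. Qed.

Definition vshear t v : R * R := (v.1, (v.2 + t * v.1)%R).
Definition hshear v : R * R := ((v.1 + v.2)%R, v.2).
(** The matrix of the derivative of the standard map, with a the derivative of
the potential. The factorization into shears isolates the dependence on a in the
one-parameter group [vshear]. *)
Definition tangent_step a v : R * R := hshear (vshear a v).

Lemma measurable_vshear2 d (T : measurableType d) (f : T -> R) (g : T -> R * R) :
  measurable_fun setT f -> measurable_fun setT g ->
  measurable_fun setT (fun x => vshear (f x) (g x)).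
Proof.
move=> mf mg; apply: measurable_fun_pair => /=; first exact: measurableT_comp.
apply: measurable_funD; first exact: measurableT_comp.
by apply: measurable_funM => //; exact: measurableT_comp.
Qed.

Lemma measurable_hshear : measurable_fun [set: R * R] hshear.
Proof. by apply: measurable_fun_pair => //; exact: measurable_funD. Qed.

Lemma measurable_tangent_step2 d (T : measurableType d) (f : T -> R) (g : T -> R * R) :
  measurable_fun setT f -> measurable_fun setT g ->
  measurable_fun setT (fun x => tangent_step (f x) (g x)).
Proof.
move=> mf mg.
exact: (measurableT_comp measurable_hshear (measurable_vshear2 mf mg)).
Qed.

Lemma measurable_vshear t : measurable_fun [set: R * R] (vshear t).
Proof. by apply: measurable_vshear2. Qed.

Lemma preserving_vshear t : preserving leb2 (vshear t).
Proof.
split=> [|F mF F0]; first exact: measurable_vshear.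
have mFt := measurableT_comp mF (measurable_vshear t).
apply: (etrans (leb2_integral mFt (fun v => F0 _))).
apply: (etrans _ (esym (leb2_integral mF F0))).
apply: eq_integral => s1 _; rewrite /vshear/=.
rewrite (@lebesgue_integral_shift _ (t * s1)%R (fun s2 => F (s1, s2)))//.
exact: measurable_fun_pair2.
Qed.

Lemma preserving_hshear : preserving leb2 hshear.
Proof.
split=> [|F mF F0]; first exact: measurable_hshear.
have mFt := measurableT_comp mF measurable_hshear.
apply: (etrans (leb2_integral_swap mFt (fun v => F0 _))).
apply: (etrans _ (esym (leb2_integral_swap mF F0))).
apply: eq_integral => s2 _; rewrite /hshear/=.
rewrite (@lebesgue_integral_shift _ s2 (fun s1 => F (s1, s2)))//.
exact: measurable_fun_pair1.
Qed.

Lemma preserving_tangent_step a : preserving leb2 (tangent_step a).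
Proof. exact: preserving_comp preserving_hshear (preserving_vshear a). Qed.

Lemma vshearD s t v : vshear s (vshear t v) = vshear (t + s)%R v.
Proof. by rewrite /vshear/= mulrDl addrA. Qed.

End plane.

(** * The phase space and the noise *)

Section averaging.
Context d (T : measurableType d) (R : realType) (P : probability T R).
Local Open Scope ereal_scope.

Lemma probability_integral_cst (c : \bar R) : \int[P]_x c = c.
Proof. by rewrite [LHS]integral_cst// [X in _ * X]probability_setT mule1. Qed.

Lemma mean_01 (f : T -> R) : measurable_fun setT f ->
  (forall x, 0 <= f x <= 1)%R ->
  [/\ (0 <= fine (\int[P]_x (f x)%:E) <= 1)%R &
      (fine (\int[P]_x (f x)%:E))%:E = \int[P]_x (f x)%:E].
Proof.
move=> mf f01; have f0 x : (0 <= f x)%R by have /andP[] := f01 x.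
have I0 : 0 <= \int[P]_x (f x)%:E.
  by apply: integral_ge0 => x _; rewrite lee_fin.
have I1 : \int[P]_x (f x)%:E <= 1.
  rewrite -[leRHS](probability_integral_cst 1).
  apply: ge0_le_integral => //.
  - by move=> x _; rewrite lee_fin.
  - exact/measurable_EFinP.
  - by move=> x _; rewrite lee_fin; have /andP[] := f01 x.
have Ifin : \int[P]_x (f x)%:E \is a fin_num.
  by rewrite ge0_fin_numE// (le_lt_trans I1)// ltry.
by rewrite fineK//; split=> //; rewrite -!lee_fin fineK// I0.
Qed.

Lemma mean_sq_variance (f : T -> R) (c : R) : measurable_fun setT f ->
  (forall x, 0 <= f x)%R -> \int[P]_x (f x)%:E = c%:E ->
  \int[P]_x (f x ^+ 2)%:E = (c ^+ 2)%:E + \int[P]_x ((f x - c) ^+ 2)%:E.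
Proof.
move=> mf f0 fc; have c0 : (0 <= c)%R.
  by rewrite -lee_fin -fc integral_ge0// => x _; rewrite lee_fin.
have mfc : measurable_fun setT (fun x => ((f x - c) ^+ 2)%:E).
  by apply: measurable_sqB.
have mf2 := measurable_sq mf.
have E : \int[P]_x (f x ^+ 2)%:E + (c ^+ 2)%:E =
    \int[P]_x ((f x - c) ^+ 2)%:E + (2 * c)%:E * c%:E.
  rewrite -[X in _ * X]fc -[in LHS](probability_integral_cst (c ^+ 2)%:E).
  rewrite -ge0_integralZl//; last 3 first.
  - exact/measurable_EFinP.
  - by move=> x _; rewrite lee_fin.
  - by rewrite lee_fin mulr_ge0.
  rewrite -!ge0_integralD//.
  - by apply: eq_integral => x _; rewrite -EFinM -!EFinD; congr EFin; ring.
  - by move=> x _; rewrite lee_fin sqr_ge0.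
  - by move=> x _; rewrite -EFinM lee_fin !mulr_ge0.
  - by apply: emeasurable_funM => //; exact/measurable_EFinP.
  - by move=> x _; rewrite lee_fin sqr_ge0.
  - by move=> x _; rewrite lee_fin sqr_ge0.
rewrite -[LHS](@addeK _ (c ^+ 2)%:E)// E -EFinM -addeA -EFinN -EFinD addeC.
by congr (_%:E + _); ring.
Qed.

End averaging.

Section phase.
Variable R : realType.
Local Open Scope ereal_scope.

Definition phase : Type := (torus R * (R * R))%type.

Definition mphase : set (torus R * (measurableTypeR R * measurableTypeR R)) -> \bar R :=
  @haar2 R \x @leb2 R.

HB.instance Definition _ := Measure.on mphase.

Let mphase_sigma_finite : sigma_finite setT mphase.
Proof. by apply: sigma_finite_product. Qed.

HB.instance Definition _ :=
  Measure_isSigmaFinite.Build _ _ _ mphase mphase_sigma_finite.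

Lemma mphase_integral (F : phase -> \bar R) :
  measurable_fun setT F -> (forall p, 0 <= F p) ->
  \int[mphase]_p F p = \int[@haar2 R]_y \int[@leb2 R]_v F (y, v).
Proof. by move=> mF F0; rewrite /mphase fubini_tonelli1. Qed.

Lemma measurable_inner_integral (F : phase -> \bar R) :
  measurable_fun setT F -> (forall p, 0 <= F p) ->
  measurable_fun setT (fun y => \int[@leb2 R]_v F (y, v)).
Proof. by move=> mF F0; exact: measurable_fun_fubini_tonelli_F. Qed.

Definition shift_phase (z : torus R) (p : phase) : phase := ((p.1 + z)%R, p.2).

Lemma measurable_shift_phase2 d (T : measurableType d) (f : T -> torus R)
    (g : T -> phase) :
  measurable_fun setT f -> measurable_fun setT g ->
  measurable_fun setT (fun x => shift_phase (f x) (g x)).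
Proof.
move=> mf mg; apply: measurable_fun_pair; last exact: measurableT_comp.
by apply: measurable_torusD => //; exact: measurableT_comp.
Qed.

Lemma measurable_shift_phase z : measurable_fun setT (shift_phase z).
Proof. exact: measurable_shift_phase2. Qed.

Lemma preserving_shift_phase z : preserving mphase (shift_phase z).
Proof.
split=> [|F mF F0]; first exact: measurable_shift_phase.
have mFz := measurableT_comp mF (measurable_shift_phase z).
rewrite (mphase_integral mF F0); apply: (etrans (mphase_integral mFz (fun p => F0 _))).
rewrite (haar2_integral_shift z (measurable_inner_integral mF F0))//.
by move=> y; exact: integral_ge0.
Qed.

Lemma shift_phaseD y z p : shift_phase y (shift_phase z p) = shift_phase (z + y)%R p.
Proof. by rewrite /shift_phase/= addrA. Qed.

Variables (V W : circle R -> R).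
Hypotheses (mV : measurable_fun setT V) (mW : measurable_fun setT W).

Definition skew_product (p : phase) : phase :=
  (gen_standard_map V p.1, tangent_step (W p.1.1) p.2).

Lemma measurable_skew_product : measurable_fun setT skew_product.
Proof.
apply: measurable_fun_pair => /=.
  by apply: measurableT_comp => //; exact: measurable_gen_standard_map.
by apply: measurable_tangent_step2 => //; do 2 apply: measurableT_comp => //.
Qed.

Lemma preserving_skew_product : preserving mphase skew_product.
Proof.
split=> [|F mF F0]; first exact: measurable_skew_product.
have mFy := measurable_inner_integral mF F0.
have mFs := measurableT_comp mF measurable_skew_product.
rewrite (mphase_integral mF F0); apply: (etrans (mphase_integral mFs (fun p => F0 _))).
rewrite -(haar2_integral_standard mV mFy); last first.
  by move=> y; exact: integral_ge0.
apply: eq_integral => y _.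
have [_ pS] := preserving_tangent_step (W y.1).
by rewrite -(pS (fun v => F (gen_standard_map V y, v)))//; exact: measurable_fun_pair2.
Qed.

End phase.

Section energy.
Variable R : realType.
Variable nu : probability (torus R) R.
Implicit Types (phi : phase R -> R).
Local Open Scope ereal_scope.

Definition unit_valued phi := measurable_fun setT phi /\
  (forall p, 0 <= phi p <= 1)%R.

Definition sqnorm phi := \int[@mphase R]_p (phi p ^+ 2)%:E.

(** The conditional expectation of phi after the random translation. For functions
with values in [0, 1] the integral is finite, so that [fine] loses nothing. *)
Definition noise_mean phi (p : phase R) : R :=
  fine (\int[nu]_x (phi (shift_phase x p))%:E).

Definition dissipation phi :=
  \int[nu]_x sqdist (@mphase R) (phi \o shift_phase x) (noise_mean phi).

Lemma measurable_shifted phi : measurable_fun setT phi ->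
  measurable_fun setT (fun q : torus R * phase R => phi (shift_phase q.1 q.2)).
Proof.
move=> mphi.
exact: (measurableT_comp mphi (measurable_shift_phase2 measurable_fst measurable_snd)).
Qed.

Lemma noise_meanE phi p : unit_valued phi ->
  (noise_mean phi p)%:E = \int[nu]_x (phi (shift_phase x p))%:E.
Proof.
move=> [mphi phi01].
by have [] := @mean_01 _ _ _ nu _ (measurable_fun_pair1 p (measurable_shifted mphi))
  (fun x => phi01 _).
Qed.

Lemma unit_valued_noise_mean phi : unit_valued phi -> unit_valued (noise_mean phi).
Proof.
move=> phiu; have [mphi phi01] := phiu; split.
  apply/measurable_EFinP.
  have -> : (EFin \o noise_mean phi) =
      fun p => \int[nu]_x (phi (shift_phase x p))%:E.
    by apply/funext => p /=; rewrite noise_meanE.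
  apply: (@measurable_fun_fubini_tonelli_G _ _ _ _ _ nu
     (fun q : torus R * phase R => (phi (shift_phase q.1 q.2))%:E)).
    by apply/measurable_EFinP; exact: measurable_shifted.
  by move=> q; rewrite lee_fin; have /andP[] := phi01 (shift_phase q.1 q.2).
move=> p.
by have [] := @mean_01 _ _ _ nu _ (measurable_fun_pair1 p (measurable_shifted mphi))
  (fun x => phi01 _).
Qed.

Lemma measurable_sqdist_shift phi (psi : torus R -> phase R -> R) :
  measurable_fun setT phi ->
  measurable_fun setT (fun q : torus R * phase R => psi q.1 q.2) ->
  measurable_fun setT
    (fun x => sqdist (@mphase R) (phi \o shift_phase x) (psi x)).
Proof.
move=> mphi mpsi.
apply: (@measurable_fun_fubini_tonelli_F _ _ _ _ _ (@mphase R)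
  (fun q : torus R * phase R => ((phi (shift_phase q.1 q.2) - psi q.1 q.2) ^+ 2)%:E)).
  by apply: measurable_sqB => //; exact: measurable_shifted.
by move=> q; rewrite lee_fin sqr_ge0.
Qed.

(** Fiberwise, the second moment is the square of the mean plus the variance.
Translations preserve the norm, so the norm lost by averaging is exactly the mean
square distance between the translates and their average. *)
Lemma sqnorm_noise_mean phi : unit_valued phi ->
  sqnorm phi = sqnorm (noise_mean phi) + dissipation phi.
Proof.
move=> phiu; have [mphi phi01] := phiu.
have [mm m01] := unit_valued_noise_mean phiu.
have mshift := measurable_shifted mphi.
have mq2 : measurable_fun setT
    (fun q : torus R * phase R => (phi (shift_phase q.1 q.2) ^+ 2)%:E).
  exact: measurable_sq.
have mqd : measurable_fun setT (fun q : torus R * phase R =>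
    ((phi (shift_phase q.1 q.2) - noise_mean phi q.2) ^+ 2)%:E).
  by apply: measurable_sqB => //; exact: measurableT_comp.
transitivity (\int[nu]_x \int[@mphase R]_p (phi (shift_phase x p) ^+ 2)%:E).
  rewrite -[LHS](probability_integral_cst nu); apply: eq_integral => x _.
  have [_ pS] := preserving_shift_phase x.
  apply/esym; apply: (pS _ (measurable_sq mphi)) => p.
  by rewrite lee_fin sqr_ge0.
rewrite (@fubini_tonelli _ _ _ _ _ nu (@mphase R) _ mq2); last first.
  by move=> q; rewrite lee_fin sqr_ge0.
rewrite /dissipation /sqdist /=.
rewrite (@fubini_tonelli _ _ _ _ _ nu (@mphase R) _ mqd); last first.
  by move=> q; rewrite lee_fin sqr_ge0.
rewrite /sqnorm -ge0_integralD//; last 4 first.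
- by move=> p _; rewrite lee_fin sqr_ge0.
- exact: measurable_sq.
- by move=> p _; apply: integral_ge0 => x _; rewrite lee_fin sqr_ge0.
- apply: (@measurable_fun_fubini_tonelli_G _ _ _ _ _ nu _ mqd).
  by move=> q; rewrite lee_fin sqr_ge0.
apply: eq_integral => p _ /=.
apply: mean_sq_variance.
- exact: (measurable_fun_pair1 p mshift).
- by move=> x; have /andP[] := phi01 (shift_phase x p).
- by rewrite noise_meanE.
Qed.

End energy.

(** * A Steinhaus theorem on the circle *)

Lemma positive_level_set d (T : measurableType d) (R : realType)
    (mu : {measure set T -> \bar R}) (F : T -> \bar R) :
  measurable_fun setT F -> (forall x, 0 <= F x)%E -> (0 < \int[mu]_x F x)%E ->
  exists2 c : R, 0 < c & (0 < mu [set x | c%:E <= F x])%E.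
Proof.
move=> mF F0 IF0; apply: contrapT => /forall2NP H.
have mS (c : R) : measurable [set x | c%:E <= F x]%E.
  by rewrite -[X in measurable X]setTI; exact: emeasurable_fun_c_infty.
have /negligible_bigcup : forall n : nat,
    mu.-negligible [set x | (n.+1%:R^-1)%:E <= F x]%E.
  move=> n; exists [set x | (n.+1%:R^-1)%:E <= F x]%E; split => //.
  have [|/negP] := H n.+1%:R^-1; first by rewrite invr_gt0 ltr0n.
  by rewrite -leNgt => h; apply/eqP; rewrite eq_le h measure_ge0.
move=> [N [mN N0 FN]].
suff : (\int[mu]_x `|F x| = 0)%E.
  under eq_integral do rewrite gee0_abs//.
  by move=> I0; rewrite I0 ltxx in IF0.
apply/(ae_eq_integral_abs mu measurableT mF); exists N; split => // x /= /not_implyP[_ Fx].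
apply: FN; have {}Fx : (0 < F x)%E by rewrite lt_neqAle F0 andbT eq_sym; apply/eqP.
have [n nF] : exists n : nat, ((n.+1%:R^-1)%:E <= F x)%E.
  case: (F x) Fx => [r||] //=; last by exists 0%N; rewrite leey.
  rewrite lte_fin => r0; have [n _ nr] := near_infty_natSinv_lt (PosNum r0).
  by exists n; rewrite lee_fin ltW// nr/=.
by exists n.
Qed.

(** The measure of the ball is 2r, so that Z fills at least three quarters of it:
enough for Z to meet its translates by at most r / 4. *)
Lemma dense_ball (R : realType) (Z : set R) :
  measurable Z -> (0 < lebesgue_measure Z)%E ->
  exists (x r : R), 0 < r /\
    ((r *+ 2 * (3 / 4))%:E <= lebesgue_measure (Z `&` ball x r))%E.
Proof.
move=> mZ Z0; have [N [mN N0 ZN]] := lebesgue_density mZ.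
have [x [Zx Nx]] : exists x, Z x /\ ~ N x.
  apply: contrapT => /forallNP H.
  suff : (lebesgue_measure Z <= 0)%E by rewrite leNgt Z0.
  rewrite -N0; apply: le_measure; rewrite ?inE// => x Zx.
  by apply: contrapT => Nx; apply: (H x).
have {ZN} : (lebesgue_measure (Z `&` ball x r) * (lebesgue_measure (ball x r))^-1)%E
    @[r --> 0^'+] --> (1 : R)%:E.
  have : (\1_Z x : R) = 1 by rewrite indicE mem_set.
  move=> <-; apply: contrapT => h; apply: Nx; exact: ZN.
move/fine_cvg/cvgr_gt => /(_ (3 / 4)) H.
have /H {}H : (3 / 4 : R) < 1 by lra.
near (0 : R)^'+ => r.
have r0 : 0 < r by near: r; exact: nbhs_right_gt.
exists x, r; split => //.
have : 3 / 4 < fine (lebesgue_measure (Z `&` ball x r) *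
    (lebesgue_measure (ball x r))^-1)%E by near: r.
have Bfin : lebesgue_measure (Z `&` ball x r) \is a fin_num.
  rewrite ge0_fin_numE// (@le_lt_trans _ _ (lebesgue_measure (ball x r)))//.
    apply: le_measure; rewrite ?inE//; last exact: measurable_ball.
    by apply: measurableI => //; exact: measurable_ball.
  by rewrite lebesgue_measure_ball ?ltry// ltW.
rewrite lebesgue_measure_ball ?(ltW r0)// inver mulrn_eq0/= (gt_eqF r0)//.
rewrite -(fineK Bfin) -EFinM/= ltr_pdivlMr; last by rewrite mulrn_wgt0.
by rewrite mulrC lee_fin => /ltW.
Unshelve. all: by end_near. Qed.

Section quasi_modulus.
Variable R : realType.
Local Open Scope ereal_scope.

(** The properties of z |-> ||phi(. + z) - phi||^2 that come from the translations
being isometries. *)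
Definition quasi_modulus (G : zmodType) (D : G -> \bar R) :=
  [/\ forall z, 0 <= D z, forall z, D (- z)%R = D z &
      forall y z, D (y + z)%R <= 2%:E * (D y + D z)].

Lemma quasi_modulusB (G : zmodType) (D : G -> \bar R) y z :
  quasi_modulus D -> D (y - z)%R <= 2%:E * (D y + D z).
Proof. by move=> [D0 DN DD]; rewrite -[D z]DN. Qed.

Lemma haar1_integral (F : circle R -> \bar R) :
  measurable_fun setT F -> (forall x, 0 <= F x) ->
  \int[@haar1 R]_x F x = \int[@lebesgue_measure R]_(t in `[0%R, 1%R[) F (circle_pi t).
Proof.
move=> mF F0.
pose m0 := mrestr (@lebesgue_measure R) (measurable_itv `[0%R, 1%R[).
pose G := F \o (@circle_pi R : R -> circle R).
have mG : measurable_fun setT G by exact: (measurableT_comp mF (@measurable_circle_pi R)).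
have mpi : measurable_fun [set: measurableTypeR R]
    (@circle_pi R : measurableTypeR R -> circle R) by exact: measurable_circle_pi.
transitivity (\int[m0]_t G t).
  have <- := @ge0_integral_pushforward _ _ (measurableTypeR R) (circle R) R
    (@circle_pi R) mpi (mrestr (@lebesgue_measure R) (measurable_itv `[0%R, 1%R[)) _ _
    measurableT mF (fun x _ => F0 x).
  by apply: eq_measure_integral => A mA _.
pose I : set (measurableTypeR R) := `[0%R, 1%R[%classic.
have m0C : m0 (~` I) = 0 by rewrite /m0 /mrestr setICl measure0.
rewrite (@ge0_negligible_integral _ _ _ _ _ (~` I) _ _ measurableT)//; last first.
- by move=> x _; exact: F0.
- by apply: measurableC; exact: measurable_itv.
rewrite setTD setCK; apply: eq_measure_integral => A mA AI.
by rewrite /= /mrestr setIidl.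
Qed.

(** Inclusion and exclusion: B and its translate both have measure at least
3r / 2, inside a ball of measure 5r / 2. *)
Lemma overlap_ball (B : set R) (x r u : R) : measurable B -> B `<=` ball x r ->
  (0 < r)%R -> (`|u| <= r / 4)%R ->
  (r *+ 2 * (3 / 4))%:E <= lebesgue_measure B ->
  (r / 2)%:E <= lebesgue_measure (B `&` (fun t => t + u)%R @^-1` B).
Proof.
move=> mB Bx r0 ur Br; set B' := _ @^-1` B.
have mB' : measurable B'.
  rewrite -[B']setTI; have : measurable_fun [set: R] (fun t => t + u)%R.
    exact: measurable_funD.
  exact.
have B'r : (r *+ 2 * (3 / 4))%:E <= lebesgue_measure B'.
  by rewrite lebesgue_measure_shift.
have r'0 : (0 <= r + r / 4)%R by lra.
have Bbig : B `|` B' `<=` ball x (r + r / 4)%R.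
  move=> t [/Bx|/Bx]; rewrite /ball/=; first by lra.
  move=> h; rewrite (_ : x - t = (x - (t + u)) + u)%R; last by ring.
  by rewrite (le_lt_trans (ler_normD _ _))//; lra.
have bigfin : lebesgue_measure (ball x (r + r / 4)%R) = ((r + r / 4) *+ 2)%:E.
  by rewrite lebesgue_measure_ball.
have fin (A : set R) : measurable A -> A `<=` ball x (r + r / 4)%R ->
    lebesgue_measure A \is a fin_num.
  move=> mA Ab; rewrite ge0_fin_numE//.
  rewrite (@le_lt_trans _ _ (lebesgue_measure (ball x (r + r / 4)%R)))//.
    by apply: le_measure; rewrite ?inE//; exact: measurable_ball.
  by rewrite bigfin ltry.
have mU : measurable (B `|` B') by exact: measurableU.
have mI : measurable (B `&` B') by exact: measurableI.
have Bfin := fin _ mB (subset_trans (@subsetUl _ B B') Bbig).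
have B'fin := fin _ mB' (subset_trans (@subsetUr _ B B') Bbig).
have Ifin := fin _ mI (subset_trans (@subIsetl _ B B') (subset_trans (@subsetUl _ B B') Bbig)).
have : lebesgue_measure (B `|` B') <= ((r + r / 4) *+ 2)%:E.
  rewrite -bigfin; apply: le_measure; rewrite ?inE//; exact: measurable_ball.
have -> : lebesgue_measure (B `|` B') = lebesgue_measure B +
    lebesgue_measure B' - lebesgue_measure (B `&` B').
  by apply: measureUfinr => //; rewrite ltey_eq; apply/orP; left.
move: Bfin B'fin Ifin Br B'r.
move: (lebesgue_measure B) (lebesgue_measure B') (lebesgue_measure (B `&` B')).
move=> [b||] [b'||] [i||] //= _ _ _.
by rewrite -EFinB !lee_fin; lra.
Qed.

(** Doubling reaches a translation of any length from a small one. *)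
Lemma quasi_modulus_double (D : circle R -> \bar R) (n : nat) (u : R) :
  quasi_modulus D -> D (circle_pi (u *+ (2 ^ n))) <= (4 ^+ n)%:E * D (circle_pi u).
Proof.
move=> [D0 DN DD]; elim: n => [|n IH]; first by rewrite expn0 mulr1n expr0 mul1e.
rewrite expnS mul2n -addnn mulrnDr circle_piD.
apply: (le_trans (DD _ _)); rewrite exprS EFinM -muleA.
have -> : (4 : R)%:E = 2%:E * 2%:E by rewrite -EFinM; congr EFin; ring.
rewrite -muleA lee_pmul2l//; apply: (le_trans (leeD IH IH)).
by rewrite mule_natl mule2n.
Qed.

(** A quantitative Steinhaus theorem. The weight w is bounded below by some c > 0
on a set that nearly fills some interval. A small u is then a difference s + u - s
of two points of this set for a positive measure of s, so that D u is bounded by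
the average of D against w; repeated doubling extends this to all t. The constant
does not depend on D. *)
Lemma circle_gap (w : circle R -> \bar R) :
  measurable_fun setT w -> (forall x, 0 <= w x) ->
  0 < \int[@haar1 R]_x w x ->
  exists2 C : R, (0 <= C)%R &
    forall D : circle R -> \bar R, quasi_modulus D -> measurable_fun setT D ->
    forall t, D t <= C%:E * \int[@haar1 R]_x (D x * w x).
Proof.
move=> mw w0 w1.
have [c c0 Z0] := positive_level_set mw w0 w1.
set Z := [set x | _] in Z0.
have mZ : measurable Z.
  by rewrite -[X in measurable X]setTI; exact: emeasurable_fun_c_infty.
have mpi : measurable_fun [set: measurableTypeR R]
    (@circle_pi R : measurableTypeR R -> circle R) by exact: measurable_circle_pi.
pose Zt : set R := @circle_pi R @^-1` Z `&` `[0%R, 1%R[.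
have mZt : measurable Zt.
  apply: measurableI => //; rewrite -[X in measurable X]setTI.
  exact: (@measurable_circle_pi R).
have [x [r [r0 rZ]]] := dense_ball mZt Z0.
set B := Zt `&` ball x r in rZ.
have mB : measurable B by apply: measurableI => //; exact: measurable_ball.
have [n nr] : exists n : nat, ((2 ^+ n)^-1 <= r / 4)%R.
  have r40 : (0 < r / 4)%R by lra.
  have [n _ h] := near_infty_natSinv_expn_lt (PosNum r40).
  by exists n; have := h n (leqnn n); rewrite /= div1r => /ltW.
(* Here n doublings take the interval of length r / 4 to one of length at least 1.
The factor 8 / r comes from the overlap, of measure r / 2, from the factor 2 of the
quasi-triangle inequality and from its two terms. *)
exists (4 ^+ n * (8 / (r * c)))%R.
  by rewrite mulr_ge0 ?exprn_ge0// divr_ge0// mulr_ge0// ltW.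
move=> D qD mD t; have [D0 DN DD] := qD; set I := \int[_]_x _.
have mDpi : measurable_fun [set: R] (D \o (@circle_pi R : R -> circle R)).
  exact: (measurableT_comp mD (@measurable_circle_pi R)).
pose J := \int[@lebesgue_measure R]_(s in B) D (circle_pi s).
have JI : c%:E * J <= I.
  rewrite /J -ge0_integralZl//; last 2 first.
  - exact: measurable_funTS.
  - by rewrite lee_fin ltW.
  rewrite /I haar1_integral//; last 2 first.
  - exact: emeasurable_funM.
  - by move=> z; exact: mule_ge0.
  have mDw : measurable_fun [set: R] (fun s => D (circle_pi s) * w (circle_pi s)).
    by apply: emeasurable_funM => //; exact: (measurableT_comp mw (@measurable_circle_pi R)).
  apply: (@le_trans _ _ (\int[@lebesgue_measure R]_(s in B) (D (circle_pi s) * w (circle_pi s)))).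
    apply: ge0_le_integral => //.
    - by move=> s _; rewrite mule_ge0// lee_fin ltW.
    - by apply: emeasurable_funM => //; exact: measurable_funTS.
    - exact: measurable_funTS.
    - by move=> s [[Zs _] _]; rewrite muleC lee_wpmul2l.
  apply: ge0_subset_integral => //.
  - exact: measurable_funTS.
  - by move=> s _; exact: mule_ge0.
  - by move=> s [[_]].
have small u : (`|u| <= r / 4)%R -> D (circle_pi u) <= (8 / (r * c))%:E * I.
  move=> ur; have := overlap_ball mB (@subIsetr _ _ _) r0 ur rZ.
  set E := B `&` _ => Er.
  have mE : measurable E.
    apply: measurableI => //; rewrite -[X in measurable X]setTI.
    have : measurable_fun [set: R] (fun t => t + u)%R by exact: measurable_funD.
    exact.
  have mDu : measurable_fun [set: R] (fun s => D (circle_pi (s + u)%R)).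
    apply: (measurableT_comp mDpi); exact: measurable_funD.
  have EJ : \int[@lebesgue_measure R]_(s in E) D (circle_pi s) <= J.
    by apply: ge0_subset_integral => //; [exact: measurable_funTS|exact: subIsetl].
  have EuJ : \int[@lebesgue_measure R]_(s in E) D (circle_pi (s + u)%R) <= J.
    rewrite integral_mkcond /J [leRHS]integral_mkcond.
    have mDB : measurable_fun [set: R] ((D \o @circle_pi R) \_ B).
      by apply/(measurable_restrictT _ mB); exact: measurable_funTS.
    rewrite -[leRHS](lebesgue_integral_shift u)//; last first.
      by move=> s; rewrite patchE; case: ifP.
    apply: ge0_le_integral => //.
    - by move=> s _; rewrite patchE; case: ifP.
    - by apply/(measurable_restrictT _ mE); exact: measurable_funTS.
    - by apply: (measurableT_comp mDB); exact: measurable_funD.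
    - move=> s _; rewrite !patchE; case: ifPn => [|_]; last by case: ifP.
      by rewrite inE => -[_ Bsu]; rewrite mem_set.
  have : D (circle_pi u) * lebesgue_measure E <= 2%:E * (J + J).
    rewrite -integral_cst//; apply: (@le_trans _ _ (\int[@lebesgue_measure R]_(s in E)
        (2%:E * (D (circle_pi (s + u)%R) + D (circle_pi s))))).
      apply: ge0_le_integral => //.
      - by move=> s _ /=.
      - by apply: emeasurable_funM => //; apply: emeasurable_funD; exact: measurable_funTS.
      - move=> s _ /=; have := quasi_modulusB (circle_pi (s + u)%R) (circle_pi s) qD.
        by rewrite circle_piD addrAC subrr add0r.
    rewrite ge0_integralZl//; last 2 first.
    - apply: emeasurable_funD; exact: measurable_funTS.
    - by move=> s _; exact: adde_ge0.
    rewrite ge0_integralD//; [|exact: measurable_funTS..].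
    by rewrite lee_pmul2l// leeD.
  move=> H.
  have {}H : D (circle_pi u) * (r / 2)%:E <= 2%:E * (J + J).
    by apply: le_trans H; rewrite lee_wpmul2l.
  have -> : D (circle_pi u) = (2 / r)%:E * (D (circle_pi u) * (r / 2)%:E).
    by rewrite muleC -muleA -EFinM (_ : r / 2 * (2 / r) = 1)%R ?mule1//; field; rewrite gt_eqF.
  have -> : (8 / (r * c))%:E * I = (2 / r)%:E * (2%:E * (2%:E * ((c^-1)%:E * I))).
    by rewrite !muleA -!EFinM; congr (_%:E * _); field; rewrite !gt_eqF.
  have rc : (0 <= 2 / r)%R by rewrite divr_ge0// ltW.
  apply: lee_wpmul2l; first by rewrite lee_fin.
  apply: (le_trans H); apply: lee_wpmul2l => //.
  have -> : J + J = 2%:E * J by rewrite mule_natl mule2n.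
  apply: lee_wpmul2l => //.
  have -> : J = (c^-1)%:E * (c%:E * J).
    by rewrite muleA -EFinM mulVf ?mul1e// gt_eqF.
  by apply: lee_wpmul2l => //; rewrite lee_fin invr_ge0 ltW.
have [s [/andP[s0 s1] <-]] := circle_lift01 t.
have -> : s = ((s / 2 ^+ n) *+ (2 ^ n))%R.
  by rewrite -mulr_natr natrX divfK// expf_neq0.
apply: (le_trans (quasi_modulus_double _ _ qD)).
rewrite EFinM -muleA lee_wpmul2l ?lee_fin ?exprn_ge0//; apply: small.
rewrite ger0_norm ?divr_ge0 ?exprn_ge0//; apply: le_trans nr.
by rewrite ler_piMl ?invr_ge0 ?exprn_ge0// ltW.
Qed.

End quasi_modulus.

(** * The spectral gap of the noise *)

Section noise_gap.
Variable R : realType.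
Local Open Scope ereal_scope.
Implicit Types (D : torus R -> \bar R) (F : torus R -> \bar R).

(** The density of P with respect to mu is at least some a > 0 on a set of
positive measure. *)
Lemma dominated_minorization d (T : measurableType d)
    (P : probability T R) (mu : {sigma_finite_measure set T -> \bar R}) :
  P `<< mu -> exists (a : R) (E : set T), [/\ (0 < a)%R, measurable E, 0 < mu E &
    forall F : T -> \bar R, measurable_fun setT F -> (forall x, 0 <= F x) ->
      a%:E * \int[mu]_x (F x * (\1_E x)%:E) <= \int[P]_x F x].
Proof.
move=> Pmu; set f := Radon_Nikodym_SigmaFinite.f P mu.
have f0 : forall x, 0 <= f x by exact: Radon_Nikodym_SigmaFinite.f_ge0.
have mf : measurable_fun setT f.
  exact: (measurable_int mu (Radon_Nikodym_SigmaFinite.f_integrable Pmu)).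
have [a a0 E0] : exists2 c : R, (0 < c)%R & 0 < mu [set x | c%:E <= f x].
  apply: positive_level_set => //.
  rewrite -(Radon_Nikodym_SigmaFinite.f_integral Pmu)//.
  by rewrite [X in _ < X](probability_setT P) lte01.
have mE : measurable [set x | a%:E <= f x].
  by rewrite -[X in measurable X]setTI; exact: emeasurable_fun_c_infty.
set E := [set x | _] in E0 mE; exists a, E; split => // F mF F0.
rewrite -(Radon_Nikodym_SigmaFinite.change_of_variables Pmu F0 measurableT mF).
have mFE : measurable_fun setT (fun x => F x * (\1_E x)%:E).
  apply: emeasurable_funM => //; apply/measurable_EFinP; exact: measurable_indic.
rewrite -ge0_integralZl//; last 2 first.
- by move=> x _; rewrite mule_ge0// lee_fin.
- by rewrite lee_fin ltW.
apply: ge0_le_integral => //.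
- by move=> x _; rewrite !mule_ge0 ?lee_fin// ltW.
- exact: emeasurable_funM.
- exact: emeasurable_funM.
move=> x _; rewrite muleCA lee_wpmul2l// indicE; have [/set_mem aE|_] := boolP (x \in E); last by rewrite mule0.
by rewrite mule1.
Qed.

Lemma measurable_torus_sub d (T : measurableType d) (f g : T -> torus R) :
  measurable_fun setT f -> measurable_fun setT g ->
  measurable_fun setT (fun z => f z - g z)%R.
Proof. by move=> mf mg; apply: measurable_torusD => //; exact: measurable_torusN. Qed.

(** Two points on the same vertical circle a, weighted by w, differ by a vertical
translation. The weight u c, the total weight of pairs at vertical distance c, has
positive integral over the circle, because the mass g a of the vertical circle a
is positive for a set of positive measure of a, and the integral of u is that of
g^2. The Steinhaus theorem on the circle then applies to u. *)
Lemma torus_gap (w : torus R -> \bar R) :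
  measurable_fun setT w -> (forall x, 0 <= w x <= 1) ->
  0 < \int[@haar2 R]_x w x ->
  exists2 C : R, (0 <= C)%R &
    forall D, quasi_modulus D -> measurable_fun setT D ->
    forall t : circle R, D (0%R : circle R, t) <= C%:E * \int[@haar2 R]_x (D x * w x).
Proof.
move=> mw w01 wpos.
have w0 x : 0 <= w x by have /andP[] := w01 x.
have w1 x : w x <= 1 by have /andP[] := w01 x.
pose u (c : circle R) := \int[@haar2 R]_p (w (p.1, (p.2 + c)%R) * w p).
have mwshift : measurable_fun setT (fun q : circle R * torus R =>
    w (q.2.1, (q.2.2 + q.1)%R)).
  apply: (measurableT_comp mw); apply: measurable_fun_pair.
    by do 2 apply: measurableT_comp => //.
  apply: measurable_circleD => //; by apply: measurableT_comp.
have mww : measurable_fun setT (fun q : circle R * torus R =>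
    w (q.2.1, (q.2.2 + q.1)%R) * w q.2).
  by apply: emeasurable_funM => //; exact: measurableT_comp.
have mu : measurable_fun setT u.
  by apply: (measurable_haar2_integral mww) => q; exact: mule_ge0.
have u0 c : 0 <= u c by apply: integral_ge0 => p _; exact: mule_ge0.
pose g (a : circle R) := \int[@haar1 R]_c w (a, c).
have mg : measurable_fun setT g by exact: measurable_haar1_integral.
have g0 a : 0 <= g a by exact: integral_ge0.
have mwa a : measurable_fun setT (fun c => w (a, c)) by exact: measurable_fun_pair2.
have upos : 0 < \int[@haar1 R]_c u c.
  have ww0 (q : circle R * torus R) : 0 <= w (q.2.1, (q.2.2 + q.1)%R) * w q.2.
    exact: mule_ge0.
  apply: (lt_le_trans _ (eq_lee (esym (haar12_swap mww ww0)))) => /=.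
  have -> : \int[@haar2 R]_p \int[@haar1 R]_c (w (p.1, (p.2 + c)%R) * w p) =
      \int[@haar2 R]_p (w p * g p.1).
    apply: eq_integral => p _; under eq_integral do rewrite muleC.
    rewrite ge0_integralZl//; last exact: (measurable_fun_pair1 p mwshift).
    congr (_ * _); rewrite -[RHS](@haar1_integral_shift _ p.2 (fun c => w (p.1, c)))//.
    by apply: eq_integral => c _; rewrite addrC.
  rewrite haar2_integral//; last 2 first.
  - by apply: emeasurable_funM => //; exact: measurableT_comp.
  - by move=> p; exact: mule_ge0.
  have -> : \int[@haar1 R]_a \int[@haar1 R]_c (w (a, c) * g a) =
      \int[@haar1 R]_a (g a * g a).
    apply: eq_integral => a _; under eq_integral do rewrite muleC.
    by rewrite ge0_integralZl.
  rewrite haar2_integral// in wpos.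
  have [c c0 cpos] := positive_level_set mg g0 wpos.
  have mE : measurable [set x | c%:E <= g x].
    by rewrite -[X in measurable X]setTI; exact: emeasurable_fun_c_infty.
  apply: (@lt_le_trans _ _ (\int[@haar1 R]_(x in [set x | c%:E <= g x]) (c * c)%:E)).
    by rewrite integral_cst// mule_gt0// lte_fin mulr_gt0.
  have mgg : measurable_fun setT (fun a => g a * g a) by exact: emeasurable_funM.
  apply: (@le_trans _ _ (\int[@haar1 R]_(x in [set x | c%:E <= g x]) (g x * g x))).
    apply: ge0_le_integral => //.
    - by move=> x _; rewrite lee_fin mulr_ge0// ltW.
    - exact: measurable_funTS.
    - by move=> x /= cg; rewrite EFinM lee_pmul// lee_fin ltW.
  by apply: ge0_subset_integral => // x _; exact: mule_ge0.
have [C C0 HC] := circle_gap mu u0 upos.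
exists (C * 4)%R => [|D qD mD t]; first by rewrite mulr_ge0.
have [D0 DN DD] := qD.
have mD0 : measurable_fun setT (fun c => D (0%R : circle R, c)).
  exact: measurable_fun_pair2.
have qD0 : quasi_modulus (fun c : circle R => D (0%R : circle R, c)).
  split=> [z|z|y z]; first exact: D0.
    by rewrite -[RHS]DN; congr D; apply/pair_equal_spec; split => //; rewrite oppr0.
  apply: le_trans (DD _ _); rewrite le_eqVlt; apply/orP; left; apply/eqP.
  by congr D; apply/pair_equal_spec; split => //=; rewrite addr0.
apply: (le_trans (HC _ qD0 mD0 t)); rewrite EFinM -muleA; apply: lee_wpmul2l => //.
have mDww : measurable_fun setT (fun q : circle R * torus R =>
    D (0%R : circle R, q.1) * (w (q.2.1, (q.2.2 + q.1)%R) * w q.2)).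
  by apply: emeasurable_funM => //; exact: (measurableT_comp mD0 measurable_fst).
have mDw : measurable_fun setT (fun p => D p * w p) by exact: emeasurable_funM.
have Dw0 p : 0 <= D p * w p by exact: mule_ge0.
have mDwa a : measurable_fun setT (fun c => D (a, c) * w (a, c)).
  exact: (measurable_fun_pair2 a mDw).
have mG : measurable_fun setT (fun a => \int[@haar1 R]_c (D (a, c) * w (a, c))).
  exact: (measurable_haar1_integral mDw).
have G0 a : 0 <= \int[@haar1 R]_c (D (a, c) * w (a, c)) by exact: integral_ge0.
have -> : \int[@haar1 R]_c (D (0%R : circle R, c) * u c) =
    \int[@haar1 R]_c \int[@haar2 R]_p
      (D (0%R : circle R, c) * (w (p.1, (p.2 + c)%R) * w p)).
  apply: eq_integral => c _; rewrite ge0_integralZl//.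
    exact: (measurable_fun_pair2 c mww).
  by move=> p _; exact: mule_ge0.
have Dww0 (q : circle R * torus R) :
  0 <= D (0%R : circle R, q.1) * (w (q.2.1, (q.2.2 + q.1)%R) * w q.2).
  by rewrite !mule_ge0.
apply: (le_trans (eq_lee (haar12_swap mDww Dww0))) => /=.
pose K := \int[@haar2 R]_p (D p * w p).
apply: (@le_trans _ _ (\int[@haar2 R]_p
    (2%:E * (\int[@haar1 R]_c (D (p.1, c) * w (p.1, c)) + D p * w p)))); last first.
  rewrite ge0_integralZl//; last 2 first.
  - by apply: emeasurable_funD => //; exact: (measurableT_comp mG measurable_fst).
  - by move=> p _; exact: adde_ge0.
  rewrite ge0_integralD//; last exact: (measurableT_comp mG measurable_fst).
  rewrite (haar2_integral_fst mG)// -(haar2_integral mDw)// -/K.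
  have -> : K + K = 2%:E * K by rewrite mule_natl mule2n.
  by rewrite muleA -EFinM lee_wpmul2r//; [exact: integral_ge0|rewrite lee_fin; lra].
apply: ge0_le_integral => //.
- by move=> p _; apply: integral_ge0 => c _; rewrite !mule_ge0.
- exact: (measurable_haar1_integral_swap mDww Dww0).
- apply: emeasurable_funM => //; apply: emeasurable_funD => //.
  exact: (measurableT_comp mG measurable_fst).
move=> [a b] _ /=.
have mH : measurable_fun setT (fun c : circle R =>
    D (0%R : circle R, (c - b)%R) * (w (a, c) * w (a, b))).
  apply: emeasurable_funM.
    apply: (measurableT_comp mD0); apply: measurable_circleD => //.
  by apply: emeasurable_funM.
rewrite (_ : \int[@haar1 R]_x _ = \int[@haar1 R]_c
    (D (0%R : circle R, (c - b)%R) * (w (a, c) * w (a, b)))); last first.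
  rewrite -[RHS](@haar1_integral_shift _ b)//; last by move=> c; rewrite !mule_ge0.
  by apply: eq_integral => c _; rewrite addrK [(c + b)%R]addrC.
rewrite -[D (a, b) * w (a, b)](probability_integral_cst (@haar1 R)).
rewrite -ge0_integralD// -ge0_integralZl//; last 2 first.
- exact: emeasurable_funD.
- by move=> c _; exact: adde_ge0.
apply: ge0_le_integral => //.
- by move=> c _; rewrite !mule_ge0.
- by apply: emeasurable_funM => //; exact: emeasurable_funD.
move=> c _.
have Dab : D (0%R : circle R, (c - b)%R) <= 2%:E * (D (a, c) + D (a, b)).
  apply: le_trans (quasi_modulusB (a, c) (a, b) qD).
  rewrite le_eqVlt; apply/orP; left; apply/eqP.
  by congr D; apply/pair_equal_spec; split => //=; rewrite subrr.
apply: (@le_trans _ _ (2%:E * (D (a, c) + D (a, b)) * (w (a, c) * w (a, b)))).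
  by apply: lee_wpmul2r => //; exact: mule_ge0.
rewrite -muleA; apply: lee_wpmul2l => //.
rewrite ge0_muleDl//; apply: leeD.
  rewrite muleA -[leRHS]mule1; apply: lee_wpmul2l => //.
rewrite (muleC (w _)) muleA -[leRHS]mule1; apply: lee_wpmul2l => //.
Qed.

(** The weighted count w z of the pairs with difference z is a weight for
[torus_gap]. *)
Lemma torus_gap_convolution (k : torus R -> \bar R) :
  measurable_fun setT k -> (forall x, 0 <= k x <= 1) ->
  0 < \int[@haar2 R]_x k x ->
  exists2 C : R, (0 <= C)%R &
    forall D, quasi_modulus D -> measurable_fun setT D ->
    forall t : circle R, D (0%R : circle R, t) <=
      C%:E * \int[@haar2 R]_p \int[@haar2 R]_q (D (p - q)%R * (k q * k p)).
Proof.
move=> mk k01 kpos.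
have k0 x : 0 <= k x by have /andP[] := k01 x.
have k1 x : k x <= 1 by have /andP[] := k01 x.
pose w (z : torus R) := \int[@haar2 R]_p (k (p + z)%R * k p).
have mkk : measurable_fun setT (fun q : torus R * torus R => k (q.2 + q.1)%R * k q.2).
  apply: emeasurable_funM; last exact: measurableT_comp.
  by apply: (measurableT_comp mk); exact: measurable_torusD.
have kk0 (q : torus R * torus R) : 0 <= k (q.2 + q.1)%R * k q.2 by exact: mule_ge0.
have mw : measurable_fun setT w.
  exact: (measurable_haar2_integral mkk).
have w0 z : 0 <= w z by apply: integral_ge0 => p _; exact: mule_ge0.
have w1 z : w z <= 1.
  rewrite -[leRHS](probability_integral_cst (@haar2 R)); apply: ge0_le_integral => //.
  - by move=> p _; exact: mule_ge0.
  - exact: (measurable_fun_pair2 z mkk).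
  - by move=> p _; rewrite -[leRHS]mule1 lee_pmul.
have wpos : 0 < \int[@haar2 R]_z w z.
  apply: (lt_le_trans _ (eq_lee (esym (haar22_swap mkk kk0)))) => /=.
  have -> : \int[@haar2 R]_p \int[@haar2 R]_z (k (p + z)%R * k p) =
      \int[@haar2 R]_p ((\int[@haar2 R]_x k x) * k p).
    apply: eq_integral => p _; under eq_integral do rewrite muleC.
    have mkp : measurable_fun setT (fun z => k (p + z)%R).
      by apply: (measurableT_comp mk); exact: measurable_torusD.
    rewrite ge0_integralZl// muleC; congr (_ * _).
    rewrite -[RHS](@haar2_integral_shift _ p)//.
    by apply: eq_integral => z _; rewrite addrC.
  rewrite ge0_integralZl//; last exact: ltW.
  exact: mule_gt0.
have [C C0 HC] := torus_gap mw (fun z => introT andP (conj (w0 z) (w1 z))) wpos.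
exists C => // D qD mD t; have [D0 DN DD] := qD.
apply: (le_trans (HC D qD mD t)); apply: lee_wpmul2l => //.
have mDkk : measurable_fun setT (fun q : torus R * torus R =>
    D q.1 * (k (q.2 + q.1)%R * k q.2)).
  by apply: emeasurable_funM => //; exact: measurableT_comp.
have -> : \int[@haar2 R]_z (D z * w z) =
    \int[@haar2 R]_z \int[@haar2 R]_p (D z * (k (p + z)%R * k p)).
  apply: eq_integral => z _; rewrite ge0_integralZl//.
    exact: (measurable_fun_pair2 z mkk).
  by move=> p _; exact: mule_ge0.
have Dkk0 (q : torus R * torus R) : 0 <= D q.1 * (k (q.2 + q.1)%R * k q.2).
  by rewrite !mule_ge0.
apply: eq_lee; apply: (etrans (haar22_swap mDkk Dkk0)); apply: eq_integral => p _.
have mH : measurable_fun setT (fun q : torus R => D (p - q)%R * (k q * k p)).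
  apply: emeasurable_funM; first by apply: (measurableT_comp mD); exact: measurable_torus_sub.
  by apply: emeasurable_funM.
rewrite -[RHS](@haar2_integral_shift _ p)//; last by move=> q; rewrite !mule_ge0.
apply: eq_integral => z _; rewrite [(z + p)%R]addrC; congr (_ * _).
by rewrite -[LHS]DN; congr D; rewrite opprD addrA subrr add0r.
Qed.

(** A common lower bound for both kinds of noise: the image by a homomorphism j of
a nonzero bounded density k on the torus. For a density on the torus j is the
identity; for a vertical line measure it is the projection to the vertical axis.
In both cases j fixes vertical translations, the only ones that are needed. *)
Lemma noise_minorization (nu : probability (torus R) R) :
  nu `<< @haar2 R \/ vertical_line_measure nu ->
  exists (a : R) (k : torus R -> \bar R) (j : torus R -> torus R),
    [/\ (0 < a)%R,
      [/\ measurable_fun setT k, forall x, 0 <= k x <= 1 & 0 < \int[@haar2 R]_x k x],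
      [/\ measurable_fun setT j, {morph j : x y / (x - y)%R} &
          forall t : circle R, j (0%R : circle R, t) = (0%R : circle R, t)] &
      forall F, measurable_fun setT F -> (forall x, 0 <= F x) ->
        a%:E * \int[@haar2 R]_p (F (j p) * k p) <= \int[nu]_x F x].
Proof.
move=> [nuac|[chi [h [mh h0 chiE nuE]]]].
  have [a [E [a0 mE E0 H]]] := dominated_minorization nuac.
  exists a, (fun x => (\1_E x)%:E), id; split => //; split => //.
  - by apply/measurable_EFinP; exact: measurable_indic.
  - by move=> x; rewrite !lee_fin ler0n indicE lern1 leq_b1.
  - by rewrite integral_indic// setIT.
have chiac : chi `<< @haar1 R.
  apply/null_content_dominatesP => A mA A0.
  rewrite chiE//; apply: null_set_integral => //.
  exact: measurable_funTS (measurableT_comp _ mh).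
have [a [E [a0 mE E0 H]]] := dominated_minorization chiac.
exists a, (fun x => (\1_E x.2)%:E), (fun x => (0%R : circle R, x.2)).
have mE1 : measurable_fun setT (fun x : circle R => (\1_E x)%:E : \bar R).
  by apply/measurable_EFinP; exact: measurable_indic.
have mk : measurable_fun setT (fun x : torus R => (\1_E x.2)%:E : \bar R).
  exact: (measurableT_comp mE1 measurable_snd).
have sndint (G : circle R -> \bar R) : measurable_fun setT G -> (forall x, 0 <= G x) ->
    \int[@haar2 R]_x G x.2 = \int[@haar1 R]_x G x.
  move=> mG G0; rewrite haar2_integral//; last exact: (measurableT_comp mG measurable_snd).
  exact: (probability_integral_cst (@haar1 R) (\int[@haar1 R]_x G x)).
split => //; first split => //.
- by move=> x; rewrite !lee_fin ler0n indicE lern1 leq_b1.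
- by rewrite [ltRHS](sndint (fun x => (\1_E x)%:E))// integral_indic// setIT.
- split => //; first exact: measurable_fun_pair.
  by move=> x y; apply/pair_equal_spec; split => //=; rewrite subrr.
move=> F mF F0.
have mF0 : measurable_fun setT (fun t => F (0%R : circle R, t)) by exact: measurable_fun_pair2.
rewrite (sndint (fun t => F (0%R : circle R, t) * (\1_E t)%:E)); last 2 first.
- exact: emeasurable_funM.
- by move=> t; rewrite mule_ge0// lee_fin.
apply: (le_trans (H _ mF0 (fun t => F0 _))).
have -> : \int[nu]_x F x = \int[\d_(0%R : circle R) \x chi]_x F x.
  by apply: eq_measure_integral => A mA _; exact: nuE.
rewrite fubini_tonelli1// integral_dirac//.
  by rewrite diracT mul1e.
exact: measurable_fun_fubini_tonelli_F.
Qed.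

(** Pulled back by j, D is again a quasi-modulus with the same vertical values, and
the lower bound for the noise is used for x and for y in turn. *)
Lemma noise_gap (nu : probability (torus R) R) :
  nu `<< @haar2 R \/ vertical_line_measure nu ->
  exists2 C : R, (0 <= C)%R &
    forall D, quasi_modulus D -> measurable_fun setT D ->
    forall t : circle R, D (0%R : circle R, t) <=
      C%:E * \int[nu]_x \int[nu]_y D (x - y)%R.
Proof.
move=> /noise_minorization[a [k [j [a0 [mk k01 kpos] [mj jB j0] H]]]].
have k0 x : 0 <= k x by have /andP[] := k01 x.
have [C C0 HC] := torus_gap_convolution mk k01 kpos.
exists (C / (a * a))%R => [|D qD mD t]; first by rewrite divr_ge0// mulr_ge0// ltW.
have [D0 DN DD] := qD.
have jN x : j (- x)%R = (- j x)%R.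
  by rewrite -[(- x)%R]add0r jB -{1}[0%R](subrr 0%R) jB subrr sub0r.
have jD x y : j (x + y)%R = (j x + j y)%R by rewrite -{1}[y]opprK jB jN opprK.
have qDj : quasi_modulus (D \o j).
  by split => [z|z|y z] /=; [exact: D0|rewrite jN DN|rewrite jD; exact: DD].
have mDj : measurable_fun setT (D \o j) by exact: measurableT_comp.
have := HC _ qDj mDj t; rewrite /= j0 => /le_trans; apply.
rewrite EFinM -muleA; apply: lee_wpmul2l => //.
have mDsub : measurable_fun setT (fun q : torus R * torus R => D (q.1 - q.2)%R).
  by apply: (measurableT_comp mD); exact: measurable_torus_sub.
have mDsubj : measurable_fun setT (fun q : torus R * torus R => D (q.1 - j q.2)%R * k q.2).
  apply: emeasurable_funM; last exact: measurableT_comp.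
  apply: (measurableT_comp mD); apply: measurable_torus_sub => //.
  exact: measurableT_comp.
have Dk0 (q : torus R * torus R) : 0 <= D (q.1 - j q.2)%R * k q.2 by exact: mule_ge0.
pose I1 x := \int[@haar2 R]_q (D (x - j q)%R * k q).
have mI1 : measurable_fun setT I1.
  exact: (measurable_haar2_integral mDsubj).
have I10 x : 0 <= I1 x by apply: integral_ge0 => q _; exact: mule_ge0.
have step1 : a%:E * \int[@haar2 R]_p (I1 (j p) * k p) <= \int[nu]_x I1 x by exact: H.
have step2 : a%:E * \int[nu]_x I1 x <= \int[nu]_x \int[nu]_y D (x - y)%R.
  rewrite -ge0_integralZl//; last by rewrite lee_fin ltW.
  apply: ge0_le_integral => //.
  - by move=> x _; rewrite mule_ge0// lee_fin ltW.
  - exact: emeasurable_funM.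
  - exact: (@measurable_fun_fubini_tonelli_F _ _ _ _ _ nu _ mDsub).
  move=> x _; apply: (H (fun y => D (x - y)%R)) => //.
  exact: (measurable_fun_pair2 x mDsub).
have -> : \int[@haar2 R]_p \int[@haar2 R]_q (D (j (p - q)%R) * (k q * k p)) =
    \int[@haar2 R]_p (I1 (j p) * k p).
  apply: eq_integral => p _; rewrite muleC -ge0_integralZl//; last 2 first.
  - exact: (measurable_fun_pair2 (j p) mDsubj).
  - by move=> q _; exact: mule_ge0.
  by apply: eq_integral => q _; rewrite jB muleA muleC.
have aa : (0 <= (a * a)^-1)%R by rewrite invr_ge0 mulr_ge0// ltW.
have -> : \int[@haar2 R]_p (I1 (j p) * k p) = ((a * a)^-1)%:E *
    (a%:E * (a%:E * \int[@haar2 R]_p (I1 (j p) * k p))).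
  rewrite !muleA -!EFinM (_ : (a * a)^-1 * a * a = 1)%R ?mul1e//.
  by field; rewrite gt_eqF.
apply: lee_wpmul2l; first by rewrite lee_fin.
by apply: le_trans step2; apply: lee_wpmul2l => //; rewrite lee_fin ltW.
Qed.

End noise_gap.

(** * Two shears and two cones *)

Section ping_pong.
Variable R : realType.
Local Open Scope ereal_scope.
Implicit Types (xi : R * R -> R) (v : R * R).

(** The slope 3 is large enough for this cone and its image by the horizontal
shear to cover the plane up to the horizontal axis, and bounded, so that vertical
shears by more than 6 move the cone off itself. *)
Definition cone : set (R * R) := [set v | v.1 != 0%R /\ (`|v.2| <= 3 * `|v.1|)%R].

Definition plane_sqdist xi psi := sqdist (@leb2 R) xi psi.

Lemma plane_sqdist_ge0 xi psi : 0 <= plane_sqdist xi psi.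
Proof. exact: sqdist_ge0. Qed.

Lemma plane_sqdistC xi psi : plane_sqdist xi psi = plane_sqdist psi xi.
Proof. exact: sqdistC. Qed.

Lemma plane_sqdistxx xi : plane_sqdist xi xi = 0.
Proof. exact: sqdistxx. Qed.

Lemma plane_sqdist_tri xi psi zeta : measurable_fun setT xi ->
  measurable_fun setT psi -> measurable_fun setT zeta ->
  plane_sqdist xi zeta <= 2%:E * (plane_sqdist xi psi + plane_sqdist psi zeta).
Proof.
by move=> m1 m2 m3; exact: (@sqdist_tri _ _ R (@leb2 R) xi psi zeta m1 m2 m3).
Qed.

Lemma plane_sqdist_vshear t xi psi : measurable_fun setT xi ->
  measurable_fun setT psi ->
  plane_sqdist (xi \o vshear t) (psi \o vshear t) = plane_sqdist xi psi.
Proof.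
move=> m1 m2.
exact: (@sqdist_preserving _ _ R (@leb2 R) _ xi psi (preserving_vshear t) m1 m2).
Qed.

Definition plane_sqnorm xi := \int[@leb2 R]_v (xi v ^+ 2)%:E.

Lemma measurable_cone : measurable cone.
Proof.
have -> : cone = (fun v => (v.1 != 0%R) && (`|v.2| <= 3 * `|v.1|)%R) @^-1` [set true].
  by apply/seteqP; split => v /= => [[-> ->]|/andP].
rewrite -[X in measurable X]setTI.
have m1 : measurable_fun setT (fun v : R * R => v.1 != 0%R).
  apply: (@measurable_neg _ _ _ (fun v : R * R => v.1 == 0%R)).
  exact: measurable_fun_eqr.
have m2 : measurable_fun setT (fun v : R * R => (`|v.2| <= 3 * `|v.1|)%R).
  apply: measurable_fun_ler; first by apply: measurableT_comp.
  by apply: measurable_funM => //; apply: measurableT_comp.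
by have := measurable_and m1 m2; apply.
Qed.

Lemma cone_vshear_disjoint v (s t : R) : (6 < `|s - t|)%R ->
  cone (vshear (- s) v) -> ~ cone (vshear (- t) v).
Proof.
move=> st [/= v0 h1] [/= _ h2].
have v1 : (0 < `|v.1|)%R by rewrite normr_gt0.
have h : (`|(s - t) * v.1| <= 6 * `|v.1|)%R.
  rewrite (_ : (s - t) * v.1 = (v.2 + - t * v.1) - (v.2 + - s * v.1))%R; last by ring.
  by rewrite (le_trans (ler_normB _ _))//; lra.
by move: h; rewrite normrM ler_pM2r// leNgt st.
Qed.

Lemma sum_exclusive n (b : 'I_n -> bool) :
  (forall i j, b i -> b j -> i = j) -> (\sum_(i < n) (b i)%:R <= 1 :> R)%R.
Proof.
move=> H; have [i bi|nb] := pickP b; last first.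
  by rewrite big1// => i _; rewrite nb.
rewrite (bigD1 i)//= bi big1 ?addr0// => j /negP ji.
by case: (boolP (b j)) => // bj; case: ji; rewrite (H _ _ bj bi).
Qed.

Lemma sqdist_vshear_iter xi (t : R) (n : nat) : measurable_fun setT xi ->
  plane_sqdist (xi \o vshear (t *+ n)) xi <=
  (4 ^+ n)%:E * plane_sqdist (xi \o vshear t) xi.
Proof.
move=> mxi; elim: n => [|n IH].
  rewrite mulr0n expr0 mul1e (_ : xi \o _ = xi).
    by rewrite plane_sqdistxx plane_sqdist_ge0.
  by apply/funext => -[a b]; rewrite /vshear/= mul0r addr0.
have mc s : measurable_fun setT (xi \o vshear s).
  exact: (measurableT_comp mxi (measurable_vshear s)).
have -> : xi \o vshear (t *+ n.+1) = (xi \o vshear t) \o vshear (t *+ n).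
  by apply/funext => v; rewrite /= vshearD mulrSr.
have mct : measurable_fun setT ((xi \o vshear t) \o vshear (t *+ n)).
  exact: (measurableT_comp (mc t) (measurable_vshear _)).
apply: (le_trans (plane_sqdist_tri mct (mc (t *+ n)%R) mxi)).
rewrite (plane_sqdist_vshear (t *+ n)%R (mc t) mxi).
set d := plane_sqdist (xi \o vshear t) xi in IH *.
have d0 : 0 <= d by exact: plane_sqdist_ge0.
apply: (@le_trans _ _ (2%:E * (d + (4 ^+ n)%:E * d))).
  by apply: lee_wpmul2l => //; apply: leeD.
rewrite -{1}[d]mul1e -ge0_muleDl ?lee_fin ?exprn_ge0// muleA.
apply: lee_wpmul2r => //; rewrite -EFinD -EFinM lee_fin exprS.
have : (1 <= 4 ^+ n :> R)%R by rewrite exprn_ege1//; lra.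
lra.
Qed.

Lemma measurable_cone_sq xi : measurable_fun setT xi ->
  measurable_fun setT (fun v => (\1_cone v)%:E * (xi v ^+ 2)%:E).
Proof.
move=> mxi; apply: emeasurable_funM; last exact: measurable_sq.
by apply/measurable_EFinP; exact: measurable_indic measurable_cone.
Qed.

Lemma cone_sq_ge0 xi v v' : 0 <= (\1_cone v)%:E * (xi v' ^+ 2)%:E.
Proof. by rewrite mule_ge0 ?lee_fin ?sqr_ge0. Qed.

(** Iterating the shear M times moves the cone off itself, so eight of these
iterates give disjoint cones. As xi is nearly invariant, its mass on the cone is at
most twice its mass on each of them, up to an error; the factor 2 comes from the
triangle inequality. Averaging over the eight bounds it by a quarter of the total. *)
Lemma cone_mass (t0 : R) : (0 < t0)%R ->
  exists2 K : R, (0 <= K)%R & forall xi (t : R), measurable_fun setT xi -> (t0 <= t)%R ->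
    \int[@leb2 R]_v ((\1_cone v)%:E * (xi v ^+ 2)%:E) <=
    K%:E * plane_sqdist (xi \o vshear t) xi + (4^-1)%:E * plane_sqnorm xi.
Proof.
move=> t00; pose M := Num.bound (6 / t0)%R.
have Mt : (6 < t0 *+ M)%R.
  have : (6 / t0 < M%:R)%R by apply: archi_boundP; rewrite divr_ge0// ltW.
  by rewrite ltr_pdivrMr// mulr_natl.
exists (2 * 4 ^+ (M * 8))%R; first by rewrite mulr_ge0// exprn_ge0.
move=> xi t mxi t0t; set d := plane_sqdist (xi \o vshear t) xi.
have d0 : 0 <= d by exact: plane_sqdist_ge0.
set X := \int[_]_v _; set S := plane_sqnorm xi.
(* Any two of these shears differ by a multiple of M t, which is more than 6. *)
pose tau (j : 'I_8) := (t *+ (M * j.+1))%R.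
pose Y (j : 'I_8) v := (\1_cone (vshear (- tau j) v))%:E * (xi v ^+ 2)%:E.
have mconeE : measurable_fun setT (fun v => (\1_cone v : R)).
  exact: measurable_indic measurable_cone.
have mY j : measurable_fun setT (Y j).
  apply: emeasurable_funM; last exact: measurable_sq.
  apply/measurable_EFinP.
  exact: (measurableT_comp mconeE (measurable_vshear (- tau j)%R)).
have Y0 j v : 0 <= Y j v by exact: cone_sq_ge0.
have each j : X <= (2 * 4 ^+ (M * 8))%:E * d + 2%:E * \int[@leb2 R]_v Y j v.
  have mxit : measurable_fun setT (xi \o vshear (tau j)).
    exact: (measurableT_comp mxi (measurable_vshear _)).
  have dtau : plane_sqdist (xi \o vshear (tau j)) xi <= (4 ^+ (M * 8))%:E * d.
    apply: (le_trans (sqdist_vshear_iter t (M * j.+1) mxi)).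
    apply: lee_wpmul2r => //; rewrite lee_fin ler_weXn2l//; first lra.
    by rewrite leq_mul2l; apply/orP; right.
  have <- : \int[@leb2 R]_v ((\1_cone v)%:E * (xi (vshear (tau j) v) ^+ 2)%:E) =
      \int[@leb2 R]_v Y j v.
    have [_ pS] := preserving_vshear (tau j).
    rewrite -(pS _ (mY j) (Y0 j)); apply: eq_integral => v _.
    rewrite /Y vshearD subrr (_ : vshear 0 v = v)//.
    by case: v => a b; rewrite /vshear/= mul0r addr0.
  apply: (@le_trans _ _ (2%:E * plane_sqdist (xi \o vshear (tau j)) xi +
      2%:E * \int[@leb2 R]_v ((\1_cone v)%:E * (xi (vshear (tau j) v) ^+ 2)%:E))); last first.
    by rewrite EFinM -muleA; apply: leeD => //; apply: lee_wpmul2l.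
  have mZ : measurable_fun setT
      (fun v => (\1_cone v)%:E * (xi (vshear (tau j) v) ^+ 2)%:E).
    by apply: emeasurable_funM; [exact/measurable_EFinP|exact: measurable_sq].
  have msq := measurable_sqB mxit mxi.
  rewrite /plane_sqdist /sqdist -!ge0_integralZl//; last 2 first.
  - by move=> v _; exact: cone_sq_ge0.
  - by move=> v _; rewrite lee_fin sqr_ge0.
  rewrite -ge0_integralD//; last 4 first.
  - by move=> v _; rewrite -EFinM lee_fin mulr_ge0 ?sqr_ge0.
  - exact: emeasurable_funM.
  - by move=> v _; rewrite mule_ge0//; exact: cone_sq_ge0.
  - exact: emeasurable_funM.
  apply: ge0_le_integral => //.
  - by move=> v _; exact: cone_sq_ge0.
  - exact: measurable_cone_sq.
  - by apply: emeasurable_funD; exact: emeasurable_funM.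
  move=> v _; rewrite -!EFinM -EFinD lee_fin indicE /=.
  set x := xi v; set y := xi _; case: (_ \in _) => /=.
    by have := sqr_ge0 (2 * y - x)%R; nra.
  by rewrite !mul0r mulr0 addr0 mulr_ge0// sqr_ge0.
have sumY : \sum_(j < 8) \int[@leb2 R]_v Y j v <= S.
  rewrite -ge0_integral_sum//.
  apply: ge0_le_integral => //.
  - by move=> v _; exact: sume_ge0.
  - exact: emeasurable_sum.
  - exact: measurable_sq.
  move=> v _; rewrite /Y; under eq_bigr do rewrite -EFinM.
  rewrite sumEFin lee_fin -mulr_suml ler_piMl ?sqr_ge0//.
  under eq_bigr do rewrite indicE.
  apply: sum_exclusive => i j /set_mem ci /set_mem cj.
  apply: contrapT => /eqP ij; apply: cone_vshear_disjoint ci cj.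
  rewrite /tau; have Mt' : (6 < t *+ M)%R by rewrite (lt_le_trans Mt)// ler_wMn2r.
  wlog lij : i j ij / (i < j)%N.
    move=> H; case: (ltngtP i j) => [|ji|/val_inj/eqP]; first exact: H.
      by rewrite distrC; apply: H => //; rewrite eq_sym.
    by rewrite (negbTE ij).
  have -> : (t *+ (M * i.+1) - t *+ (M * j.+1) = - (t *+ M) *+ (j - i))%R.
    have -> : j.+1 = (i.+1 + (j - i))%N by rewrite addSn subnKC// ltnW.
    by rewrite mulnDr mulrnDr !mulrnA opprD addrA subrr add0r mulNrn.
  rewrite normrMn normrN (lt_le_trans Mt')//.
  rewrite ger0_norm; last by lra.
  by rewrite -[leLHS]mulr1n ler_wpMn2l ?subn_gt0//; lra.
set c := (2 * 4 ^+ (M * 8))%:E in each *.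
have c0 : 0 <= c * d by rewrite mule_ge0// lee_fin mulr_ge0// exprn_ge0.
have S0 : 0 <= S by apply: integral_ge0 => v _; rewrite lee_fin sqr_ge0.
have X0 : 0 <= X by apply: integral_ge0 => v _; exact: cone_sq_ge0.
have sum8 (x : \bar R) : \sum_(j < 8) x = 8%:E * x.
  by rewrite sumr_const card_ord mule_natl.
have : \sum_(j < 8) X <= \sum_(j < 8) (c * d + 2%:E * \int[@leb2 R]_v Y j v).
  by apply: lee_sum => j _; exact: each.
have -> : \sum_(j < 8) (c * d + 2%:E * \int[@leb2 R]_v Y j v) =
    8%:E * (c * d) + 2%:E * \sum_(j < 8) \int[@leb2 R]_v Y j v.
  by rewrite big_split/= sum8 ge0_sume_distrr// => j _; exact: integral_ge0.
rewrite sum8 => H.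
have {}H : 8%:E * X <= 8%:E * (c * d + (4^-1)%:E * S).
  have S40 : 0 <= (4^-1)%:E * S by rewrite mule_ge0// lee_fin.
  apply: (le_trans H); rewrite (@ge0_muleDr _ 8%:E (c * d) _ c0 S40).
  apply: leeD => //; rewrite muleA -EFinM (_ : 8 * 4^-1 = 2)%R; last by field.
  exact: lee_wpmul2l.
by rewrite lee_pmul2l in H.
Qed.

(** The cone and its image by the horizontal shear cover almost the whole plane,
while each holds at most a quarter of the mass up to an error. *)
Lemma ping_pong (t0 : R) : (0 < t0)%R ->
  exists2 K : R, (0 <= K)%R & forall xi (s t : R), measurable_fun setT xi ->
    (t0 <= s)%R -> (t0 <= t)%R -> plane_sqnorm xi < +oo ->
    plane_sqnorm xi <= K%:E * (plane_sqdist (xi \o vshear s) xi +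
      plane_sqdist ((xi \o @hshear R) \o vshear t) (xi \o @hshear R)).
Proof.
move=> t00; have [K K0 HK] := cone_mass t00.
exists (2 * K)%R; first exact: mulr_ge0.
move=> xi s t mxi ts tt xifin.
have mxiS : measurable_fun setT (xi \o @hshear R).
  exact: (measurableT_comp mxi (@measurable_hshear R)).
have h1 := HK xi s mxi ts; have h2 := HK _ t mxiS tt.
have SS : plane_sqnorm (xi \o @hshear R) = plane_sqnorm xi.
  have [_ pS] := preserving_hshear R.
  apply: (pS (fun v => (xi v ^+ 2)%:E)); first exact: measurable_sq.
  by move=> v; rewrite lee_fin sqr_ge0.
rewrite SS in h2.
pose unshear v : R * R := ((v.1 - v.2)%R, v.2).
have munshear : measurable_fun setT unshear.
  by apply: measurable_fun_pair => //; exact: measurable_funB.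
pose Z v := (\1_cone (unshear v))%:E * (xi v ^+ 2)%:E.
have mZ : measurable_fun setT Z.
  apply: emeasurable_funM; last exact: measurable_sq.
  apply/measurable_EFinP; apply: measurableT_comp => //.
  exact: measurable_indic measurable_cone.
have Z0 v : 0 <= Z v by exact: cone_sq_ge0.
have E2 : \int[@leb2 R]_v ((\1_cone v)%:E * (((xi \o @hshear R) v) ^+ 2)%:E) =
    \int[@leb2 R]_v Z v.
  have [_ pS] := preserving_hshear R.
  rewrite -(pS _ mZ Z0); apply: eq_integral => -[a b] _.
  by rewrite /Z /unshear /hshear/= addrK.
rewrite E2 in h2.
have cover : plane_sqnorm xi <=
    \int[@leb2 R]_v ((\1_cone v)%:E * (xi v ^+ 2)%:E) + \int[@leb2 R]_v Z v.
  rewrite -ge0_integralD//; last 2 first.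
  - by move=> v _; exact: cone_sq_ge0.
  - exact: measurable_cone_sq.
  apply: ae_ge0_le_integral => //.
  - by move=> v _; rewrite lee_fin sqr_ge0.
  - exact: measurable_sq.
  - by move=> v _; apply: adde_ge0; [exact: cone_sq_ge0|].
  - by apply: emeasurable_funD => //; exact: measurable_cone_sq.
  exists (setT `*` [set 0%R]); split.
  - exact: measurableX.
  - by rewrite [LHS]product_measure1E//= lebesgue_measure_set1 mule0.
  move=> [a b] /= /not_implyP[_ H]; split => //=; apply: contrapT => b0; apply: H.
  rewrite /Z -!EFinM -EFinD lee_fin -mulrDl -[leLHS]mul1r.
  apply: ler_wpM2r; first exact: sqr_ge0.
  rewrite !indicE; have [_|nc] := boolP ((a, b) \in cone).
    by rewrite lerDl.
  rewrite mem_set ?add0r//; split => /=.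
    apply/eqP => ab; move/negP: nc; apply; rewrite inE; split => /=.
      by rewrite (_ : a = b)//; [exact/eqP|lra].
    by rewrite (_ : a = b); [have := normr_ge0 b; lra|lra].
  rewrite leNgt; apply/negP => h; move/negP: nc; apply; rewrite inE.
  have nb : (0 < `|b|)%R by rewrite normr_gt0; exact/eqP.
  split => /=.
    by apply/eqP => a0; move: h; rewrite a0 sub0r normrN; lra.
  have : (`|b| <= `|a| + `|a - b|)%R.
    rewrite (_ : b = a - (a - b))%R; last by ring.
    by rewrite (le_trans (ler_normB _ _))// (_ : a - (a - (a - b)) = a - b)%R//; ring.
  lra.
have N0 : 0 <= plane_sqnorm xi by apply: integral_ge0 => v _; rewrite lee_fin sqr_ge0.
have Nfin : plane_sqnorm xi \is a fin_num by rewrite ge0_fin_numE.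
set d1 := plane_sqdist _ _ in h1 *; set d2 := plane_sqdist _ _ in h2 *.
have d10 : 0 <= d1 by exact: plane_sqdist_ge0.
have d20 : 0 <= d2 by exact: plane_sqdist_ge0.
have := le_trans cover (leeD h1 h2).
set N := plane_sqnorm xi in N0 Nfin *.
rewrite -(fineK Nfin) addeACA -ge0_muleDr// -EFinM -EFinD => H.
have {}H : (fine N)%:E - (2^-1 * fine N)%:E <= K%:E * (d1 + d2).
  rewrite leeBlDr//; apply: (le_trans H); apply: leeD => //; rewrite lee_fin; lra.
rewrite EFinM -muleA (_ : (fine N)%:E = 2%:E * ((fine N)%:E - (2^-1 * fine N)%:E)).
  exact: lee_wpmul2l.
by rewrite -EFinB -EFinM; congr EFin; field.
Qed.

End ping_pong.

(** * The transfer operator *)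

Section transfer.
Variable R : realType.
Local Open Scope ereal_scope.
Implicit Types (phi psi : phase R -> R) (y z : torus R).

Lemma double_bound (a b c : \bar R) (x y : R) :
  a <= 2%:E * (b + c) -> b <= x%:E -> c <= y%:E -> a <= (2 * (x + y))%:E.
Proof.
by move=> h hb hc; apply: (le_trans h); rewrite EFinM lee_wpmul2l// EFinD leeD.
Qed.

Lemma double_integral_bound d (T : measurableType d) (P : probability T R)
    (F : T -> \bar R) (M : T * T -> \bar R) (s : R) :
  measurable_fun setT F -> (forall x, 0 <= F x) -> \int[P]_x F x <= s%:E ->
  measurable_fun setT M -> (forall q, 0 <= M q) ->
  (forall q, M q <= 2%:E * (F q.1 + F q.2)) ->
  \int[P]_x \int[P]_y M (x, y) <= (4 * s)%:E.
Proof.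
move=> mF F0 FI mM M0 pt.
have mF2 c : measurable_fun setT (fun x => 2%:E * (F x + c)).
  by apply: emeasurable_funM => //; exact: emeasurable_funD.
have Fint (c : \bar R) : 0 <= c ->
    \int[P]_x (2%:E * (F x + c)) = 2%:E * (\int[P]_x F x + c).
  move=> c0; rewrite ge0_integralZl//; last 2 first.
  - exact: emeasurable_funD.
  - by move=> x _; exact: adde_ge0.
  by rewrite ge0_integralD// (probability_integral_cst P c).
have inner x : \int[P]_y M (x, y) <= 2%:E * (F x + s%:E).
  apply: (@le_trans _ _ (\int[P]_y (2%:E * (F y + F x)))).
    apply: ge0_le_integral => //; first exact: (measurable_fun_pair2 x mM).
    by move=> y _; rewrite [F y + _]addeC; exact: (pt (x, y)).
  by rewrite Fint// addeC lee_pmul2l// leeD.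
have s0 : 0 <= s%:E by apply: le_trans FI; exact: integral_ge0.
apply: (@le_trans _ _ (\int[P]_x (2%:E * (F x + s%:E)))).
  apply: ge0_le_integral => //.
  - by move=> x _; exact: integral_ge0.
  - exact: (measurable_fun_fubini_tonelli_F _ mM M0).
rewrite Fint// (_ : 4 * s = 2 * (s + s))%R; last by ring.
by rewrite EFinM lee_pmul2l// EFinD leeD.
Qed.

Definition phase_sqdist phi psi := sqdist (@mphase R) phi psi.

Lemma phase_sqdist_ge0 phi psi : 0 <= phase_sqdist phi psi.
Proof. exact: sqdist_ge0. Qed.

Lemma phase_sqdistC phi psi : phase_sqdist phi psi = phase_sqdist psi phi.
Proof. exact: sqdistC. Qed.

Lemma phase_sqdist_tri phi psi zeta : measurable_fun setT phi ->
  measurable_fun setT psi -> measurable_fun setT zeta ->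
  phase_sqdist phi zeta <= 2%:E * (phase_sqdist phi psi + phase_sqdist psi zeta).
Proof.
by move=> m1 m2 m3; exact: (@sqdist_tri _ _ R (@mphase R) phi psi zeta m1 m2 m3).
Qed.

Lemma phase_sqdist_bound phi psi zeta (x y : R) : measurable_fun setT phi ->
  measurable_fun setT psi -> measurable_fun setT zeta ->
  phase_sqdist phi psi <= x%:E -> phase_sqdist psi zeta <= y%:E ->
  phase_sqdist phi zeta <= (2 * (x + y))%:E.
Proof. by move=> m1 m2 m3; apply: double_bound; exact: phase_sqdist_tri. Qed.

Lemma plane_sqdist_bound (xi psi zeta : R * R -> R) (x y : R) :
  measurable_fun setT xi ->
  measurable_fun setT psi -> measurable_fun setT zeta ->
  plane_sqdist xi psi <= x%:E -> plane_sqdist psi zeta <= y%:E ->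
  plane_sqdist xi zeta <= (2 * (x + y))%:E.
Proof. by move=> m1 m2 m3; apply: double_bound; exact: plane_sqdist_tri. Qed.

Lemma phase_sqdist_shift z phi psi : measurable_fun setT phi ->
  measurable_fun setT psi ->
  phase_sqdist (phi \o shift_phase z) (psi \o shift_phase z) = phase_sqdist phi psi.
Proof.
move=> m1 m2.
exact: (@sqdist_preserving _ _ R (@mphase R) _ phi psi (preserving_shift_phase z) m1 m2).
Qed.

Lemma measurable_comp_shift z phi : measurable_fun setT phi ->
  measurable_fun setT (phi \o shift_phase z).
Proof. by move=> mphi; exact: (measurableT_comp mphi (measurable_shift_phase z)). Qed.

Definition fiber phi y (v : R * R) := phi (y, v).

Lemma measurable_fiber phi y : measurable_fun setT phi ->
  measurable_fun setT (fiber phi y).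
Proof. by move=> mphi; exact: (measurable_fun_pair2 y mphi). Qed.

Lemma measurable_snd_phase (xi : R * R -> R) : measurable_fun setT xi ->
  measurable_fun setT (fun p : phase R => xi p.2).
Proof. by move=> mxi; exact: (measurableT_comp mxi measurable_snd). Qed.

Lemma measurable_phase_sq phi psi : measurable_fun setT phi -> measurable_fun setT psi ->
  measurable_fun setT (fun p => ((phi p - psi p) ^+ 2)%:E).
Proof. exact: measurable_sqB. Qed.

Lemma phase_sqdistE phi psi : measurable_fun setT phi -> measurable_fun setT psi ->
  phase_sqdist phi psi =
  \int[@haar2 R]_y plane_sqdist (fiber phi y) (fiber psi y).
Proof.
move=> m1 m2; apply: (mphase_integral (measurable_phase_sq m1 m2)) => p.
by rewrite lee_fin sqr_ge0.
Qed.

Lemma measurable_plane_sqdist d (T : measurableType d) (f g : T * (R * R) -> R) :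
  measurable_fun setT f -> measurable_fun setT g ->
  measurable_fun setT (fun x => plane_sqdist (fun v => f (x, v)) (fun v => g (x, v))).
Proof.
move=> mf mg.
apply: (@measurable_fun_fubini_tonelli_F _ _ _ _ _ (@leb2 R)
  (fun q : T * (R * R) => ((f q - g q) ^+ 2)%:E)).
  exact: measurable_sqB.
by move=> q; rewrite lee_fin sqr_ge0.
Qed.

(** The average over y of the distance from phi to its fiber at y is the average
over z of the distance from phi to its translate by z, by the substitution
(y, z) |-> (y, y + z). Some y does at least as well as the average. *)
Lemma close_to_fiber phi (s : R) : measurable_fun setT phi ->
  (forall z, phase_sqdist (phi \o shift_phase z) phi <= s%:E) ->
  exists y, phase_sqdist phi (fun p => fiber phi y p.2) <= s%:E.
Proof.
move=> mphi H.
pose K (q : torus R * torus R) := plane_sqdist (fiber phi q.2) (fiber phi q.1).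
have mK : measurable_fun setT K.
  apply: (@measurable_plane_sqdist _ _ (fun r : (torus R * torus R) * (R * R) =>
    phi (r.1.2, r.2)) (fun r => phi (r.1.1, r.2))).
    apply: (measurableT_comp mphi); apply: measurable_fun_pair => //.
    exact: measurableT_comp.
  apply: (measurableT_comp mphi); apply: measurable_fun_pair => //.
  exact: measurableT_comp.
have K0 q : 0 <= K q by exact: plane_sqdist_ge0.
have mKs : measurable_fun setT (fun q : torus R * torus R => K (q.2, q.2 + q.1)%R).
  apply: (measurableT_comp mK); apply: measurable_fun_pair => //.
  exact: measurable_torusD.
have DE z : phase_sqdist (phi \o shift_phase z) phi = \int[@haar2 R]_y K (y, (y + z)%R).
  rewrite phase_sqdistE//; exact: measurable_comp_shift.
have total : \int[@haar2 R]_z \int[@haar2 R]_y K (y, (y + z)%R) <= s%:E.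
  rewrite -[leRHS](probability_integral_cst (@haar2 R)).
  apply: ge0_le_integral => //.
  - by move=> z _; apply: integral_ge0.
  - exact: (measurable_haar2_integral mKs (fun q => K0 _)).
  - by move=> z _; rewrite -DE.
have swapped : \int[@haar2 R]_y \int[@haar2 R]_z K (y, z) <= s%:E.
  apply: le_trans total; apply: eq_lee; apply: esym.
  apply: (etrans (haar22_swap mKs (fun q => K0 _))) => /=.
  apply: eq_integral => y _.
  have mKy : measurable_fun setT (fun z => K (y, z)) by exact: measurable_fun_pair2.
  rewrite -[RHS](@haar2_integral_shift _ y _ mKy (fun z => K0 _)).
  by apply: eq_integral => z _; rewrite addrC.
have [||||y _] := @le_average _ _ R (@haar2 R) setT
    (fun y => \int[@haar2 R]_z K (y, z)) _ measurableT.
- by rewrite [ltLHS](probability_setT (@haar2 R)) ltry.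
- by rewrite [ltRHS](probability_setT (@haar2 R)) lte01.
- exact: measurable_haar2_integral.
- by move=> y; exact: integral_ge0.
rewrite [X in _ * X](probability_setT (@haar2 R)) mule1 => /le_trans/(_ swapped) h.
exists y; apply: le_trans h; apply: eq_lee; rewrite phase_sqdistE//.
exact: (measurable_snd_phase (measurable_fiber y mphi)).
Qed.

Section operator.
Variables (V W : circle R -> R) (nu : probability (torus R) R).
Hypotheses (mV : measurable_fun setT V) (mW : measurable_fun setT W).

(** The expectation of phi one step later, the noise coming after the skew
product. *)
Definition transfer phi : phase R -> R := noise_mean nu phi \o skew_product V W.

Lemma measurable_comp_skew phi : measurable_fun setT phi ->
  measurable_fun setT (phi \o skew_product V W).
Proof. by move=> mphi; exact: (measurableT_comp mphi (measurable_skew_product mV mW)). Qed.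

Lemma phase_sqdist_skew phi psi : measurable_fun setT phi ->
  measurable_fun setT psi ->
  phase_sqdist (phi \o skew_product V W) (psi \o skew_product V W) = phase_sqdist phi psi.
Proof.
move=> m1 m2.
exact: (@sqdist_preserving _ _ R (@mphase R) _ phi psi (preserving_skew_product mV mW) m1 m2).
Qed.

Lemma unit_valued_transfer phi : unit_valued phi -> unit_valued (transfer phi).
Proof.
move=> /(unit_valued_noise_mean nu)[mm m01]; split; last by move=> p; exact: m01.
exact: measurable_comp_skew.
Qed.

(** The skew product is an isometry, so all the loss comes from the noise. *)
Lemma sqnorm_transfer phi : unit_valued phi ->
  sqnorm phi = sqnorm (transfer phi) + dissipation nu phi.
Proof.
move=> phiu; have [mm m01] := unit_valued_noise_mean nu phiu.
have [_ pS] := preserving_skew_product mV mW.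
have -> : sqnorm (transfer phi) = sqnorm (noise_mean nu phi).
  by apply: (pS _ (measurable_sq mm)) => p; rewrite lee_fin sqr_ge0.
exact: sqnorm_noise_mean.
Qed.

(** When little norm is lost, a single realization of the noise already represents
the average. *)
Lemma noise_mean_sample phi (s : R) : unit_valued phi ->
  dissipation nu phi <= s%:E ->
  exists x, phase_sqdist (transfer phi) (phi \o shift_phase x \o skew_product V W) <= s%:E.
Proof.
move=> phiu phis; have [mphi _] := phiu.
have [mm _] := unit_valued_noise_mean nu phiu.
have mF : measurable_fun setT (fun x =>
    phase_sqdist (phi \o shift_phase x) (noise_mean nu phi)).
  apply: (measurable_sqdist_shift mphi).
  exact: (measurableT_comp mm measurable_snd).
have [||||x _] := @le_average _ _ R nu setT
    (fun x => phase_sqdist (phi \o shift_phase x) (noise_mean nu phi)) _ measurableT.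
- by rewrite [ltLHS](probability_setT nu) ltry.
- by rewrite [ltRHS](probability_setT nu) lte01.
- exact: mF.
- by move=> x; exact: phase_sqdist_ge0.
rewrite [X in _ * X](probability_setT nu) mule1 => /le_trans/(_ phis) h.
exists x; rewrite phase_sqdistC.
apply: le_trans h; apply: eq_lee; apply: phase_sqdist_skew => //.
exact: measurable_comp_shift.
Qed.

Definition modulus phi z := phase_sqdist (phi \o shift_phase z) phi.

Lemma modulus_sub phi y z : measurable_fun setT phi ->
  modulus phi (y - z)%R =
  phase_sqdist (phi \o shift_phase y) (phi \o shift_phase z).
Proof.
move=> mphi.
rewrite /modulus -(phase_sqdist_shift z (measurable_comp_shift _ mphi) mphi).
by congr phase_sqdist; apply/funext => p /=; rewrite shift_phaseD addrC subrK.
Qed.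

Lemma shift_phase0 (p : phase R) : shift_phase 0%R p = p.
Proof. by case: p => y v; rewrite /shift_phase/= addr0. Qed.

Lemma quasi_modulus_modulus phi : measurable_fun setT phi ->
  quasi_modulus (modulus phi).
Proof.
move=> mphi; have E0 : phi \o shift_phase 0%R = phi.
  by apply/funext => p /=; rewrite shift_phase0.
split=> [z|z|y z]; first exact: phase_sqdist_ge0.
  by rewrite -[(- z)%R]sub0r modulus_sub// E0 phase_sqdistC.
rewrite -{1}[z]opprK modulus_sub//.
apply: (le_trans (phase_sqdist_tri (measurable_comp_shift y mphi) mphi
  (measurable_comp_shift (- z)%R mphi))).
rewrite lee_pmul2l//; apply: leeD => //.
by rewrite -{1}E0 -modulus_sub// sub0r opprK.
Qed.

Lemma measurable_modulus phi : measurable_fun setT phi ->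
  measurable_fun setT (modulus phi).
Proof.
move=> mphi; apply: (@measurable_sqdist_shift _ phi (fun _ => phi) mphi).
exact: (measurableT_comp mphi measurable_snd).
Qed.

(** Two translates of phi are both close to the average over the noise, hence to
each other. *)
Lemma modulus_noise phi (s : R) : unit_valued phi -> dissipation nu phi <= s%:E ->
  \int[nu]_x \int[nu]_y modulus phi (x - y)%R <= (4 * s)%:E.
Proof.
move=> phiu phis; have [mphi _] := phiu.
have [mm _] := unit_valued_noise_mean nu phiu.
pose F x := phase_sqdist (phi \o shift_phase x) (noise_mean nu phi).
have mF : measurable_fun setT F.
  apply: (measurable_sqdist_shift mphi).
  exact: (measurableT_comp mm measurable_snd).
have F0 x : 0 <= F x by exact: phase_sqdist_ge0.
have FI : \int[nu]_x F x <= s%:E by [].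
have mM : measurable_fun setT (fun q : torus R * torus R => modulus phi (q.1 - q.2)%R).
  by apply: (measurableT_comp (measurable_modulus mphi)); exact: measurable_torus_sub.
have M0 z : 0 <= modulus phi z by exact: phase_sqdist_ge0.
have pt x y : modulus phi (x - y)%R <= 2%:E * (F x + F y).
  have -> : F y = phase_sqdist (noise_mean nu phi) (phi \o shift_phase y).
    exact: phase_sqdistC.
  rewrite modulus_sub//.
  exact: (phase_sqdist_tri (measurable_comp_shift x mphi) mm
    (measurable_comp_shift y mphi)).
exact: (double_integral_bound mF F0 FI mM (fun q => M0 _) (fun q => pt q.1 q.2)).
Qed.

End operator.

End transfer.

(** * Strict contraction of the fourth power *)

Section contraction.
Variable R : realType.
Local Open Scope ereal_scope.
Variables (V W : circle R -> R) (nu : probability (torus R) R).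
Hypotheses (mV : measurable_fun setT V) (mW : measurable_fun setT W).
Variable C : R.
Hypothesis C0 : (0 <= C)%R.
Hypothesis gap : forall D : torus R -> \bar R,
  quasi_modulus D -> measurable_fun setT D ->
  forall t : circle R, D (0%R : circle R, t) <=
    C%:E * \int[nu]_x \int[nu]_y D (x - y)%R.
Implicit Types (phi : phase R -> R) (s : R).

Local Notation T := (transfer V W nu).
Local Notation vert t := ((0%R : circle R, t) : torus R).

Lemma modulus_vertical phi s t : unit_valued phi -> dissipation nu phi <= s%:E ->
  modulus phi (vert t) <= (C * (4 * s))%:E.
Proof.
move=> phiu phis; have [mphi _] := phiu.
apply: (le_trans (gap (quasi_modulus_modulus mphi) (measurable_modulus mphi) t)).
rewrite EFinM; apply: lee_wpmul2l => //.
exact: modulus_noise.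
Qed.

(** The second coordinate enters the standard map only as a term added to both
coordinates, and does not enter the tangent map. *)
Lemma skew_product_vertical t p :
  skew_product V W (shift_phase (vert t) p) = shift_phase (t, t) (skew_product V W p).
Proof.
case: p => [[y1 y2] v]; rewrite /skew_product /shift_phase /gen_standard_map /=.
congr (_, _); last by rewrite addr0.
apply/pair_equal_spec; split => /=; rewrite addr0.
  by rewrite -!addrA; congr (_ + _)%R; rewrite addrCA addrC -addrA.
by rewrite addrAC.
Qed.

Definition diagonal_constant : R := (2 * (2 * (1 + C * 4) + 1))%R.
Definition modulus_constant : R := (2 * (diagonal_constant + C * 4))%R.

(** T phi is close to the composition G of phi with the skew product and a
translation. Its near-invariance under vertical translations passes to G, and
[skew_product_vertical] converts it into near-invariance of phi under diagonal
translations. *)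
Lemma modulus_diagonal phi s t : unit_valued phi ->
  dissipation nu phi <= s%:E -> dissipation nu (T phi) <= s%:E ->
  modulus phi (t, t) <= (diagonal_constant * s)%:E.
Proof.
move=> phiu phis Tphis; have [mphi _] := phiu.
have Tu := unit_valued_transfer nu mV mW phiu; have [mT _] := Tu.
have [x hx] := noise_mean_sample mV mW phiu phis.
set G := _ \o _ in hx.
have mG : measurable_fun setT G.
  exact: (measurable_comp_skew mV mW (measurable_comp_shift x mphi)).
have -> : modulus phi (t, t) = phase_sqdist (G \o shift_phase (vert t)) G.
  rewrite /modulus -(phase_sqdist_shift x (measurable_comp_shift _ mphi) mphi).
  rewrite -(phase_sqdist_skew mV mW); last 2 first.
  - do 2 apply: measurable_comp_shift => //.
  - exact: measurable_comp_shift.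
  congr phase_sqdist; apply/funext => p.
  by rewrite /G /= skew_product_vertical !shift_phaseD addrC.
have b1 : phase_sqdist (G \o shift_phase (vert t)) (T phi \o shift_phase (vert t)) <= s%:E.
  by rewrite phase_sqdist_shift// phase_sqdistC.
have b2 := modulus_vertical t Tu Tphis.
have mGs := measurable_comp_shift (vert t) mG.
have mTs := measurable_comp_shift (vert t) mT.
have b3 := phase_sqdist_bound mGs mTs mT b1 b2.
have := phase_sqdist_bound mGs mT mG b3 hx.
by congr (_ <= _); congr EFin; rewrite /diagonal_constant; ring.
Qed.

(** Vertical and diagonal translations generate the torus. *)
Lemma modulus_le phi s z : unit_valued phi ->
  dissipation nu phi <= s%:E -> dissipation nu (T phi) <= s%:E ->
  modulus phi z <= (modulus_constant * s)%:E.
Proof.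
move=> phiu phis Tphis; case: z => a b; have [mphi _] := phiu.
have -> : (a, b) = ((a, a) + vert (b - a))%R :> torus R.
  by apply/pair_equal_spec; split => /=; rewrite ?addr0// addrC subrK.
have [_ _ DD] := quasi_modulus_modulus mphi.
have := double_bound (DD (a, a) (vert (b - a)%R)) (modulus_diagonal a phiu phis Tphis)
  (modulus_vertical (b - a)%R phiu phis).
by congr (_ <= _); congr EFin; rewrite /modulus_constant; ring.
Qed.

Lemma close_fiber phi s : unit_valued phi ->
  dissipation nu phi <= s%:E -> dissipation nu (T phi) <= s%:E ->
  exists2 xi : R * R -> R, measurable_fun setT xi &
    phase_sqdist phi (fun p => xi p.2) <= (modulus_constant * s)%:E.
Proof.
move=> phiu phis Tphis; have [mphi _] := phiu.
have [y hy] := close_to_fiber mphi (fun z => modulus_le z phiu phis Tphis).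
by exists (fiber phi y) => //; exact: measurable_fiber.
Qed.

Definition link_constant : R := (2 * (modulus_constant + 2 * (1 + modulus_constant)))%R.

(** T phi is close to xi_1 and to the composition of phi, that is of xi_0, with the
skew product. The distance between these two depends on y only through the slope
W at its first coordinate. *)
Lemma fiber_link phi s (xi0 xi1 : R * R -> R) : unit_valued phi ->
  dissipation nu phi <= s%:E ->
  measurable_fun setT xi0 -> measurable_fun setT xi1 ->
  phase_sqdist phi (fun p => xi0 p.2) <= (modulus_constant * s)%:E ->
  phase_sqdist (T phi) (fun p => xi1 p.2) <= (modulus_constant * s)%:E ->
  \int[@haar1 R]_a plane_sqdist xi1 (xi0 \o tangent_step (W a)) <= (link_constant * s)%:E.
Proof.
move=> phiu phis m0 m1 h0 h1; have [mphi _] := phiu.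
have Tu := unit_valued_transfer nu mV mW phiu; have [mT _] := Tu.
have [x hx] := noise_mean_sample mV mW phiu phis.
have m0s := measurable_snd_phase m0; have m1s := measurable_snd_phase m1.
have mG := measurable_comp_skew mV mW (measurable_comp_shift x mphi).
have m0k := measurable_comp_skew mV mW m0s.
have b0 : phase_sqdist (phi \o shift_phase x \o skew_product V W)
    ((fun p => xi0 p.2) \o skew_product V W) <= (modulus_constant * s)%:E.
  rewrite phase_sqdist_skew//; last exact: measurable_comp_shift.
  by apply: le_trans h0; apply: eq_lee; exact: (phase_sqdist_shift x mphi m0s).
rewrite phase_sqdistC in h1.
have b1 := phase_sqdist_bound mT mG m0k hx b0.
have b2 := phase_sqdist_bound m1s mT m0k h1 b1.
have mh : measurable_fun setT (fun a => plane_sqdist xi1 (xi0 \o tangent_step (W a))).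
  apply: (@measurable_plane_sqdist _ _ _ (fun q : circle R * (R * R) => xi1 q.2)
    (fun q => xi0 (tangent_step (W q.1) q.2))).
    exact: (measurableT_comp m1 measurable_snd).
  apply: (measurableT_comp m0); apply: measurable_tangent_step2 => //.
  exact: measurableT_comp.
rewrite -(haar2_integral_fst mh); last by move=> a; exact: plane_sqdist_ge0.
apply: (@le_trans _ _ (phase_sqdist (fun p => xi1 p.2) ((fun p => xi0 p.2) \o skew_product V W))).
  by apply: eq_lee; rewrite phase_sqdistE.
by apply: (le_trans b2); rewrite lee_fin /link_constant le_eqVlt; apply/orP; left; apply/eqP; ring.
Qed.

Lemma pick_point (G : set (circle R)) (h : circle R -> \bar R) (x : R) :
  measurable G -> 0 < @haar1 R G -> measurable_fun setT h -> (forall a, 0 <= h a) ->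
  \int[@haar1 R]_a h a <= x%:E ->
  exists2 a, G a & h a <= (x / fine (@haar1 R G))%:E.
Proof.
move=> mG G0 mh h0 hx.
have Gfin : @haar1 R G \is a fin_num by exact: fin_num_measure.
have Gpos : (0 < fine (@haar1 R G))%R by rewrite fine_gt0// G0 ltey_eq Gfin.
have [|a Ga ha] := @le_average _ _ R (@haar1 R) G h _ mG G0 mh h0.
  by rewrite [ltLHS](probability_setT (@haar1 R)) ltry.
exists a => //; rewrite EFinM lee_pdivlMr// (fineK Gfin).
exact: le_trans ha hx.
Qed.

Variables alpha beta : R.
Hypothesis beta_alpha : (beta < alpha)%R.
Let upper := [set a | (alpha < W a)%R].
Let lower := [set b | (W b < beta)%R].
Hypotheses (upper_gt0 : 0 < @haar1 R upper) (lower_gt0 : 0 < @haar1 R lower).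

Let measurable_upper : measurable upper.
Proof.
rewrite -[upper]setTI (_ : upper = W @^-1` `]alpha, +oo[); first exact: mW.
by apply/seteqP; split => x /=; rewrite in_itv/= andbT.
Qed.

Let measurable_lower : measurable lower.
Proof.
rewrite -[lower]setTI (_ : lower = W @^-1` `]-oo, beta[); first exact: mW.
by apply/seteqP; split => x /=; rewrite in_itv/=.
Qed.

Definition pick_constant : R :=
  ((fine (@haar1 R upper))^-1 + (fine (@haar1 R lower))^-1)%R.

(** A bound on average over the circle holds, up to a constant, somewhere in each
of the two sets of positive measure. *)
Lemma pick_slopes (xi0 xi1 : R * R -> R) (x : R) :
  measurable_fun setT xi0 -> measurable_fun setT xi1 -> (0 <= x)%R ->
  \int[@haar1 R]_a plane_sqdist xi1 (xi0 \o tangent_step (W a)) <= x%:E ->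
  exists a b, [/\ (alpha - beta <= a - b)%R,
    plane_sqdist xi1 (xi0 \o tangent_step a) <= (pick_constant * x)%:E &
    plane_sqdist xi1 (xi0 \o tangent_step b) <= (pick_constant * x)%:E].
Proof.
move=> m0 m1 x0 hx.
have mh : measurable_fun setT (fun a => plane_sqdist xi1 (xi0 \o tangent_step (W a))).
  apply: (@measurable_plane_sqdist _ _ _ (fun q : circle R * (R * R) => xi1 q.2)
    (fun q => xi0 (tangent_step (W q.1) q.2))).
    exact: (measurableT_comp m1 measurable_snd).
  apply: (measurableT_comp m0); apply: measurable_tangent_step2 => //.
  exact: measurableT_comp.
have h0 a : 0 <= plane_sqdist xi1 (xi0 \o tangent_step (W a)).
  exact: plane_sqdist_ge0.
have [a Ga ha] := pick_point measurable_upper upper_gt0 mh h0 hx.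
have [b Gb hb] := pick_point measurable_lower lower_gt0 mh h0 hx.
have f1 : (0 <= (fine (@haar1 R upper))^-1)%R by rewrite invr_ge0 fine_ge0.
have f2 : (0 <= (fine (@haar1 R lower))^-1)%R by rewrite invr_ge0 fine_ge0.
exists (W a), (W b); split.
- by apply: lerB; [exact: ltW Ga|exact: ltW Gb].
- by apply: (le_trans ha); rewrite lee_fin mulrC ler_wpM2r// /pick_constant lerDl.
- by apply: (le_trans hb); rewrite lee_fin mulrC ler_wpM2r// /pick_constant lerDr.
Qed.

Lemma measurable_comp_vshear (xi : R * R -> R) t : measurable_fun setT xi ->
  measurable_fun setT (xi \o vshear t).
Proof. by move=> mxi; exact: (measurableT_comp mxi (measurable_vshear t)). Qed.

Lemma measurable_comp_hshear (xi : R * R -> R) : measurable_fun setT xi ->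
  measurable_fun setT (xi \o @hshear R).
Proof. by move=> mxi; exact: (measurableT_comp mxi (@measurable_hshear R)). Qed.

(** Both compositions of xi_0 are close to xi_1, and the two tangent maps differ by
a vertical shear applied first. Hence the composition of xi_0 with the horizontal
shear is nearly invariant under this shear, and so is xi_1, which is close to it
up to a further shear. *)
Lemma shear_from_slopes (xi0 xi1 : R * R -> R) (a b x : R) :
  measurable_fun setT xi0 -> measurable_fun setT xi1 ->
  plane_sqdist xi1 (xi0 \o tangent_step a) <= x%:E ->
  plane_sqdist xi1 (xi0 \o tangent_step b) <= x%:E ->
  plane_sqdist (xi1 \o vshear (a - b)) xi1 <= (2 * (x + x))%:E /\
  plane_sqdist ((xi0 \o @hshear R) \o vshear (a - b)) (xi0 \o @hshear R) <=
    (2 * (x + x))%:E.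
Proof.
move=> m0 m1 ha hb; set zeta := xi0 \o @hshear R.
have mz : measurable_fun setT zeta by exact: measurable_comp_hshear.
have stepE c : xi0 \o tangent_step c = zeta \o vshear c by [].
rewrite !stepE in ha hb.
have mzv c : measurable_fun setT (zeta \o vshear c) by exact: measurable_comp_vshear.
have m1v c : measurable_fun setT (xi1 \o vshear c) by exact: measurable_comp_vshear.
have shearE (xi : R * R -> R) c e : (xi \o vshear c) \o vshear e = xi \o vshear (e + c)%R.
  by apply/funext => v /=; rewrite vshearD.
split.
  have h1 : plane_sqdist (xi1 \o vshear (a - b)) (zeta \o vshear a) <= x%:E.
    rewrite (_ : zeta \o vshear a = (zeta \o vshear b) \o vshear (a - b)).
      by rewrite plane_sqdist_vshear.
    by rewrite shearE subrK.
  rewrite plane_sqdistC in ha.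
  exact: (plane_sqdist_bound (m1v _) (mzv a) m1 h1 ha).
have h := ha; rewrite plane_sqdistC in h.
have := plane_sqdist_bound (mzv a) m1 (mzv b) h hb.
rewrite -(plane_sqdist_vshear (- b)) // !shearE addNr addrC.
by rewrite (_ : zeta \o vshear 0 = zeta)//; apply/funext => -[u v];
  rewrite /= /vshear/= mul0r addr0.
Qed.

(** Small losses at four consecutive times provide fibers xi_0, xi_1, xi_2; the
pair (xi_0, xi_1) gives the invariance of xi_1 itself, and the pair (xi_1, xi_2)
that of its composition with the horizontal shear. This is what [ping_pong]
needs to bound xi_1, hence T phi. *)
Lemma transfer_smallness : exists2 c : R, (0 <= c)%R &
  forall phi s, unit_valued phi -> (0 <= s)%R -> sqnorm (T phi) < +oo ->
    dissipation nu phi <= s%:E -> dissipation nu (T phi) <= s%:E ->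
    dissipation nu (T (T phi)) <= s%:E -> dissipation nu (T (T (T phi))) <= s%:E ->
    sqnorm (T phi) <= (c * s)%:E.
Proof.
have t00 : (0 < alpha - beta)%R by rewrite subr_gt0.
have [K K0 HK] := ping_pong t00.
have pc0 : (0 <= pick_constant)%R by rewrite addr_ge0// invr_ge0 fine_ge0.
have C40 : (0 <= C * 4)%R by rewrite mulr_ge0.
have mc0 : (0 <= modulus_constant)%R by rewrite !(mulr_ge0, addr_ge0).
have lc0 : (0 <= link_constant)%R by rewrite !(mulr_ge0, addr_ge0).
exists (2 * (modulus_constant + K * (8 * (pick_constant * link_constant))))%R.
  by rewrite mulr_ge0// addr_ge0// mulr_ge0// mulr_ge0// mulr_ge0.
move=> phi s phiu s0 Nfin e0 e1 e2 e3.
have Tu := unit_valued_transfer nu mV mW phiu; have [mT _] := Tu.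
have TTu := unit_valued_transfer nu mV mW Tu.
have [xi0 m0 h0] := close_fiber phiu e0 e1.
have [xi1 m1 h1] := close_fiber Tu e1 e2.
have [xi2 m2 h2] := close_fiber TTu e2 e3.
have ls0 : (0 <= link_constant * s)%R by rewrite mulr_ge0.
have [a [b [ab ha hb]]] := pick_slopes m0 m1 ls0 (fiber_link phiu e0 m0 m1 h0 h1).
have [a' [b' [ab' ha' hb']]] := pick_slopes m1 m2 ls0 (fiber_link Tu e1 m1 m2 h1 h2).
have [B1 _] := shear_from_slopes m0 m1 ha hb.
have [_ B2] := shear_from_slopes m1 m2 ha' hb'.
have m1s := measurable_snd_phase m1.
have mzero : measurable_fun setT (fun _ : phase R => 0 : R)%R by exact: measurable_cst.
have normE : plane_sqnorm xi1 = phase_sqdist (fun p => xi1 p.2) (fun _ => 0%R).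
  rewrite phase_sqdistE// -[LHS](probability_integral_cst (@haar2 R)).
  apply: eq_integral => y _; apply: eq_integral => v _.
  by rewrite /fiber /= subr0.
have sqnormE (f : phase R -> R) : sqnorm f = phase_sqdist f (fun _ => 0%R).
  by apply: eq_integral => p _; rewrite subr0.
have xifin : plane_sqnorm xi1 < +oo.
  rewrite normE; apply: (le_lt_trans (phase_sqdist_tri m1s mT mzero)).
  rewrite phase_sqdistC -sqnormE lte_mul_pinfty// lte_add_pinfty//.
  by rewrite (le_lt_trans h1)// ltry.
have H := HK xi1 _ _ m1 ab ab' xifin.
set x := (2 * (_ + _))%R in B1 B2.
have Nxi : plane_sqnorm xi1 <= (K * (x + x))%:E.
  apply: (le_trans H); rewrite EFinM EFinD; apply: lee_wpmul2l => //.
  exact: leeD.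
rewrite normE in Nxi.
rewrite sqnormE; apply: (le_trans (phase_sqdist_bound mT m1s mzero h1 Nxi)).
by rewrite lee_fin le_eqVlt; apply/orP; left; apply/eqP; rewrite /x; ring.
Qed.

(** The numerical part: n_i is the norm after i steps and d_i the loss at step i.
The total loss d is n_0 - n_4, and n_4 <= n_1 <= c d. *)
Lemma contraction_of_smallness (n0 n1 n2 n3 n4 d0 d1 d2 d3 : \bar R) (c : R) :
  (0 <= c)%R -> n0 < +oo ->
  0 <= d0 -> 0 <= d1 -> 0 <= d2 -> 0 <= d3 ->
  0 <= n0 -> 0 <= n1 -> 0 <= n2 -> 0 <= n3 -> 0 <= n4 ->
  n0 = n1 + d0 -> n1 = n2 + d1 -> n2 = n3 + d2 -> n3 = n4 + d3 ->
  (forall s : R, (0 <= s)%R -> n1 < +oo -> d0 <= s%:E -> d1 <= s%:E ->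
    d2 <= s%:E -> d3 <= s%:E -> n1 <= (c * s)%:E) ->
  n4 <= (c / (1 + c))%:E * n0.
Proof.
move=> c0 n0fin.
case: n0 n0fin => [n0||]// _; case: n1 => [n1||]//; case: n2 => [n2||]//;
  case: n3 => [n3||]//; case: n4 => [n4||]//; case: d0 => [d0||]//;
  case: d1 => [d1||]//; case: d2 => [d2||]//; case: d3 => [d3||]//.
rewrite !lee_fin => p0 p1 p2 p3 q0 q1 q2 q3 q4 [E0] [E1] [E2] [E3] H.
have {}H : (n1 <= c * (d0 + d1 + d2 + d3))%R.
  by rewrite -lee_fin; apply: H; rewrite ?ltry ?lee_fin//; lra.
rewrite mulrAC ler_pdivlMr; last lra.
have : (c * (d0 + d1 + d2 + d3) = c * n0 - c * n4)%R.
  by rewrite -mulrBr; congr (_ * _)%R; lra.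
move=> E; rewrite (_ : n4 * (1 + c) = n4 + c * n4)%R; last by ring.
by lra.
Qed.

Lemma transfer_contraction : exists2 r : R, (0 <= r < 1)%R &
  forall phi, unit_valued phi -> sqnorm phi < +oo ->
    sqnorm (T (T (T (T phi)))) <= r%:E * sqnorm phi.
Proof.
have [c c0 Hc] := transfer_smallness.
exists (c / (1 + c))%R.
  apply/andP; split; first by rewrite divr_ge0//; lra.
  by rewrite ltr_pdivrMr; lra.
move=> phi phiu Nfin.
have u1 := unit_valued_transfer nu mV mW phiu.
have u2 := unit_valued_transfer nu mV mW u1.
have u3 := unit_valued_transfer nu mV mW u2.
have sq0 (f : phase R -> R) : 0 <= sqnorm f.
  by apply: integral_ge0 => p _; rewrite lee_fin sqr_ge0.
have ds0 (f : phase R -> R) : 0 <= dissipation nu f.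
  by apply: integral_ge0 => x _; exact: sqdist_ge0.
exact: (contraction_of_smallness c0 Nfin (ds0 _) (ds0 _) (ds0 _) (ds0 _)
  (sq0 _) (sq0 _) (sq0 _) (sq0 _) (sq0 _)
  (sqnorm_transfer nu mV mW phiu) (sqnorm_transfer nu mV mW u1)
  (sqnorm_transfer nu mV mW u2) (sqnorm_transfer nu mV mW u3)
  (fun s => Hc phi s phiu)).
Qed.

End contraction.

(** * Iterates of the operator and random orbits *)

Section sequences.
Context d (T : measurableType d) (R : realType).
Local Open Scope ereal_scope.

Lemma measurable_coordinate n :
  measurable_fun setT (fun w : seq_space T => (w : nat -> T) n).
Proof.
move=> _ A mA; rewrite setTI; apply: sub_gen_smallest.
by exists n, A.
Qed.

Lemma measurable_to_seq_space d' (S : measurableType d') (f : S -> seq_space T) :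
  (forall n, measurable_fun setT (fun s => (f s : nat -> T) n)) ->
  measurable_fun setT f.
Proof.
move=> mf; apply: (@measurability _ _ S (seq_space T) setT f (@cylinders _ T)) => //.
move=> _ [C [n [A [mA ->]]] <-].
exact: (mf n).
Qed.

Definition seq_cons (x : T) (w : seq_space T) : seq_space T :=
  fun n => if n is k.+1 then w k else x.

Lemma measurable_seq_cons :
  measurable_fun setT (fun q : T * seq_space T => seq_cons q.1 q.2).
Proof.
apply: measurable_to_seq_space => -[|n] /=; first exact: measurable_fst.
exact: (measurableT_comp (measurable_coordinate n) measurable_snd).
Qed.

Definition rectangles : set (set (seq_space T)) :=
  [set C | exists n (A : nat -> set T), (forall i, measurable (A i)) /\
    C = [set w : seq_space T | forall i, (i < n)%N -> A i (w i)]].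

Lemma measurable_rectangle n (A : nat -> set T) : (forall i, measurable (A i)) ->
  measurable [set w : seq_space T | forall i, (i < n)%N -> A i (w i)].
Proof.
move=> mA.
rewrite (_ : [set w | _] =
    \bigcap_(i < n) [set w : seq_space T | A i (w i)]); last first.
  by apply/seteqP; split.
apply: fin_bigcap_measurable => [|i _]; first exact: finite_II.
by apply: sub_gen_smallest; exists i, (A i).
Qed.

Lemma measurable_rectangles : @measurable _ (seq_space T) = <<s rectangles >>.
Proof.
apply/seteqP; split; apply: smallest_sub.
- exact: smallest_sigma_algebra.
- move=> _ [n [A [mA ->]]]; apply: sub_gen_smallest.
  exists n.+1, (fun i => if i == n then A else setT); split.
    by move=> i; case: ifP.
  apply/seteqP; split => w /=; last by move=> /(_ n (leqnn _)); rewrite eqxx.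
  by move=> Aw i _; case: eqP => // ->.
- exact: sigma_algebra_measurable.
- by move=> _ [n [A [mA ->]]]; exact: measurable_rectangle.
Qed.

Lemma setI_closed_rectangles : setI_closed rectangles.
Proof.
move=> _ _ [n [A [mA ->]]] [m [B [mB ->]]].
exists (maxn n m), (fun i => (if (i < n)%N then A i else setT) `&`
  (if (i < m)%N then B i else setT)); split.
  by move=> i; apply: measurableI; case: ifP.
apply/seteqP; split => w /=.
  by move=> [HA HB] i _; split; case: ifP => // h; [exact: HA|exact: HB].
move=> H; split => i h.
  by have := H i; rewrite leq_max h /= => /(_ isT) [].
by have := H i; rewrite leq_max h orbT /= => /(_ isT) [].
Qed.

Variables (nu : probability T R) (rho : probability (seq_space T) R).
Hypothesis rhoP : is_power_measure nu rho.

(** Finite rectangles are closed under intersection and generate the product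
sigma-algebra, so that they determine the measure. *)
Lemma power_measure_cons (A : set (seq_space T)) : measurable A ->
  rho A = pushforward (nu \x rho) (fun q : T * seq_space T => seq_cons q.1 q.2) A.
Proof.
move=> mA.
apply: (@measure_unique _ _ _ rectangles (fun=> setT) measurable_rectangles
  setI_closed_rectangles _ _ rho
  (pushforward (nu \x rho) (fun q : T * seq_space T => seq_cons q.1 q.2))) => //.
- by move=> i; exists 0%N, (fun=> setT); split => //; apply/seteqP; split.
- by apply/seteqP; split => // w _; exists 0%N.
- exact: measurable_seq_cons.
- move=> mcons _ [n [B [mB ->]]]; rewrite [LHS]rhoP//=.
  case: n => [|n].
    rewrite big_ord0 /pushforward (_ : _ @^-1` _ = setT); last first.
      by apply/seteqP; split.
    rewrite -setXTT product_measure1E//.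
    by rewrite [X in X * _](probability_setT nu) [X in _ * X](probability_setT rho) mule1.
  rewrite big_ord_recl /pushforward (_ : _ @^-1` _ =
      B 0%N `*` [set w : seq_space T | forall i, (i < n)%N -> B i.+1 (w i)]); last first.
    apply/seteqP; split => -[x w] /=.
      by move=> H; split => [|i ni]; [exact: (H 0%N)|exact: (H i.+1)].
    by move=> [H0 H] [|i] //=; rewrite ltnS => /H.
  rewrite product_measure1E//; last exact: (measurable_rectangle n (fun i => mB i.+1)).
  by congr (_ * _); rewrite [RHS](rhoP n (fun i => mB i.+1)).
- by move=> _; rewrite [ltLHS](probability_setT rho) ltry.
Qed.

Lemma power_measure_integral (F : seq_space T -> \bar R) :
  measurable_fun setT F -> (forall w, 0 <= F w) ->
  \int[rho]_w F w = \int[nu]_x \int[rho]_w F (seq_cons x w).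
Proof.
move=> mF F0.
have mFc := measurableT_comp mF measurable_seq_cons.
apply: etrans (fubini_tonelli1 _ mFc (fun q => F0 _)).
rewrite -[RHS](ge0_integral_pushforward measurable_seq_cons _ measurableT mF)//.
apply: eq_measure_integral => [|mcons A mA _]; first exact: measurable_seq_cons.
exact: power_measure_cons.
Qed.

End sequences.

Section orbits.
Variable R : realType.
Local Open Scope ereal_scope.
Variables (V W : circle R -> R).
Hypotheses (mV : measurable_fun setT V) (mW : measurable_fun setT W).
Local Notation Omega := (seq_space (torus R)).
Implicit Types (w : Omega) (p : phase R) (y : torus R) (v : R * R).

(** The second component is the image of the tangent vector by the derivative of
the random composition when W is the derivative of V. *)
Fixpoint tangent_orbit w n p : phase R :=
  if n is k.+1 then shift_phase (w k) (skew_product V W (tangent_orbit w k p)) else p.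

Lemma orbit_fst w n p : (tangent_orbit w n p).1 = random_iter V w n p.1.
Proof. by elim: n => //= n ->. Qed.

(** Orbits append the newest noise last, while the operator averages over the first
one; this lemma reconciles the two orders. *)
Lemma orbit_cons (x : torus R) w n p :
  tangent_orbit (seq_cons x w) n.+1 p = tangent_orbit w n (shift_phase x (skew_product V W p)).
Proof. by elim: n => // n IH; rewrite /= -IH. Qed.

Lemma measurable_orbit n :
  measurable_fun setT (fun q : Omega * phase R => tangent_orbit q.1 n q.2).
Proof.
elim: n => [|n IH] /=; first exact: measurable_snd.
apply: measurable_shift_phase2.
  exact: (measurableT_comp (@measurable_coordinate _ (torus R) n)
    (@measurable_fst _ _ Omega (phase R))).
exact: (measurableT_comp (measurable_skew_product mV mW) IH).
Qed.

Lemma tangent_step_linear a (s t : R) v v' :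
  tangent_step a ((s * v.1 + t * v'.1)%R, (s * v.2 + t * v'.2)%R) =
  ((s * (tangent_step a v).1 + t * (tangent_step a v').1)%R,
   (s * (tangent_step a v).2 + t * (tangent_step a v').2)%R).
Proof.
by rewrite /tangent_step /hshear /vshear /=; congr (_, _); ring.
Qed.

Lemma orbit_linear w n y v :
  (tangent_orbit w n (y, v)).2 =
  ((v.1 * (tangent_orbit w n (y, (1, 0))).2.1 + v.2 * (tangent_orbit w n (y, (0, 1))).2.1)%R,
   (v.1 * (tangent_orbit w n (y, (1, 0))).2.2 + v.2 * (tangent_orbit w n (y, (0, 1))).2.2)%R).
Proof.
elim: n => [|n IH] /=.
  by case: v => a b /=; rewrite !mulr0 !mulr1 addr0 add0r.
by rewrite !orbit_fst /= IH tangent_step_linear.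
Qed.

Definition box (s : R) : set (R * R) := [set v | (`|v.1| <= s)%R /\ (`|v.2| <= s)%R].

Lemma box_setX s : box s = `[(- s)%R, s] `*` `[(- s)%R, s].
Proof.
by apply/seteqP; split => v /=; rewrite !in_itv/= -!ler_norml => -[].
Qed.

Lemma measurable_box s : measurable (box s).
Proof. by rewrite box_setX; exact: measurableX. Qed.

Lemma leb2_box s : (0 <= s)%R -> leb2 (box s) = (4 * s ^+ 2)%:E.
Proof.
move=> s0; rewrite box_setX /leb2 product_measure1E//= lebesgue_measure_itv/= lte_fin.
case: ltP => h.
  by rewrite -EFinB -EFinM; congr EFin; ring.
by rewrite mule0 (_ : s = 0)%R; [rewrite expr0n mulr0|lra].
Qed.

Definition box_indicator p : R := \1_(box 1) p.2.

Lemma unit_valued_box : unit_valued box_indicator.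
Proof.
split; last by move=> p; rewrite /box_indicator indicE; case: (_ \in _) => /=; lra.
by apply: measurable_snd_phase; exact: measurable_indic (measurable_box 1).
Qed.

Lemma sqnorm_box : sqnorm box_indicator = 4%:E.
Proof.
have [mb b01] := unit_valued_box.
apply: (etrans (mphase_integral (measurable_sq mb) _)).
  by move=> p; rewrite lee_fin sqr_ge0.
rewrite -[RHS](probability_integral_cst (@haar2 R)).
apply: eq_integral => y _.
transitivity (\int[@leb2 R]_v (\1_(box 1) v)%:E).
  apply: eq_integral => v _; rewrite /box_indicator/= indicE.
  by case: (_ \in _); rewrite ?expr1n ?expr0n.
rewrite integral_indic//; last exact: measurable_box.
by rewrite setIT; apply: (etrans (leb2_box ler01)); rewrite expr1n mulr1.
Qed.

Variables (nu : probability (torus R) R) (rho : probability Omega R).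
Hypothesis rhoP : is_power_measure nu rho.

(** The operator computes a probability: starting from p, the tangent vector is in
the unit box at time n. *)
Lemma iter_transfer n p :
  (iter n (transfer V W nu) box_indicator p)%:E =
  \int[rho]_w (box_indicator (tangent_orbit w n p))%:E.
Proof.
elim: n p => [|n IH] p /=; first by rewrite (probability_integral_cst rho).
have unit_n : unit_valued (iter n (transfer V W nu) box_indicator).
  elim: n {IH} => [|n IH]; first exact: unit_valued_box.
  exact: unit_valued_transfer.
have [mb b01] := unit_valued_box.
rewrite [RHS](power_measure_integral rhoP)//; last 2 first.
- apply/measurable_EFinP; apply: (measurableT_comp mb).
  exact: (measurable_fun_pair1 p (measurable_orbit n.+1)).
- by move=> w; rewrite lee_fin; have /andP[] := b01 (tangent_orbit w n.+1 p).
rewrite /transfer /= noise_meanE//; apply: eq_integral => x _.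
by rewrite IH; apply: eq_integral => w _; rewrite -orbit_cons.
Qed.

End orbits.

Lemma product_measure_sections d1 d2 (T1 : measurableType d1)
    (T2 : measurableType d2) (R : realType)
    (m1 : {sigma_finite_measure set T1 -> \bar R})
    (m2 : {sigma_finite_measure set T2 -> \bar R}) (B : set (T1 * T2)) :
  measurable B ->
  ((m1 \x m2) B = \int[m2]_y \int[m1]_x (\1_B (x, y))%:E)%E.
Proof.
move=> mB; transitivity (\int[m1 \x m2]_z (\1_B z)%:E)%E.
  by rewrite integral_indic// setIT.
apply: (fubini_tonelli2 (fun z => (\1_B z)%:E)) => [|z]; last by rewrite lee_fin.
by apply/measurable_EFinP; exact: measurable_indic.
Qed.

(** * Growth along a subsequence *)

Section growth.
Variable R : realType.
Local Open Scope ereal_scope.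
Variables (V W : circle R -> R).
Hypotheses (mV : measurable_fun setT V) (mW : measurable_fun setT W).
Local Notation Omega := (seq_space (torus R)).
Variables (nu : probability (torus R) R) (rho : probability Omega R).
Hypothesis rhoP : is_power_measure nu rho.
Local Notation orb := (tangent_orbit V W).
Local Notation count n := (iter n (transfer V W nu) (@box_indicator R)).

(** The entries of the derivative at time n are the components of the images of the
two basis vectors. *)
Definition slow_set (n : nat) (s : R) : set (Omega * torus R) :=
  [set z | box s (orb z.1 n (z.2, (1, 0)%R)).2 /\ box s (orb z.1 n (z.2, (0, 1)%R)).2].

Lemma measurable_slow_set n s : measurable (slow_set n s).
Proof.
have m v : measurable_fun setT (fun z : Omega * torus R => (orb z.1 n (z.2, v)).2).
  apply: (measurableT_comp (measurable_snd : measurable_fun setT (snd : phase R -> _))).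
  apply: (measurableT_comp (measurable_orbit mV mW n)
    (_ : measurable_fun setT (fun z : Omega * torus R => (z.1, (z.2, v))))).
  by apply: measurable_fun_pair => //; exact: measurable_fun_pair.
have -> : slow_set n s =
    ((fun z : Omega * torus R => (orb z.1 n (z.2, (1, 0)%R)).2) @^-1` box s) `&`
    ((fun z : Omega * torus R => (orb z.1 n (z.2, (0, 1)%R)).2) @^-1` box s) by [].
apply: measurableI; rewrite -[X in measurable X]setTI.
  by apply: (m (1, 0)%R) => //; exact: measurable_box.
by apply: (m (0, 1)%R) => //; exact: measurable_box.
Qed.

Lemma slow_box n (s : R) (z : Omega * torus R) v : (0 < s)%R ->
  slow_set n s z -> box (2 * s)^-1 v -> box 1 (orb z.1 n (z.2, v)).2.
Proof.
move=> s0 [[a1 a2] [b1 b2]] [v1 v2]; rewrite orbit_linear.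
set a := (orb _ _ _).2 in a1 a2 *; set b := (orb _ _ _).2 in b1 b2 *.
have key (x x' : R) : (`|x| <= s)%R -> (`|x'| <= s)%R -> (`|v.1 * x + v.2 * x'| <= 1)%R.
  move=> hx hx'; apply: (le_trans (ler_normD _ _)); rewrite !normrM.
  have -> : 1%R = ((2 * s)^-1 * s + (2 * s)^-1 * s)%R :> R.
    by field; rewrite gt_eqF.
  by apply: lerD; apply: ler_pM.
by split; apply: key.
Qed.

Let unit_count n : unit_valued (count n).
Proof. by elim: n => [|n IH]; [exact: unit_valued_box|exact: unit_valued_transfer]. Qed.

(** On the event of slow growth, every vector of the box of size 1 / (2s), of area
s^(-2), stays in the unit box. Hence the probability of the event times this area
is at most the integral of the function [count n] over small vectors, which Young's
inequality with parameter eta bounds by its L2 norm. *)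
Lemma slow_probability n (s eta : R) : (0 < s)%R -> (0 < eta)%R ->
  (s ^- 2)%:E * (rho \x @haar2 R) (slow_set n s) <=
  ((2 * eta)^-1)%:E * sqnorm (count n) + (eta / 2 * s ^- 2)%:E.
Proof.
move=> s0 eta0; set B := slow_set n s; set Phi := count n.
have mB : measurable B by exact: measurable_slow_set.
have [mPhi Phi01] := unit_count n; rewrite -/Phi in mPhi Phi01.
have Phi0 p : (0 <= Phi p)%R by have /andP[] := Phi01 p.
pose D := box (2 * s)^-1 : set (R * R).
have mD : measurable D by exact: measurable_box.
have D2 : @leb2 R D = (s ^- 2)%:E.
  apply: (etrans (leb2_box _)); first by rewrite invr_ge0 mulr_ge0// ltW.
  by congr EFin; field; rewrite gt_eqF.
have mBE : measurable_fun setT (fun z : Omega * torus R => (\1_B z)%:E : \bar R).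
  by apply/measurable_EFinP; exact: measurable_indic.
have B0 (z : Omega * torus R) : 0 <= (\1_B z)%:E :> \bar R by rewrite lee_fin.
pose b y := \int[rho]_w (\1_B (w, y))%:E.
have mb : measurable_fun setT b by exact: (measurable_fun_fubini_tonelli_G _ mBE B0).
have b0 y : 0 <= b y by apply: integral_ge0 => w _; exact: B0.
have muB : (rho \x @haar2 R) B = \int[@haar2 R]_y b y.
  exact: product_measure_sections.
have mDE : measurable_fun setT (fun v : R * R => (\1_D v)%:E : \bar R).
  by apply/measurable_EFinP; exact: measurable_indic.
have intD : \int[@leb2 R]_v (\1_D v)%:E = (s ^- 2)%:E.
  by rewrite integral_indic// setIT; exact: D2.
pose G (p : phase R) := (\1_D p.2)%:E * (Phi p)%:E.
have mDp : measurable_fun setT (fun p : phase R => (\1_D p.2)%:E : \bar R).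
  exact: (measurableT_comp mDE measurable_snd).
have mG : measurable_fun setT G by apply: emeasurable_funM => //; exact/measurable_EFinP.
have G0 p : 0 <= G p by rewrite mule_ge0// lee_fin.
have lower : (s ^- 2)%:E * (rho \x @haar2 R) B <= \int[@mphase R]_p G p.
  rewrite muB (mphase_integral mG G0) -ge0_integralZl//; last first.
    by rewrite lee_fin invr_ge0 exprn_ge0// ltW.
  apply: ge0_le_integral => //.
  - by move=> y _; rewrite mule_ge0// lee_fin invr_ge0 exprn_ge0// ltW.
  - exact: emeasurable_funM.
  - exact: measurable_inner_integral.
  move=> y _; rewrite -intD muleC -ge0_integralZl//.
  apply: ge0_le_integral => //.
  - by move=> v _; rewrite mule_ge0// lee_fin.
  - exact: emeasurable_funM.
  - exact: (measurable_fun_pair2 y mG).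
  move=> v _; rewrite muleC /G/=; have [/set_mem Dv|vD] := boolP (v \in D); last first.
    by rewrite !indicE (negbTE vD) !mul0e.
  apply: lee_wpmul2l; first by rewrite lee_fin.
  rewrite /Phi (iter_transfer mV mW rhoP).
  apply: ge0_le_integral => //.
  - exact: (measurable_fun_pair1 y mBE).
  - apply/measurable_EFinP; apply: (measurableT_comp (unit_valued_box R).1).
    exact: (measurable_fun_pair1 _ (measurable_orbit mV mW n)).
  move=> w _; rewrite lee_fin /box_indicator !indicE.
  have [/set_mem Bwy|_] := boolP ((w, y) \in B); last by rewrite ler0n.
  by rewrite mem_set//; exact: (slow_box s0 Bwy).
apply: (le_trans lower).
(* Young's inequality: x i <= x^2 / (2 eta) + eta i / 2 when i is 0 or 1. *)
apply: (@le_trans _ _ (\int[@mphase R]_p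
    (((2 * eta)^-1)%:E * (Phi p ^+ 2)%:E + (eta / 2)%:E * (\1_D p.2)%:E))).
  apply: ge0_le_integral => //.
  - apply: emeasurable_funD; apply: emeasurable_funM => //; exact: measurable_sq.
  move=> p _; rewrite /G -!EFinM -EFinD lee_fin.
  set x := Phi p; set i : R := \1_D _.
  have ii : (i * i = i)%R by rewrite /i indicE; case: (_ \in _); rewrite ?mul1r ?mul0r.
  have -> : ((2 * eta)^-1 * x ^+ 2 + eta / 2 * i =
    i * x + (2 * eta)^-1 * (x - eta * i) ^+ 2)%R.
    rewrite (_ : (x - eta * i) ^+ 2 = x ^+ 2 - 2 * eta * (i * x) + eta ^+ 2 * (i * i))%R; last by ring.
    by rewrite ii; field; rewrite gt_eqF.
  by rewrite lerDl mulr_ge0 ?sqr_ge0// invr_ge0 mulr_ge0// ltW.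
have eta20 : (0 <= (2 * eta)^-1)%R by rewrite invr_ge0 mulr_ge0// ltW.
have eta2 : (0 <= eta / 2)%R by rewrite divr_ge0// ltW.
rewrite ge0_integralD//; last 4 first.
- by move=> p _; rewrite -EFinM lee_fin mulr_ge0 ?sqr_ge0.
- by apply: emeasurable_funM => //; exact: measurable_sq.
- by move=> p _; rewrite -EFinM lee_fin mulr_ge0.
- exact: emeasurable_funM.
rewrite ge0_integralZl//; last 2 first.
- exact: measurable_sq.
- by move=> p _; rewrite lee_fin sqr_ge0.
apply: leeD => //; rewrite ge0_integralZl//.
rewrite [leRHS]EFinM; apply: lee_wpmul2l => //; apply: eq_lee.
apply: (etrans (mphase_integral mDp _)); first by move=> p; rewrite lee_fin.
rewrite -[RHS](probability_integral_cst (@haar2 R)); apply: eq_integral => y _.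
exact: intD.
Qed.

Variable r : R.
Hypothesis r01 : (0 <= r < 1)%R.
Hypothesis contraction : forall phi, unit_valued phi -> sqnorm phi < +oo ->
  sqnorm (iter 4 (transfer V W nu) phi) <= r%:E * sqnorm phi.

Lemma sqnorm_count k : sqnorm (count (4 * k)) <= (4 * r ^+ k)%:E.
Proof.
elim: k => [|k IH]; first by rewrite muln0 expr0 mulr1 sqnorm_box.
rewrite mulnS iterD.
have fin : sqnorm (count (4 * k)) < +oo by rewrite (le_lt_trans IH)// ltry.
apply: (le_trans (contraction (unit_count _) fin)).
rewrite exprS mulrCA EFinM; apply: lee_wpmul2l => //.
by rewrite lee_fin; case/andP: r01.
Qed.

(** With s = e^(cn) and n = 4k, the factor s^2 = e^(8ck) from the area is beaten by
the decay r^k <= e^(-16ck) of the squared norm. *)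
Lemma slow_probability_rate (c eta : R) k : (r <= expR (- (16 * c)))%R -> (0 < eta)%R ->
  (rho \x @haar2 R) (slow_set (4 * k) (expR (c * (4 * k)%:R))) <=
  (2 / eta * expR (- (8 * c * k%:R)) + eta / 2)%:E.
Proof.
move=> rc eta0; set s := expR _; have s0 : (0 < s)%R by exact: expR_gt0.
have [r0 _] := andP r01.
pose E : R := expR (8 * c * k%:R); have E0 : (0 < E)%R by exact: expR_gt0.
have sE : (s ^+ 2 = E)%R.
  by rewrite /s -expRM_natr; congr expR; rewrite natrM; ring.
have rE : (r ^+ k <= E^-1 * E^-1)%R.
  rewrite -expRN -expRD.
  have -> : (- (8 * c * k%:R) + - (8 * c * k%:R) = - (16 * c) * k%:R)%R by ring.
  by rewrite expRM_natr lerXn2r// nnegrE// expR_ge0.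
set m := (rho \x _) _.
have -> : m = E%:E * ((s ^- 2)%:E * m).
  by rewrite muleA -EFinM sE mulfV ?mul1e// gt_eqF.
apply: (@le_trans _ _ (E%:E * ((2 * eta)^-1 * (4 * r ^+ k) + eta / 2 * s ^- 2)%:E)).
  apply: lee_wpmul2l; first by rewrite lee_fin ltW.
  apply: (le_trans (slow_probability (4 * k) s0 eta0)).
  rewrite [leRHS]EFinD; apply: leeD => //; rewrite [leRHS]EFinM.
  apply: lee_wpmul2l; last exact: sqnorm_count.
  by rewrite lee_fin invr_ge0 mulr_ge0// ltW.
rewrite -EFinM lee_fin sE expRN -/E.
have -> : (E * ((2 * eta)^-1 * (4 * r ^+ k) + eta / 2 * E^-1) =
    2 / eta * (E * r ^+ k) + eta / 2)%R by field; rewrite !gt_eqF.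
rewrite lerD2r; apply: ler_wpM2l; first by rewrite divr_ge0// ltW.
apply: (le_trans (ler_wpM2l (ltW E0) rE)).
by rewrite mulrA mulfV ?mul1r// gt_eqF.
Qed.

(** For each K, the event of slow growth at all times 4k with k >= K is contained in
the events at single times, of arbitrarily small probability. *)
Lemma frequent_growth : exists2 c : R, (0 < c)%R &
  (rho \x @haar2 R).-negligible [set z | exists K : nat, forall k, (K <= k)%N ->
    slow_set (4 * k) (expR (c * (4 * k)%:R)) z].
Proof.
have [r0 r1] := andP r01.
have [c c0 rc] : exists2 c : R, (0 < c)%R & (r <= expR (- (16 * c)))%R.
  have [->|rn0] := eqVneq r 0%R; first by exists 1%R => //; exact: expR_ge0.
  have rp : (0 < r)%R by rewrite lt_neqAle eq_sym rn0.
  exists (- ln r / 16)%R; first by rewrite divr_gt0// oppr_gt0 ln_lt0// rp.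
  by rewrite mulrC divfK// opprK lnK.
exists c => //.
pose B k := slow_set (4 * k) (expR (c * (4 * k)%:R)).
have mB k : measurable (B k) by exact: measurable_slow_set.
rewrite (_ : [set z | _] = \bigcup_K \bigcap_(k in [set k | (K <= k)%N]) B k); last first.
  by apply/seteqP; split => z [K]; [exists K|move=> _; exists K].
apply: negligible_bigcup => K.
have mI : measurable (\bigcap_(k in [set k | (K <= k)%N]) B k).
  by apply: bigcap_measurableType => k _; exact: mB.
exists (\bigcap_(k in [set k | (K <= k)%N]) B k); split => //.
apply/eqP; rewrite eq_le measure_ge0 andbT; apply/lee_addgt0Pr => e e0.
rewrite add0e.
pose k := maxn K (Num.bound (4 / (e * e) / (8 * c))%R).
apply: (@le_trans _ _ ((rho \x @haar2 R) (B k))).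
  apply: le_measure; rewrite ?inE//; apply: bigcap_inf => /=.
  exact: leq_maxl.
apply: (le_trans (slow_probability_rate k rc e0)); rewrite lee_fin.
have ee0 : (0 < e * e)%R by exact: mulr_gt0.
have kbig : (4 / (e * e) <= 8 * c * k%:R)%R.
  rewrite -ler_pdivrMl ?mulr_gt0// mulrC.
  apply: (@le_trans _ _ (Num.bound (4 / (e * e) / (8 * c))%R)%:R).
    by apply: ltW; apply: archi_boundP; rewrite !divr_ge0 ?mulr_ge0 ?ltW.
  by rewrite ler_nat leq_maxr.
have : (expR (- (8 * c * k%:R)) <= e * e / 4)%R.
  rewrite expRN -[leRHS]invrK lef_pV2 ?posrE ?expR_gt0 ?invr_gt0 ?divr_gt0//.
  rewrite invf_div (le_trans kbig)// (le_trans _ (expR_ge1Dx _))//; lra.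
move=> h; rewrite [leRHS](_ : e = 2 / e * (e * e / 4) + e / 2)%R; last first.
  by field; rewrite gt_eqF.
by rewrite lerD2r ler_wpM2l// divr_ge0// ltW.
Qed.

End growth.

(** * The slope of the potential *)

Section slopes.
Variable R : realType.
Variable V : circle R -> R.
Hypothesis V1 : circle_C1 V.

Local Notation f := (V \o @circle_pi R).

Definition slope (x : circle R) : R := derive1 f (circle_log x).

Lemma lift_periodic (t : R) (m : int) : f (t + m%:~R) = f t.
Proof. by rewrite /= circle_piDz. Qed.

Lemma slope_pi (t : R) : slope (circle_pi t) = derive1 f t.
Proof.
rewrite /slope; have [m ->] := circle_log_pi t.
have E (u : R) : f (u - m%:~R) = f u by rewrite -mulrNz lift_periodic.
have EF : (fun h : R => h^-1 *: (f (h + (t - m%:~R)) - f (t - m%:~R))) =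
    (fun h => h^-1 *: (f (h + t) - f t)).
  by apply/funext => h; rewrite addrA !E.
by rewrite /derive1 EF.
Qed.

Lemma continuous_lift : continuous f.
Proof.
move=> t; have [dV _] := V1.
exact: (differentiable_continuous (proj1 (derivable1_diffP _ _) (dV t))).
Qed.

Lemma measurable_potential : measurable_fun setT V.
Proof. exact: (continuous_circle_measurable continuous_lift). Qed.

Lemma continuous_slope_lift : continuous (slope \o @circle_pi R).
Proof.
rewrite (_ : _ \o _ = derive1 f); first by case: V1.
by apply/funext => t /=; rewrite slope_pi.
Qed.

Lemma measurable_slope : measurable_fun setT slope.
Proof. exact: (continuous_circle_measurable continuous_slope_lift). Qed.

Lemma haar1_open_gt0 (U : set (circle R)) (x : circle R) :
  circle_open U -> U x -> (0 < @haar1 R U)%E.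
Proof.
move=> oU Ux; have [s [/andP[s0 s1] sx]] := circle_lift01 x.
have /= Us : (@circle_pi R @^-1` U) s by rewrite /= sx.
have /nbhs_ballP[e /= e0 he] := open_nbhs_nbhs (conj oU Us).
pose m := Num.min (s + e) 1.
have sm : s < m by rewrite lt_min s1 andbT ltrDl.
apply: (@lt_le_trans _ _ (lebesgue_measure `]s, m[)).
  by rewrite lebesgue_measure_itv/= lte_fin sm -EFinB lte_fin subr_gt0.
rewrite /haar1 /pushforward /mrestr; apply: le_measure; rewrite ?inE//.
  apply: measurableI => //.
  rewrite -[X in measurable X]setTI.
  by apply: (@measurable_circle_pi R) => //; exact: sub_gen_smallest.
move=> t /=; rewrite in_itv/= lt_min => /andP[st /andP[te t1]]; split.
  by apply: he; rewrite /ball/= ltr0_norm ?subr_lt0//; lra.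
by rewrite in_itv/=; apply/andP; split; lra.
Qed.

(** V takes a value different from V 0 at some s in ]0, 1[, and the lift is periodic.
The mean value theorem on [0, s] and on [s, 1] then gives slopes of opposite signs.
The slope being continuous, values near each of them are taken on open sets, which
have positive Haar measure. *)
Lemma slopes_differ : ~ (exists c, forall x, V x = c) ->
  exists alpha beta : R, [/\ beta < alpha,
    (0 < @haar1 R [set a | (alpha < slope a)%R])%E &
    (0 < @haar1 R [set b | (slope b < beta)%R])%E].
Proof.
move=> Vnc.
have [x Vx] : exists x, V x <> V 0.
  apply: contrapT => /forallNP H; apply: Vnc; exists (V 0) => x.
  by apply: contrapT; exact: H.
have [s [/andP[s0 s1] sx]] := circle_lift01 x.
have f0 : f 0 = V 0 by rewrite /= circle_pi0.
have f1 : f 1 = V 0 by rewrite -f0 -(lift_periodic 0 1) add0r.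
have fs : f s <> V 0 by rewrite /= sx.
have {}s0 : 0 < s.
  by rewrite lt_neqAle s0 andbT; apply/eqP => E; apply: fs; rewrite -E.
have fder (a b t : R) : t \in `]a, b[%R -> is_derive t 1 f (derive1 f t).
  by move=> _; rewrite derive1E; apply: derivableP; case: V1.
have fcont (a b : R) : {within `[a, b], continuous f}.
  by apply: continuous_subspaceT; exact: continuous_lift.
have [p _ hp] := MVT s0 (@fder 0 s) (fcont 0 s).
have [q _ hq] := MVT s1 (@fder s 1) (fcont s 1).
rewrite f0 subr0 in hp; rewrite f1 in hq.
have open_upper alpha : circle_open [set a | alpha < slope a].
  rewrite /circle_open /=.
  have -> : @circle_pi R @^-1` [set a | alpha < slope a] =
      (slope \o @circle_pi R) @^-1` `]alpha, +oo[.
    by apply/seteqP; split => t /=; rewrite in_itv/= andbT.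
  by apply: open_comp => [t _|]; [exact: continuous_slope_lift|exact: interval_open].
have open_lower beta : circle_open [set a | slope a < beta].
  rewrite /circle_open /=.
  have -> : @circle_pi R @^-1` [set a | slope a < beta] =
      (slope \o @circle_pi R) @^-1` `]-oo, beta[.
    by apply/seteqP; split => t /=; rewrite in_itv.
  by apply: open_comp => [t _|]; [exact: continuous_slope_lift|exact: interval_open].
have conclude t u : derive1 f u < derive1 f t -> exists alpha beta : R, [/\ beta < alpha,
    (0 < @haar1 R [set a | (alpha < slope a)%R])%E &
    (0 < @haar1 R [set b | (slope b < beta)%R])%E].
  move=> ut; set P := derive1 f t in ut *; set Q := derive1 f u in ut *.
  exists ((P + P + Q) / 3), ((P + Q + Q) / 3); split; first lra.
    apply: (haar1_open_gt0 (x := circle_pi t)) => //=.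
    by rewrite slope_pi -/P; lra.
  apply: (haar1_open_gt0 (x := circle_pi u)) => //=.
  by rewrite slope_pi -/Q; lra.
have [lt|gt|eq] := ltgtP (derive1 f p) (derive1 f q).
- exact: conclude lt.
- exact: conclude gt.
exfalso; apply: fs.
rewrite -eq in hq.
have : derive1 f p = 0.
  by move: hp hq; move: (f s) (V 0) (derive1 f p) => F F0 D; lra.
by move=> D0; move: hp; rewrite D0 mul0r => /eqP; rewrite subr_eq0 => /eqP.
Qed.

End slopes.

(** * The derivative of the random composition *)

Section jacobian.
Variable R : realType.
Variable V : circle R -> R.
Hypothesis V1 : circle_C1 V.
Local Notation f := (V \o @circle_pi R).
Local Notation Omega := (seq_space (torus R)).

(** The logarithm chart is discontinuous, so the map whose Jacobian is wanted is
differentiable only through its agreement near 0 with a smooth lift. *)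
Lemma jacobian_near (F H : 'rV[R]_2 -> 'rV[R]_2) (M : 'M[R]_2) :
  (\forall h \near (0 : 'rV[R]_2), F h = H h) -> differentiable H (0 : 'rV[R]_2) ->
  (forall h, 'd H (0 : 'rV[R]_2) h = h *m M) -> 'J F 0 = M.
Proof.
move=> FH dH dHE.
have dF : 'd F (0 : 'rV[R]_2) = 'd H (0 : 'rV[R]_2) :> ('rV[R]_2 -> 'rV[R]_2).
  apply: diff_unique; first exact: diff_continuous.
  apply/eqaddoP => e e0.
  have /eqaddoP/(_ e e0) := diff_locally dH.
  have F0 : F 0 = H 0 by exact: nbhs_singleton FH.
  apply: filter_app; near=> h.
  rewrite /= !fctE /= !addr0 F0 (_ : F h = H h)//.
  by near: h.
apply/matrixP => i j.
by rewrite /jacobian mxE dF dHE -rowE mxE.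
Unshelve. all: by end_near. Qed.

Implicit Types (h : 'rV[R]_2) (t a : R) (w : Omega) (y x : torus R).

(** The translated map read in the charts centered at y and at its image, without
reduction modulo 1; only t, a lift of the first coordinate of y, matters. *)
Definition lift_step t h : 'rV[R]_2 :=
  h + h 0 1 *: delta_mx 0 0 + (f (t + h 0 0) - f t) *: const_mx 1.

Definition step_matrix a : 'M[R]_2 :=
  \matrix_(i, j) (if i == 0 then (if j == 0 then 1 + a else a) else 1).

Lemma lift_step0 t : lift_step t 0 = 0.
Proof. by apply/rowP => j; rewrite !mxE /= addr0 subrr !mul0r !addr0. Qed.

Lemma step_rearrange (G : zmodType) (y1 y2 p0 p1 q e z : G) :
  y1 + p0 + (y2 + p1) + (q + e) + z = y1 + y2 + q + z + (p0 + p1 + e).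
Proof. by rewrite [LHS](AC (2*2*2*1) ((1*3)*5*7*((2*4)*6))). Qed.

Lemma translated_map_lift x y h :
  translated_map V x (y + torus_pi h) =
  translated_map V x y + torus_pi (lift_step (circle_log y.1) h).
Proof.
set t := circle_log y.1.
have Vy : V y.1 = f t by rewrite /= circle_logK.
have Vyh : V (y.1 + circle_pi (h 0 0)) = f (t + h 0 0).
  by rewrite /= circle_piD circle_logK.
have piB (a b : R) : circle_pi a = circle_pi b + circle_pi (a - b) :> circle R.
  by rewrite -circle_piD addrC subrK.
have E0 : lift_step t h 0 0 = h 0 0 + h 0 1 + (f (t + h 0 0) - f t).
  by rewrite !mxE /=; ring.
have E1 : lift_step t h 0 1 = h 0 1 + (f (t + h 0 0) - f t).
  by rewrite !mxE /=; ring.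
apply/pair_equal_spec; split => /=; rewrite ?E0 ?E1 Vyh Vy (piB (f (t + h 0 0)) (f t)).
  by rewrite !circle_piD step_rearrange.
by rewrite !circle_piD [LHS](AC (2*2*1) ((1*3)*5*(2*4))).
Qed.

Fixpoint lift_iter w n y h : 'rV[R]_2 :=
  if n is k.+1
  then lift_step (circle_log (random_iter V w k y).1) (lift_iter w k y h) else h.

Lemma random_iter_lift w n y h :
  random_iter V w n (y + torus_pi h) = random_iter V w n y + torus_pi (lift_iter w n y h).
Proof. by elim: n => //= n ->; rewrite translated_map_lift. Qed.

Lemma lift_iter0 w n y : lift_iter w n y 0 = 0.
Proof. by elim: n => //= n ->; rewrite lift_step0. Qed.

Lemma ord2 (j : 'I_2) : j = 0 \/ j = 1.
Proof. by case: j => [[|[|]]] // i; [left|right]; exact/val_inj. Qed.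

Lemma diff_lift_step t : differentiable (lift_step t) (0 : 'rV[R]_2) /\
  forall h, 'd (lift_step t) (0 : 'rV[R]_2) h = h *m step_matrix (derive1 f t).
Proof.
have [fder _] := V1.
pose c (j : 'I_2) : 'rV[R]_2 -> R := fun h => h 0 j.
have lin_c j : linear (c j) by move=> k u v; rewrite /c !mxE.
have dc j : is_diff (0 : 'rV[R]_2) (c j) (c j).
  pose cM := GRing.isLinear.Build _ _ _ _ _ (lin_c j).
  pose cL : {linear 'rV[R]_2 -> R} := HB.pack (c j) cM.
  have cc : continuous (cL : 'rV[R]_2 -> R) by exact: coord_continuous.
  by apply: DiffDef; [exact: differentiable_coord|exact: (@diff_lin R _ _ cL (0 : 'rV[R]_2) cc)].
pose k : 'rV[R]_2 -> R := cst t + c 0.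
have k0 : k 0 = t by rewrite /k /= fctE /c mxE addr0.
have dk : is_diff (0 : 'rV[R]_2) k (c 0).
  by apply: (is_diff_eq (is_diffD (is_diff_cst t 0) (dc 0))); rewrite add0r.
have df : is_diff (k 0) (f : R -> R) ( *:%R^~ (derive1 f t)).
  rewrite k0; apply: DiffDef; first exact/derivable1_diffP.
  exact: deriv1E.
pose g : 'rV[R]_2 -> R := (f \o k) - cst (f t).
have dg : is_diff (0 : 'rV[R]_2) g (fun h => c 0 h * derive1 f t).
  by apply: (is_diff_eq (is_diffB (is_diff_comp dk df) (is_diff_cst (f t) 0)));
    rewrite subr0.
pose H : 'rV[R]_2 -> 'rV[R]_2 :=
  id + (fun h => c 1 h *: (delta_mx 0 0 : 'rV[R]_2)) + (fun h => g h *: const_mx 1).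
have HE : lift_step t = H by apply/funext => h; rewrite /H /= !fctE.
have d1 : differentiable (c 1) (0 : 'rV[R]_2) by exact: ex_diff.
have d2 : differentiable g (0 : 'rV[R]_2) by exact: ex_diff.
have dz1 : is_diff (0 : 'rV[R]_2) (fun h => c 1 h *: (delta_mx 0 0 : 'rV[R]_2))
    (fun h => c 1 h *: (delta_mx 0 0 : 'rV[R]_2)).
  apply: DiffDef; first exact: differentiableZl.
  by rewrite diffZl//; apply/funext => h; rewrite diff_val.
have dz2 : is_diff (0 : 'rV[R]_2) (fun h => g h *: (const_mx 1 : 'rV[R]_2))
    (fun h => (c 0 h * derive1 f t) *: (const_mx 1 : 'rV[R]_2)).
  apply: DiffDef; first exact: differentiableZl.
  by rewrite diffZl//; apply/funext => h; rewrite diff_val.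
have dH := is_diffD (is_diffD (is_diff_id (0 : 'rV[R]_2)) dz1) dz2.
rewrite HE; split=> [|h]; first exact: ex_diff.
rewrite diff_val; apply/rowP => j; rewrite /= !fctE !mxE /c big_ord_recl big_ord1 !mxE /=.
have -> : lift ord0 ord0 = 1 :> 'I_2 by exact/val_inj.
have -> : ord0 = 0 :> 'I_2 by exact/val_inj.
set d := derive1 _ _.
by have [->|->] := ord2 j; rewrite /=; ring.
Qed.

Fixpoint orbit_matrix w n y : 'M[R]_2 :=
  if n is k.+1
  then orbit_matrix w k y *m step_matrix (slope V (random_iter V w k y).1) else 1%:M.

Lemma diff_lift_iter w n y : differentiable (lift_iter w n y) (0 : 'rV[R]_2) /\
  forall h, 'd (lift_iter w n y) (0 : 'rV[R]_2) h = h *m orbit_matrix w n y.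
Proof.
elim: n => [|n [dn En]].
  have -> : lift_iter w 0 y = id by apply/funext.
  by split=> [|h]; [exact: ex_diff | rewrite diff_val mulmx1].
set t := circle_log (random_iter V w n y).1.
have [dt Et] := diff_lift_step t.
have z : lift_iter w n y 0 = 0 := lift_iter0 w n y.
have -> : lift_iter w n.+1 y = lift_step t \o lift_iter w n y by apply/funext.
have dt' : differentiable (lift_step t) (lift_iter w n y 0) by rewrite z.
split=> [|h]; first exact: differentiable_comp.
have E := diff_comp dn dt'.
transitivity ('d (lift_step t) (lift_iter w n y 0) ('d (lift_iter w n y) 0 h)).
  exact: (congr1 (fun F => F h) E).
rewrite z; apply: (etrans (Et _)); rewrite En -mulmxA; reflexivity.
Qed.

(** By continuity the lift stays within distance 1/2 of 0, where the logarithm chart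
inverts the projection. *)
Lemma torus_jacobian_orbit w n y :
  torus_jacobian (random_iter V w n) y = orbit_matrix w n y.
Proof.
have [dn En] := diff_lift_iter w n y.
apply: (jacobian_near _ dn En).
have cn := differentiable_continuous dn.
have near_j (j : 'I_2) : \forall h \near (0 : 'rV[R]_2), `|lift_iter w n y h 0 j| < 2^-1.
  have cj : {for (0 : 'rV[R]_2), continuous (fun h => lift_iter w n y h 0 j)}.
    have c2 : {for lift_iter w n y 0, continuous (fun h : 'rV[R]_2 => h 0 j)}.
      exact: coord_continuous.
    exact: (continuous_comp cn c2).
  have {}cj : (fun h => lift_iter w n y h 0 j) @ nbhs (0 : 'rV[R]_2) --> (0 : R).
    by move: cj; rewrite /prop_for /continuous_at lift_iter0 mxE.
  have half : 0 < 2^-1 :> R by rewrite invr_gt0.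
  exact: (@cvgr0_norm_lt R R 'rV[R]_2 (nbhs (0 : 'rV[R]_2)) _ _ cj _ half).
near=> h.
rewrite random_iter_lift addrAC subrr add0r.
apply/rowP => j; rewrite mxE.
have hj : circle_log (circle_pi (lift_iter w n y h 0 j)) = lift_iter w n y h 0 j.
  apply: circle_piK.
  have : `|lift_iter w n y h 0 j| < 2^-1.
    by have [->|->] := ord2 j; near: h; exact: near_j.
  by rewrite ltr_norml => /andP[a b]; rewrite (ltW a) b.
by move: hj; have [->|->] := ord2 j.
Unshelve. all: by end_near.
Qed.

Definition row_of (v : R * R) : 'rV[R]_2 := \row_j (if j == 0 then v.1 else v.2).

Lemma sum2 (F : 'I_2 -> R) : \sum_j F j = F 0 + F 1.
Proof.
by rewrite big_ord_recl big_ord1; congr (F _ + F _); exact/val_inj.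
Qed.

Lemma row_of_tangent_step a v : row_of (tangent_step a v) = row_of v *m step_matrix a.
Proof.
apply/rowP => j; rewrite mxE [RHS]mxE sum2 !mxE /=.
by have [->|->] := ord2 j; rewrite /=; ring.
Qed.

(** Vectors are rows here: the rows of the matrix are the images of the basis
vectors. *)
Lemma tangent_orbit_matrix w n y (v : R * R) :
  row_of (tangent_orbit V (slope V) w n (y, v)).2 = row_of v *m orbit_matrix w n y.
Proof.
elim: n => [|n IH] /=; first by rewrite mulmx1.
by rewrite row_of_tangent_step IH orbit_fst mulmxA.
Qed.

Lemma det_mx2 (M : 'M[R]_2) : \det M = M 0 0 * M 1 1 - M 0 1 * M 1 0.
Proof.
rewrite (expand_det_row _ 0) sum2 /cofactor !det_mx11 !mxE.
have -> : lift 0 0 = 1 :> 'I_2 by exact/val_inj.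
have -> : lift 1 0 = 0 :> 'I_2 by exact/val_inj.
by rewrite /=; ring.
Qed.

Lemma det_orbit_matrix w n y : \det (orbit_matrix w n y) = 1.
Proof.
elim: n => [|n IH] /=; first by rewrite det1.
by rewrite det_mulmx IH mul1r det_mx2 !mxE /=; ring.
Qed.

End jacobian.

(** * The Lyapunov exponents *)

Section lyapunov.
Variable R : realType.

Lemma limn_esup_frequent (u : nat -> \bar R) (c : \bar R) :
  (forall K, exists2 n, (K <= n)%N & (c <= u n)%E) -> (c <= limn_esup u)%E.
Proof.
move=> H; apply: le_ereal_inf_tmp => _ [A [K _ KA] <-].
have [n Kn cn] := H K.
by apply: (le_trans cn); apply: ereal_sup_ubound; exists n => //; exact: KA.
Qed.

Implicit Types (M : 'M[R]_2) (v : 'rV[R]_2).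

Lemma eucl_norm2 v : eucl_norm v = Num.sqrt (v 0 0 ^+ 2 + v 0 1 ^+ 2).
Proof. by rewrite /eucl_norm sum2. Qed.

Lemma eucl_norm_ge v (j : 'I_2) : `|v 0 j| <= eucl_norm v.
Proof.
rewrite -sqrtr_sqr eucl_norm2; apply: ler_wsqrtr.
by have [->|->] := ord2 j; rewrite ?lerDl ?lerDr sqr_ge0.
Qed.

Lemma eucl_norm_le v (s : R) : (forall j, `|v 0 j| <= s) -> eucl_norm v <= 2 * s.
Proof.
move=> H; have s0 : 0 <= s := le_trans (normr_ge0 _) (H 0).
rewrite -[leRHS](@ger0_norm _ (2 * s)); last by rewrite mulr_ge0.
rewrite -sqrtr_sqr eucl_norm2; apply: ler_wsqrtr.
have sq j : v 0 j ^+ 2 <= s ^+ 2 by rewrite -real_normK ?num_real// ler_sqr ?nnegrE.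
have := sq 0; have := sq 1; have := sqr_ge0 s; rewrite exprMn => a b d.
by apply: (le_trans (lerD d b)); lra.
Qed.

Lemma image_norm_le M s v : (forall i j, `|M i j| <= s) -> eucl_norm v <= 1 ->
  eucl_norm (v *m M) <= 4 * s.
Proof.
move=> H v1; have -> : 4 * s = 2 * (2 * s) by ring.
apply: eucl_norm_le => j; rewrite mxE sum2.
have vi i : `|v 0 i| <= 1 := le_trans (eucl_norm_ge v i) v1.
have key i : `|v 0 i * M i j| <= s.
  by rewrite normrM -[leRHS]mul1r; apply: ler_pM.
by apply: (le_trans (ler_normD _ _)); have := lerD (key 0) (key 1); lra.
Qed.

Lemma eucl_norm0 : eucl_norm (0 : 'rV[R]_2) = 0.
Proof. by rewrite eucl_norm2 !mxE expr0n /= addr0 sqrtr0. Qed.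

Lemma op_norm_le M s : (forall i j, `|M i j| <= s) -> op_norm M <= 4 * s.
Proof.
move=> H; apply: ge_sup; last by move=> _ [v v1 <-]; exact: image_norm_le.
by exists (eucl_norm (0 *m M)); exists 0 => //=; rewrite eucl_norm0 ler01.
Qed.

Lemma op_norm_ge M i j : `|M i j| <= op_norm M.
Proof.
apply: (@le_trans _ _ (eucl_norm (delta_mx 0 i *m M))).
  by apply: le_trans (eucl_norm_ge _ j); rewrite -rowE mxE.
apply: ub_le_sup; last first.
  exists (delta_mx 0 i) => //=; rewrite eucl_norm2 !mxE /=.
  by have [->|->] := ord2 i; rewrite /= ?expr0n ?expr1n /= ?addr0 ?add0r sqrtr1.
pose s := \sum_i \sum_j `|M i j|.
exists (4 * s) => _ [v v1 <-]; apply: image_norm_le => // k l.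
rewrite /s !sum2; have [->|->] := ord2 k; have [->|->] := ord2 l;
  have := normr_ge0 (M 0 0); have := normr_ge0 (M 0 1);
  have := normr_ge0 (M 1 0); have := normr_ge0 (M 1 1); lra.
Qed.

(** The inverse is the adjugate, whose entries are those of M up to order and sign. *)
Lemma invmx_entry M i j : \det M = 1 -> exists k l, `|invmx M i j| = `|M k l|.
Proof.
move=> dM; have uM : M \in unitmx by rewrite unitmxE dM unitr1.
rewrite /invmx uM dM invr1 scale1r !mxE /cofactor det_mx11 !mxE.
by eexists; eexists; rewrite normrM normrX normrN1 expr1n mul1r.
Qed.

Lemma det_invmx1 M : \det M = 1 -> \det (invmx M) = 1.
Proof. by move=> dM; rewrite det_inv dM invr1. Qed.

Lemma op_norm_inv_ge M i j : \det M = 1 -> `|M i j| <= op_norm (invmx M).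
Proof.
move=> dM; have [k [l]] := invmx_entry i j (det_invmx1 dM).
by rewrite invmxK => ->; exact: op_norm_ge.
Qed.

Lemma op_norm_inv_le M s : \det M = 1 -> (forall i j, `|M i j| <= s) ->
  op_norm (invmx M) <= 4 * s.
Proof.
move=> dM H; apply: op_norm_le => i j.
by have [k [l ->]] := invmx_entry i j dM.
Qed.

(** For small b, ln a <= b a - ln b <= 4 b (n + 1) - ln b, which is at most 8 b n for
large n; b = e / 8. *)
Lemma log_rate_cvg0 (a : nat -> R) :
  (forall n, 1 <= a n) -> (forall n, a n <= 4 * n.+1%:R) ->
  (fun n => (n%:R^-1 * ln (a n))%:E) @ \oo --> 0%E.
Proof.
move=> a1 a2.
apply/fine_cvgP; split; first exact: nearW.
apply/cvgr0Pnorm_le => e e0 /=.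
pose b := e / 8; have b0 : 0 < b by rewrite divr_gt0.
near=> n.
have n0 : 0 < n%:R :> R by rewrite ltr0n; near: n; exact: nbhs_infty_gt.
have ap : 0 < a n := lt_le_trans ltr01 (a1 n).
have ln0 : 0 <= ln (a n) by exact: ln_ge0.
rewrite ger0_norm ?mulr_ge0 ?invr_ge0 ?ler0n// mulrC ler_pdivrMr//.
have : ln (b * a n) <= b * a n by apply/ltW/ln_sublinear; rewrite mulr_gt0.
rewrite lnM ?posrE// => H.
have : (b * 4 - ln b) / (b * 4) <= n%:R by near: n; exact: nbhs_infty_ger.
rewrite ler_pdivrMr ?mulr_gt0// => Hn.
have h2 : b * a n <= b * (4 * n.+1%:R) by rewrite ler_pM2l.
have -> : e = 8 * b by rewrite /b mulrC divfK.
rewrite -natr1 in h2; lra.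
Unshelve. all: by end_near.
Qed.

Variable V : circle R -> R.

(** Only infinitely many times of fast growth are required, because the exponents are
upper limits. *)
Lemma fast_exponents w y c : 0 < c ->
  (forall K, exists2 n, (K <= n)%N &
     ~ slow_set V (slope V) n (expR (c * n%:R)) (w, y)) ->
  circle_C1 V -> (c%:E <= lyapunov_plus V w y)%E /\ (lyapunov_minus V w y <= - c%:E)%E.
Proof.
move=> c0 H V1.
have key (K : nat) : exists2 n, (K <= n)%N & exists i j, (0 < n)%N /\
    expR (c * n%:R) < `|orbit_matrix V w n y i j|.
  have [n Kn ns] := H K.+1; exists n; first exact: ltnW.
  apply: contrapT => /forallNP nij; apply: ns.
  have small i j : `|orbit_matrix V w n y i j| <= expR (c * n%:R).
    rewrite leNgt; apply/negP => h; apply: (nij i); exists j; split => //.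
    exact: leq_ltn_trans Kn.
  have E (v : R * R) j : row_of (tangent_orbit V (slope V) w n (y, v)).2 0 j =
      (row_of v *m orbit_matrix V w n y) 0 j by rewrite tangent_orbit_matrix.
  have E0 := E (1, 0); have E1 := E (0, 1).
  split; split => /=.
  - by have := E0 0; rewrite mxE [RHS]mxE sum2 !mxE /= mul1r mul0r addr0 => ->.
  - by have := E0 1; rewrite mxE [RHS]mxE sum2 !mxE /= mul1r mul0r addr0 => ->.
  - by have := E1 0; rewrite mxE [RHS]mxE sum2 !mxE /= mul1r mul0r add0r => ->.
  - by have := E1 1; rewrite mxE [RHS]mxE sum2 !mxE /= mul1r mul0r add0r => ->.
have rate n (x : R) : (0 < n)%N -> expR (c * n%:R) <= x -> (c%:E <= (n%:R^-1 * ln x)%:E)%E.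
  move=> n0 hx; rewrite lee_fin mulrC ler_pdivlMr ?ltr0n//.
  by rewrite -[leLHS]expRK ler_ln ?posrE ?expR_gt0//; exact: lt_le_trans (expR_gt0 _) hx.
split.
  apply: limn_esup_frequent => K; have [n Kn [i [j [n0 h]]]] := key K; exists n => //.
  rewrite torus_jacobian_orbit//; apply: rate => //.
  exact: le_trans (ltW h) (op_norm_ge _ _ _).
rewrite /lyapunov_minus leeN2.
apply: limn_esup_frequent => K; have [n Kn [i [j [n0 h]]]] := key K; exists n => //.
rewrite torus_jacobian_orbit//; apply: rate => //.
exact: le_trans (ltW h) (op_norm_inv_ge _ _ (det_orbit_matrix _ _ _ _)).
Qed.

Lemma flat_orbit_matrix (c : R) w n y : (forall x, V x = c) ->
  orbit_matrix V w n y = \matrix_(i, j) (if i == j then 1 else if i == 0 then 0 else n%:R).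
Proof.
move=> Vc.
have s0 x : slope V x = 0.
  by rewrite /slope (_ : V \o _ = cst c) ?derive1_cst//; apply/funext => t /=.
elim: n => [|n IH] /=; apply/matrixP => i j.
  by rewrite !mxE; have [->|->] := ord2 i; have [->|->] := ord2 j.
rewrite IH s0 [LHS]mxE sum2 !mxE.
by have [->|->] := ord2 i; have [->|->] := ord2 j; rewrite /= -?natr1; ring.
Qed.

Lemma flat_exponents w y : circle_C1 V -> (exists c, forall x, V x = c) ->
  lyapunov_plus V w y = 0%E /\ lyapunov_minus V w y = 0%E.
Proof.
move=> V1 [c Vc].
have E n := flat_orbit_matrix w n y Vc.
have small n i j : `|orbit_matrix V w n y i j| <= n.+1%:R.
  rewrite E mxE; have [_|_] := eqVneq i j; first by rewrite normr1 ler1n.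
  by have [_|_] := eqVneq i 0; rewrite ?normr0 ?ler0n// normr_nat ler_nat.
have one n : `|orbit_matrix V w n y 0 0| = 1 by rewrite E mxE eqxx normr1.
split.
  have H := @log_rate_cvg0 (fun n => op_norm (orbit_matrix V w n y)) _ _.
  rewrite /lyapunov_plus; under eq_fun do rewrite torus_jacobian_orbit//.
  apply: (cvg_limn_einf_sup (H _ _)).2 => n; last exact: op_norm_le.
  by rewrite -(one n); exact: op_norm_ge.
have H := @log_rate_cvg0 (fun n => op_norm (invmx (orbit_matrix V w n y))) _ _.
rewrite /lyapunov_minus; under eq_fun do rewrite torus_jacobian_orbit//.
have d n := det_orbit_matrix V w n y.
rewrite (cvg_limn_einf_sup (H _ _)).2 ?oppe0// => n; last exact: op_norm_inv_le.
by rewrite -(one n); exact: op_norm_inv_ge.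
Qed.

End lyapunov.

Theorem theorem1p4 (R : realType) (V : circle R -> R)
    (nu : probability (torus R) R)
    (rho : probability (seq_space (torus R)) R) :
  circle_C1 V ->
  nu `<< @haar2 R \/ vertical_line_measure nu ->
  is_power_measure nu rho ->
  (~ (exists c, forall x, V x = c) ->
    {ae (rho \x @haar2 R)%E, forall z : seq_space (torus R) * torus R,
      lyapunov_plus V z.1 z.2 <> 0%E /\ lyapunov_minus V z.1 z.2 <> 0%E}) /\
  ((exists c, forall x, V x = c) ->
    {ae (rho \x @haar2 R)%E, forall z : seq_space (torus R) * torus R,
      lyapunov_plus V z.1 z.2 = 0%E /\ lyapunov_minus V z.1 z.2 = 0%E}).
Proof.
move=> V1 nuP rhoP; split=> [Vnc|Vc]; last by apply: aeW => z; exact: flat_exponents.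
have mV := measurable_potential V1.
have mW := measurable_slope V1.
have [C C0 gap] := noise_gap nuP.
have [alpha [beta [ba upper lower]]] := slopes_differ V1 Vnc.
have [r r01 contr] := transfer_contraction mV mW C0 gap ba upper lower.
have [c c0 Hneg] := frequent_growth mV mW rhoP r01 contr.
apply: negligibleS Hneg => -[w y] /= Hz.
apply: contrapT => nK; apply: Hz.
have freq K : exists2 n, (K <= n)%N & ~ slow_set V (slope V) n (expR (c * n%:R)) (w, y).
  have /existsNP[k /not_implyP[Kk ns]] :
      ~ forall k, (K <= k)%N -> slow_set V (slope V) (4 * k) (expR (c * (4 * k)%:R)) (w, y).
    by move=> h; apply: nK; exists K.
  by exists (4 * k)%N => //; apply: (leq_trans Kk); rewrite leq_pmull.
have [p m] := fast_exponents c0 freq V1.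
split=> /= e; rewrite ?e in p; rewrite ?e in m.
  by move: p; rewrite lee_fin leNgt c0.
by move: m; rewrite -EFinN lee_fin oppr_ge0 leNgt c0.
Qed.
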